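(* Let $\big(\mathsf{X}^{DBM}_\infty(t);t\ge0\big)=\big(\alpha_i^{\pm}(t),\gamma_1(t),\gamma_2(t);t\ge0\big)$ be the Feller process on $\Omega$ corresponding to Dyson Brownian motions, i.e. the process with semigroup $P_\infty(t)$ on $\Omega$ uniquely determined by $P_\infty(t)\Lambda_N^\infty=\Lambda_N^\infty P^N_{DBM}(t)$ for all $t\ge0$, $N\ge1$. Then it is given, for all $t\ge0$, by $$\alpha_i^+(t)=\alpha_i^+(0)\ \ \forall i\ge1,\qquad \alpha_i^-(t)=\alpha_i^-(0)\ \ \forall i\ge1,\qquad \gamma_1(t)=\gamma_1(0),\qquad \gamma_2(t)=t+\gamma_2(0).$$
   Context: $W^N=\{x\in\mathbb{R}^N:x_1\le\cdots\le x_N\}$. $P^N_{DBM}(t)$ is the Feller semigroup on $W^N$ of Dyson Brownian motion, the solution of $$dX^N_i(t)=dW^N_i(t)+\sum_{j\ne i}\frac{1}{X^N_i(t)-X^N_j(t)}dt,\quad 1\le i\le N,$$ with independent standard Brownian motions $W_i^N$. It is known that $P^{N+1}_{DBM}(t)\Lambda_N^{N+1}=\Lambda_N^{N+1}P^N_{DBM}(t)$, where for $x\in W^{N+1}$, $\Lambda_N^{N+1}(x,\cdot)$ is the law of the ordered eigenvalues of the top-left $N\times N$ corner of $U^*\mathrm{diag}(x)U$, $U$ Haar distributed on $\mathbb{U}(N+1)$; this implies existence and uniqueness of the Feller semigroup $P_\infty(t)$. The space $\Omega$ is the set of $\omega=(\alpha^+,\alpha^-,\gamma_1,\delta)\in\mathbb{R}^\infty\times\mathbb{R}^\infty\times\mathbb{R}\times\mathbb{R}$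 with $\alpha_1^{\pm}\ge\alpha_2^{\pm}\ge\cdots\ge0$ and $\sum_i(\alpha_i^+)^2+\sum_i(\alpha_i^-)^2\le\delta$, with the product topology (locally compact, metrizable, countable base). Put $\gamma_2=\delta-\sum_i(\alpha_i^+)^2-\sum_i(\alpha_i^-)^2$ (so a point of $\Omega$ is equivalently described by $(\alpha^{\pm},\gamma_1,\gamma_2)$) and $$F_\omega(x)=e^{i\gamma_1x-\frac{\gamma_2}{2}x^2}\prod_{k\ge1}\frac{e^{-i\alpha_k^+x}}{1-i\alpha_k^+x}\prod_{k\ge1}\frac{e^{i\alpha_k^-x}}{1+i\alpha_k^-x}.$$ For $\omega\in\Omega$ let $M_\omega$ be the (ergodic) $\mathbb{U}(\infty)$-conjugation-invariant probability measure on the space $H$ of infinite Hermitian matrices with $\int_H e^{i\mathrm{Tr}(\mathrm{diag}(r_1,\dots,r_n,0,0,\dots)X)}M_\omega(dX)=\prod_{j=1}^nF_\omega(r_j)$ for all $n$ and $r_j\in\mathbb{R}$. The Markov kernel $\Lambda_N^\infty(\omega,\cdot)$ from $\Omega$ to $W^N$ is the law of the ordered eigenvalues of the top-left $N\times N$ corner of an $M_\omega$-distributed matrix. *)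

(* Defs.v *)
From HB Require Import structures.
From mathcomp Require Import all_boot all_order all_algebra.
From mathcomp Require Import all_classical all_reals all_analysis.
From mathcomp Require Import complex.
Set Implicit Arguments.
Unset Strict Implicit.
Unset Printing Implicit Defensive.
Import Order.TTheory GRing.Theory Num.Theory.
Import numFieldNormedType.Exports.
Local Open Scope classical_set_scope.
Local Open Scope ring_scope.

Definition borel (T : ptopologicalType) : Type :=
  g_sigma_algebraType (@open T).

HB.instance Definition _ (T : ptopologicalType) :=
  Measurable.copy (borel T) (g_sigma_algebraType (@open T)).

Definition C0_fun (R : realType) (T : ptopologicalType) (f : T -> R) : Prop :=
  continuous f /\
  forall e : R, 0 < e ->
    exists2 K : set T, compact K & forall x, ~ K x -> `|f x| < e.

(* Only the values of [P] at nonnegative times matter. *)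
Definition is_Feller_semigroup (R : realType) (T : ptopologicalType)
    (P : R -> R.-pker (borel T) ~> (borel T)) : Prop :=
  [/\ forall (x : T) (A : set (borel T)), measurable A -> P 0 x A = \d_(x : borel T) A,
      forall (s t : R) (x : T) (A : set (borel T)), 0 <= s -> 0 <= t ->
        measurable A ->
        P (s + t) x A = (\int[P s x]_y P t y A)%E,
      forall (t : R) (f : T -> R), 0 <= t -> C0_fun f ->
        C0_fun (fun x : T => \int[P t x]_y f y)
    & forall f : T -> R, C0_fun f -> forall e : R, 0 < e ->
        \forall t \near 0^'+, forall x : T,
          `|\int[P t x]_y f y - f x| < e].

Definition is_filtration (R : realType) d (S : measurableType d)
    (F : R -> set (set S)) : Prop :=
  (forall t : R, 0 <= t -> sigma_algebra setT (F t) /\ F t `<=` measurable) /\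
  (forall s t : R, 0 <= s -> s <= t -> F s `<=` F t).

Definition adapted (R : realType) d (S : measurableType d)
    (F : R -> set (set S)) d' (T : measurableType d') (X : R -> S -> T) : Prop :=
  forall (t : R) (A : set T), 0 <= t -> measurable A -> F t (X t @^-1` A).

Definition is_Markov_process (R : realType) (T : ptopologicalType)
    (P : R -> R.-pker (borel T) ~> (borel T))
    d (S : measurableType d) (Pr : probability S R)
    (F : R -> set (set S)) (X : R -> S -> borel T) : Prop :=
  [/\ is_filtration F, adapted F X
    & forall (s t : R) (G : set S) (A : set (borel T)), 0 <= s -> s <= t ->
        F s G -> measurable A ->
        Pr (G `&` (X t @^-1` A)) = (\int[Pr]_(w in G) P (t - s)%R (X s w) A)%E].

Definition is_cadlag (R : realType) (T : ptopologicalType) (f : R -> T) : Prop :=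
  (forall t : R, 0 <= t -> f s @[s --> t^'+] --> f t) /\
  (forall t : R, 0 < t -> cvg (f s @[s --> t^'-])).

Definition chamber (R : realType) (N : nat) : set 'rV[R]_N :=
  [set x | forall i j : 'I_N, (i <= j)%N -> x 0 i <= x 0 j].

Definition Weyl (R : realType) (N : nat) : Type := set_type (@chamber R N).

HB.instance Definition _ (R : realType) (N : nat) :=
  Topological.copy (Weyl R N) (set_type (@chamber R N)).

Lemma chamber0 (R : realType) (N : nat) : (0 : 'rV[R]_N) \in @chamber R N.
Proof. by rewrite inE => i j _; rewrite !mxE. Qed.

Definition weyl0 (R : realType) (N : nat) : Weyl R N := SigSub (chamber0 R N).

HB.instance Definition _ (R : realType) (N : nat) :=
  isPointed.Build (Weyl R N) (weyl0 R N).

Definition coords (R : realType) (N : nat) (x : Weyl R N) : 'rV[R]_N := \val x.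

(* The last clause says at once that the N coordinates of W t - W s are
   independent centered Gaussian variables of variance t - s, and that they are
   jointly independent of F s; the second argument of [normal_prob] is the
   standard deviation. *)
Definition is_Brownian_family (R : realType) d (S : measurableType d)
    (Pr : probability S R) (F : R -> set (set S)) (N : nat)
    (W : 'I_N -> R -> S -> R) : Prop :=
  [/\ forall i, adapted F (W i),
      forall i w, W i 0 w = 0,
      forall i w, {within `[0, +oo[%classic, continuous (fun t => W i t w)}
    & forall (s t : R) (G : set S) (A : 'I_N -> set R), 0 <= s -> s < t ->
        F s G -> (forall i, measurable (A i)) ->
        Pr (G `&` \bigcap_i ((fun w => W i t w - W i s w) @^-1` A i)) =
        (Pr G * \prod_(i < N) normal_prob 0 (Num.sqrt (t - s)) (A i))%E].

Definition dyson_drift (R : realType) (N : nat) (x : 'rV[R]_N) (i : 'I_N) : R :=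
  \sum_(j < N | j != i) (x 0 i - x 0 j)^-1.

(* (Weak) solutions started from [x0], a boundary point of the chamber being
   allowed. The noise is additive, so the equation is a pathwise integral
   equation. Since [0^-1 = 0] here, it is explicitly required that the drift be
   well defined at almost every time, besides being integrable. *)
Definition is_DBM_solution (R : realType) (N : nat) (x0 : Weyl R N)
    d (S : measurableType d) (Pr : probability S R) (F : R -> set (set S))
    (W : 'I_N -> R -> S -> R) (X : R -> S -> borel (Weyl R N)) : Prop :=
  [/\ is_filtration F, is_Brownian_family Pr F W & adapted F X] /\
  [/\ forall w, {within `[0, +oo[%classic,
                   continuous (fun t => X t w : Weyl R N)},
      forall w, X 0 w = x0
    & {ae Pr, forall w,
        [/\ {ae lebesgue_measure, forall s : R, 0 <= s ->
               forall i j : 'I_N, i != j ->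
                 coords (X s w) 0 i != coords (X s w) 0 j},
            forall (t : R) (i : 'I_N), 0 <= t ->
              lebesgue_measure.-integrable `[0, t]%classic
                (fun s => (dyson_drift (coords (X s w)) i)%:E)
          & forall (t : R) (i : 'I_N), 0 <= t ->
              coords (X t w) 0 i = coords x0 0 i + W i t w +
                \int[lebesgue_measure]_(s in `[0, t])
                  dyson_drift (coords (X s w)) i]}].

Definition is_DBM_semigroup (R : realType) (N : nat)
    (P : R -> R.-pker (borel (Weyl R N)) ~> (borel (Weyl R N))) : Prop :=
  is_Feller_semigroup P /\
  forall x0 : Weyl R N,
    exists d (S : measurableType d) (Pr : probability S R)
      (F : R -> set (set S)) (W : 'I_N -> R -> S -> R)
      (X : R -> S -> borel (Weyl R N)),
      is_DBM_solution x0 Pr F W X /\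
      forall (t : R) (A : set (borel (Weyl R N))), 0 <= t -> measurable A ->
        P t x0 A = Pr (X t @^-1` A).

Definition omega_set (R : realType) :
    set ({ptws nat -> R} * {ptws nat -> R} * R * R)%type :=
  [set u | let: (ap, am, _, delta) := u in
    [/\ forall k, 0 <= ap k.+1 <= ap k,
        forall k, 0 <= am k.+1 <= am k
      & (\sum_(0 <= k <oo) ((ap k) ^+ 2)%:E +
         \sum_(0 <= k <oo) ((am k) ^+ 2)%:E <= delta%:E)%E]].

Definition Omega (R : realType) : Type := set_type (@omega_set R).

HB.instance Definition _ (R : realType) :=
  Topological.copy (Omega R) (set_type (@omega_set R)).

Lemma omega_set0 (R : realType) :
  ((fun=> 0, fun=> 0, 0, 0) : {ptws nat -> R} * {ptws nat -> R} * R * R)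
    \in @omega_set R.
Proof.
rewrite inE /=; split=> [k|k|]; rewrite ?lexx //.
by rewrite !eseries0 ?adde0// => k _ _; rewrite expr0n.
Qed.

Definition omega0 (R : realType) : Omega R := SigSub (omega_set0 R).

HB.instance Definition _ (R : realType) :=
  isPointed.Build (Omega R) (omega0 R).

(* Indices are shifted: [alphap w k] is alpha^+_(k+1). *)
Definition alphap (R : realType) (w : Omega R) : nat -> R := (\val w).1.1.1.
Definition alpham (R : realType) (w : Omega R) : nat -> R := (\val w).1.1.2.
Definition gamma1 (R : realType) (w : Omega R) : R := (\val w).1.2.
Definition delta (R : realType) (w : Omega R) : R := (\val w).2.
Definition gamma2 (R : realType) (w : Omega R) : R :=
  delta w - limn (series (fun k => alphap w k ^+ 2))
          - limn (series (fun k => alpham w k ^+ 2)).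

Local Open Scope complex_scope.

Definition cexp (R : realType) (z : R[i]) : R[i] :=
  (expR (complex.Re z))%:C *
    (cos (complex.Im z) +i* sin (complex.Im z)).

(* [R[i]^o] carries the topology of the modulus. *)
Definition cprod_oo (R : realType) (u : nat -> R[i]) : R[i] :=
  limn (fun n => \prod_(0 <= k < n) u k : R[i]^o).

Definition F_omega (R : realType) (w : Omega R) (x : R) : R[i] :=
  cexp ('i%C * (gamma1 w * x)%:C - (gamma2 w / 2 * x ^+ 2)%:C) *
  cprod_oo (fun k => cexp (- ('i%C * (alphap w k * x)%:C)) /
                     (1 - 'i%C * (alphap w k * x)%:C)) *
  cprod_oo (fun k => cexp ('i%C * (alpham w k * x)%:C) /
                     (1 + 'i%C * (alpham w k * x)%:C)).

Definition hermitian_set (R : realType) :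
    set {ptws nat -> {ptws nat -> R[i]^o}} :=
  [set X | forall i j : nat, X j i = Num.conj (X i j : R[i])].

Definition H_oo (R : realType) : Type := set_type (@hermitian_set R).

HB.instance Definition _ (R : realType) :=
  Topological.copy (H_oo R) (set_type (@hermitian_set R)).

Lemma hermitian_set0 (R : realType) :
  ((fun _ _ => 0) : {ptws nat -> {ptws nat -> R[i]^o}}) \in @hermitian_set R.
Proof. by rewrite inE => i j; rewrite /= conjC0. Qed.

Definition H_oo0 (R : realType) : H_oo R := SigSub (hermitian_set0 R).

HB.instance Definition _ (R : realType) :=
  isPointed.Build (H_oo R) (H_oo0 R).

Definition entry (R : realType) (X : H_oo R) (i j : nat) : R[i] := \val X i j.

Definition corner (R : realType) (N : nat) (X : H_oo R) : 'M[R[i]]_N :=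
  \matrix_(i < N, j < N) entry X i j.

(* The embedding U(n) -> U(oo), as an infinite matrix. *)
Definition extend_mx (R : realType) (n : nat) (U : 'M[R[i]]_n) (i j : nat)
    : R[i] :=
  if (insub i, insub j) is (Some i', Some j') then U i' j' else (i == j)%:R.

(* The entries of U^* X U; [extend_mx U k i] vanishes for [k >= maxn n i.+1], so
   the finite sums contain all the nonzero terms. *)
Definition conj_entry (R : realType) (n : nat) (U : 'M[R[i]]_n) (X : H_oo R)
    (i j : nat) : R[i] :=
  \sum_(k < maxn n i.+1) \sum_(l < maxn n j.+1)
    Num.conj (extend_mx U k i) * entry X k l * extend_mx U l j.

Lemma conj_entry_hermitian (R : realType) (n : nat) (U : 'M[R[i]]_n)
    (X : H_oo R) :
  (conj_entry U X : {ptws nat -> {ptws nat -> R[i]^o}}) \in @hermitian_set R.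
Proof.
have hX i j : entry X j i = Num.conj (entry X i j).
  by have := valP X; rewrite inE => /(_ i j).
rewrite inE => i j; rewrite /conj_entry exchange_big /= rmorph_sum /=.
apply: eq_bigr => k _; rewrite rmorph_sum /=; apply: eq_bigr => l _.
by rewrite !rmorphM /= conjCK -hX mulrAC [RHS]mulrC mulrA mulrAC.
Qed.

Definition conjH (R : realType) (n : nat) (U : 'M[R[i]]_n) (X : borel (H_oo R))
    : borel (H_oo R) :=
  SigSub (conj_entry_hermitian U X).

Definition conj_invariant (R : realType) (mu : probability (borel (H_oo R)) R)
    : Prop :=
  forall (n : nat) (U : 'M[R[i]]_n) (A : set (borel (H_oo R))),
    U \is unitarymx -> measurable A -> mu (conjH U @^-1` A) = mu A.

Definition cintegral (R : realType) d (T : measurableType d)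
    (mu : {measure set T -> \bar R}) (f : T -> R[i]) : R[i] :=
  (\int[mu]_x complex.Re (f x)) +i* (\int[mu]_x complex.Im (f x)).

Definition has_charfun (R : realType) (mu : probability (borel (H_oo R)) R)
    (F : R -> R[i]) : Prop :=
  forall (n : nat) (r : 'I_n -> R),
    cintegral mu
      (fun X => cexp ('i%C * \tr (diag_mx (\row_j (r j)%:C) *m corner n X))) =
    \prod_(j < n) F (r j).

(* The eigenvalues in increasing order, with multiplicity; this is only used for
   Hermitian [A], for which they exist and are unique. *)
Definition eigenvalues (R : realType) (N : nat) (A : 'M[R[i]]_N) : Weyl R N :=
  xget point [set x : Weyl R N |
    char_poly A = \prod_(i < N) ('X - ((coords x 0 i)%:C)%:P)].

Definition corner_eigenvalues (R : realType) (N : nat) (X : borel (H_oo R))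
    : borel (Weyl R N) :=
  eigenvalues (corner N X).

(* Main.v *)
Require Import Defs.
From HB Require Import structures.
From mathcomp Require Import all_boot all_order all_algebra.
From mathcomp Require Import all_classical all_reals all_analysis.
From mathcomp Require Import measurable_realfun complex.
From mathcomp Require Import ring lra zify.
Set Implicit Arguments.
Unset Strict Implicit.
Unset Printing Implicit Defensive.
Import Order.TTheory GRing.Theory Num.Theory.
Import numFieldNormedType.Exports.
Local Open Scope classical_set_scope.
Local Open Scope ring_scope.

(* Only the trace of Dyson Brownian motion is needed: its drifts cancel, so the
   trace is a Brownian motion of variance N t, and the intertwining relations give
     E_w [F_{w'}(y) ^ N] = (e^{- t y^2 / 2} F_w(y)) ^ N
   under P_oo(t)(w, dw'). Writing
   log F_w(y) = \sum_n i^n c_n(w) y^n / n with c_1 = gamma_1, c_2 = delta and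
   c_n = \sum_k (alpha_k^+)^n + \sum_k (- alpha_k^-)^n for n >= 3, choose
   N = r k^n and y = 1 / (p k) and let k tend to infinity. If the differences
   Y_j = c_j(w') - c_j(w) - t [j = 2] vanish almost surely for all j < n, then
   E Re exp (r i^n Y_n / (n p^n)) = 1 follows by dominated convergence, whence
   Y_n = 0 almost surely: for even n the variable e^{a Y_n} has variance zero, and
   for odd n cos (a Y_n) is identically one at arbitrarily small scales a. The
   power sums c_n with n >= 3 determine the alpha_k^+ and alpha_k^-. *)

(** * Sums over the points of [Omega] *)

(** For a single [N] the intertwining gives only the mean of [F_w'(y) ^ N], which is far from fixing
    the law of [w']; the relations for all [N] have to be combined. As [y] is free, [N * y ^ n] can
    be held fixed while [N] grows: the terms of order above [n] in [ln F] disappear, and those of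
    order below [n] would blow up unless their differences already vanish, whence the induction on
    [n]. Since [i^n] is real for even [n] and imaginary for odd [n], the limit is a real exponential
    or a cosine. For the former, [r = 1] and [r = 2] give two moments; for the latter, a mean equal
    to the maximal value 1 determines the angle up to multiples of 2 pi, which varying [p] removes.

    The obstacle is domination: [exp (- N * lnA_gap)] may be large, and [delta w'] has no a priori
    bound. For [n <= 2] the inequality [|F_w'| <= 1] provides the bound; from [n = 3] on, the
    vanishing second difference fixes [delta w' = delta w + t], and with it the constants of all
    Taylor remainders. *)

Section sequence_sums.
Variable R : realType.
Implicit Types (a : nat -> R) (f g : R -> R) (C D M : R).

Definition sqsummable a (D : R) :=
  (forall n, \sum_(0 <= k < n) a k ^+ 2 <= D).

Definition ssum a f : R := limn (series (fun k => f (a k))).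

(** Each square is at most [D], and [D <= (1 + D) ^ 2]; the bound [1 + D] avoids the square root of
    [D]. *)
Lemma sqsummable_bound a D k : sqsummable a D -> `|a k| <= 1 + D.
Proof.
move=> /(_ k.+1); rewrite big_nat_recr//= => aD.
have s0 : 0 <= \sum_(0 <= i < k) a i ^+ 2 by apply: sumr_ge0 => i _; exact: sqr_ge0.
have D0 : 0 <= D by apply: le_trans aD; rewrite addr_ge0// sqr_ge0.
rewrite -ler_sqr ?nnegrE ?addr_ge0// real_normK ?num_real//.
have := sqr_ge0 D; have := sqr_ge0 (a k); move: D0 s0 aD.
by move: (a k ^+ 2) (\sum_(_ <= _ < _) _) => u v *; nra.
Qed.

(** The bound is local because powers and Taylor remainders are O(z^2) only on bounded sets; [M]
    will be [1 + D], which bounds every term of the sequence. Such functions can be summed over a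
    square-summable sequence. *)
Definition sqdominated M C f := forall z, `|z| <= M -> `|f z| <= C * z ^+ 2.

Lemma is_cvg_ssum a D C f : sqsummable a D -> sqdominated (1 + D) C f ->
  cvgn (series (fun k => f (a k))).
Proof.
move=> aD fC; apply: normed_cvg.
have C1 : sqdominated (1 + D) (`|C|) f.
  by move=> z /fC /le_trans; apply; rewrite ler_wpM2r ?sqr_ge0// ler_norm.
apply: (@series_le_cvg _ _ (fun k => `|C| * a k ^+ 2)) => [n|n|n|].
- exact: normr_ge0.
- by rewrite mulr_ge0 ?sqr_ge0.
- exact/C1/(sqsummable_bound _ aD).
- apply: nondecreasing_is_cvgn.
    by apply: nondecreasing_series => n _ _; rewrite mulr_ge0 ?sqr_ge0.
  exists (`|C| * D) => _ [n _ <-].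
  by rewrite /series/= -mulr_sumr ler_wpM2l.
Qed.

Lemma ssumD a D C C' f g : sqsummable a D -> sqdominated (1 + D) C f ->
  sqdominated (1 + D) C' g ->
  ssum a (fun z => f z + g z) = ssum a f + ssum a g.
Proof.
move=> aD fC gC; rewrite /ssum.
exact: (lim_seriesD (is_cvg_ssum aD fC) (is_cvg_ssum aD gC)).
Qed.

Lemma ssumZ a D C c f : sqsummable a D -> sqdominated (1 + D) C f ->
  ssum a (fun z => c * f z) = c * ssum a f.
Proof.
move=> aD fC; rewrite /ssum.
have := lim_seriesZ c (is_cvg_ssum aD fC).
by rewrite /GRing.scale/= => <-.
Qed.

End sequence_sums.

Section omega_sums.
Variable R : realType.
Implicit Types (w : Omega R).

Lemma omegaP w :
  [/\ forall k, 0 <= alphap w k.+1 <= alphap w k,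
      forall k, 0 <= alpham w k.+1 <= alpham w k
    & forall n, \sum_(0 <= k < n) alphap w k ^+ 2 +
                \sum_(0 <= k < n) alpham w k ^+ 2 <= delta w].
Proof.
rewrite /alphap /alpham /delta.
case: w => [[[[ap am] g] dl] /= H]; have := H; rewrite inE => -[h1 h2 h3].
split => // n; rewrite -lee_fin EFinD -!sumEFin.
by apply: le_trans h3; apply: leeD; apply: nneseries_lim_ge => k _ _;
  rewrite lee_fin sqr_ge0.
Qed.

Lemma alphap_ge0 w k : 0 <= alphap w k.
Proof. by have [/(_ k)/andP[h0 /(le_trans h0)]] := omegaP w. Qed.

Lemma alpham_ge0 w k : 0 <= alpham w k.
Proof. by have [_ /(_ k)/andP[h0 /(le_trans h0)]] := omegaP w. Qed.

Lemma alphap_nincr w : nonincreasing_seq (alphap w).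
Proof. by apply/nonincreasing_seqP => k; have [/(_ k)/andP[]] := omegaP w. Qed.

Lemma alpham_nincr w : nonincreasing_seq (alpham w).
Proof. by apply/nonincreasing_seqP => k; have [_ /(_ k)/andP[]] := omegaP w. Qed.

Lemma sqsummable_alphap w : sqsummable (alphap w) (delta w).
Proof.
move=> n; have [_ _ /(_ n)] := omegaP w; apply: le_trans.
by rewrite lerDl sumr_ge0// => i _; exact: sqr_ge0.
Qed.

Lemma sqsummable_alphaNm w : sqsummable (fun k => - alpham w k) (delta w).
Proof.
move=> n; have [_ _ /(_ n)] := omegaP w; apply: le_trans.
under eq_bigr do rewrite sqrrN.
by rewrite lerDr sumr_ge0// => i _; exact: sqr_ge0.
Qed.

Lemma delta_ge0 w : 0 <= delta w.
Proof. by have [_ _ /(_ 0%N)] := omegaP w; rewrite !big_geq// addr0. Qed.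

(** The alpha^- enter with a minus sign because their factor in [F_omega] is the alpha^+ factor
    evaluated at [- alpham w k]. *)
Definition asum w f := ssum (alphap w) f + ssum (fun k => - alpham w k) f.

Notation dom w := (sqdominated (1 + delta w)).

(** The two sums of squares are bounded together by [delta w], which gives the constant [C] and not
    [2 * C]. [lnA_ge0] depends on this sharp constant. *)
Lemma asum_norm_le w C f : 0 <= C -> dom w C f -> `|asum w f| <= C * delta w.
Proof.
move=> C0 fC.
have cp := is_cvg_ssum (sqsummable_alphap w) fC.
have cm := is_cvg_ssum (sqsummable_alphaNm w) fC.
have partial n : `|series (fun k => f (alphap w k)) n +
                   series (fun k => f (- alpham w k)) n| <= C * delta w.
  have [_ _ /(_ n) aD] := omegaP w.
  rewrite (le_trans (ler_normD _ _))//.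
  rewrite (le_trans (lerD (ler_norm_sum _ _ _) (ler_norm_sum _ _ _)))//.
  rewrite (le_trans (lerD
    (ler_sum _ (fun k _ => fC _ (sqsummable_bound k (sqsummable_alphap w))))
    (ler_sum _ (fun k _ => fC _ (sqsummable_bound k (sqsummable_alphaNm w))))))//.
  by rewrite -!mulr_sumr -mulrDr ler_wpM2l//; under [X in _ + X]eq_bigr do rewrite sqrrN.
have cpm := is_cvgD cp cm.
rewrite /asum /ssum -limD// ler_norml; apply/andP; split.
  apply: limr_ge; [exact: cpm|apply: nearW => n].
  by have := partial n; rewrite ler_norml => /andP[].
apply: limr_le; [exact: cpm|apply: nearW => n].
by have := partial n; rewrite ler_norml => /andP[].
Qed.

Lemma asumD w C C' f g : dom w C f -> dom w C' g ->
  asum w (fun z => f z + g z) = asum w f + asum w g.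
Proof.
move=> fC gC; rewrite /asum (ssumD (sqsummable_alphap w) fC gC).
by rewrite (ssumD (sqsummable_alphaNm w) fC gC) addrACA.
Qed.

Lemma asumZ w C c f : dom w C f -> asum w (fun z => c * f z) = c * asum w f.
Proof.
move=> fC; rewrite /asum (ssumZ _ (sqsummable_alphap w) fC).
by rewrite (ssumZ _ (sqsummable_alphaNm w) fC) mulrDr.
Qed.

Lemma eq_asum w f g : f =1 g -> asum w f = asum w g.
Proof. by move=> /funext ->. Qed.

Lemma asum_sqr w : asum w (fun z => z ^+ 2) = delta w - gamma2 w.
Proof.
rewrite /asum /ssum /gamma2.
have -> : (fun k => (- alpham w k) ^+ 2) = (fun k => alpham w k ^+ 2).
  by apply/funext => k; rewrite sqrrN.
ring.
Qed.

End omega_sums.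

(** * The logarithm of [F_omega] *)

Section polar_form.
Variable R : realType.
Implicit Types (w : Omega R) (x y t : R).
Local Open Scope complex_scope.

Lemma cexpD (z1 z2 : R[i]) : cexp (z1 + z2) = cexp z1 * cexp z2.
Proof.
case: z1 z2 => [a b] [c d]; rewrite /cexp /= expRD cosD sinD.
by apply/eqP; rewrite eq_complex /=; apply/andP; split; apply/eqP; ring.
Qed.

Lemma cexpE (a b : R) : cexp (a +i* b) = (expR a * cos b) +i* (expR a * sin b).
Proof.
by apply/eqP; rewrite eq_complex /=; apply/andP; split; apply/eqP; ring.
Qed.

Lemma cexp0 : cexp (0 : R[i]) = 1.
Proof.
by rewrite cexpE expR0 cos0 sin0 mulr0 mulr1.
Qed.

Lemma cexp_neq0 (z : R[i]) : cexp z != 0.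
Proof.
apply/negP => /eqP z0; have := cexp0.
by rewrite -(subrr z) cexpD z0 mul0r => /eqP; rewrite eq_sym oner_eq0.
Qed.

Lemma cexp_sum (I : Type) (r : seq I) (z : I -> R[i]) :
  \prod_(i <- r) cexp (z i) = cexp (\sum_(i <- r) z i).
Proof.
elim: r => [|i r IH]; first by rewrite !big_nil cexp0.
by rewrite !big_cons IH cexpD.
Qed.

Lemma cexpX (z : R[i]) n : cexp z ^+ n = cexp (z *+ n).
Proof.
elim: n => [|n IH]; first by rewrite mulr0n cexp0.
by rewrite exprS IH mulrS cexpD.
Qed.

(** The logarithm of the modulus of 1 - i t; the argument is - atan t. *)
Definition lnmod t : R := ln (1 + t ^+ 2) / 2.

Lemma one_sub_it_polar t : 1 - 'i%C * t%:C = cexp (lnmod t -i* atan t) :> R[i].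
Proof.
have p0 : 0 < 1 + t ^+ 2 by rewrite ltr_pwDl// sqr_ge0.
have s0 : Num.sqrt (1 + t ^+ 2) != 0 by rewrite gt_eqF// sqrtr_gt0.
have E : expR (lnmod t) = Num.sqrt (1 + t ^+ 2).
  have : (expR (lnmod t)) ^+ 2 = 1 + t ^+ 2.
    rewrite -expRM_natl.
    rewrite /lnmod mulrC divfK ?pnatr_eq0// lnK //.
  by move=> <-; rewrite sqrtr_sqr ger0_norm// expR_ge0.
have T : sin (atan t) = t * cos (atan t).
  have := atanK t; rewrite /tan => {2}<-; rewrite divfK// cos_atan.
  by rewrite invr_neq0.
rewrite cexpE cosN sinN E T cos_atan.
apply/eqP; rewrite eq_complex /= !(mul0r, mulr0, mul1r, subr0, addr0, add0r).
apply/andP; split; apply/eqP; first by rewrite mulfV// oppr0 subr0.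
by rewrite mulrN mulrCA mulfV// mulr1.
Qed.

Lemma cexp_div_polar t :
  cexp (- ('i%C * t%:C)) / (1 - 'i%C * t%:C) =
  cexp ((- lnmod t) +i* (atan t - t)) :> R[i].
Proof.
have d0 := cexp_neq0 (lnmod t -i* atan t).
rewrite one_sub_it_polar; apply: (mulIf d0); rewrite divfK// -cexpD.
by congr cexp; apply/eqP; rewrite eq_complex /=; apply/andP; split; apply/eqP; ring.
Qed.

Lemma cvg_real_complex (u : nat -> R) (l : R) : u @ \oo --> l ->
  (fun n => (u n)%:C : R[i]^o) @ \oo --> (l%:C : R[i]^o).
Proof.
move=> ul; apply/(@cvgrPdist_lt _ R[i]^o) => e e0.
have e1 : 0 < complex.Re e by move: e0; rewrite ltcE /= => /andP[].
have e2 : (complex.Re e)%:C = e :> R[i].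
  by apply/RRe_real; rewrite ger0_real// ltW.
move/cvgrPdist_lt : ul => /(_ _ e1); apply: filterS => n.
rewrite -ltcR e2; apply: le_lt_trans.
by rewrite normc_def /= subr0 expr0n addr0 sqrtr_sqr.
Qed.

Lemma cvg_complex (u v : nat -> R) (a b : R) :
  u @ \oo --> a -> v @ \oo --> b ->
  (fun n => u n +i* v n : R[i]^o) @ \oo --> ((a +i* b) : R[i]^o).
Proof.
move=> ua vb.
have E (x y : R) : x +i* y = x%:C + 'i%C * y%:C by exact: (complexE (x +i* y)).
rewrite E; under eq_fun do rewrite E.
apply: (@cvgD _ R[i]^o); first exact: cvg_real_complex.
apply: cvgM; first exact: cvg_cst.
exact: cvg_real_complex.
Qed.

Lemma cprod_oo_cexp (a b : nat -> R) :
  cvgn (series a) -> cvgn (series b) ->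
  cprod_oo (fun k => cexp (a k +i* b k)) =
  cexp (limn (series a) +i* limn (series b)).
Proof.
move=> ca cb; rewrite /cprod_oo.
apply: (@cvg_lim R[i]^o); first exact: (@norm_hausdorff _ R[i]^o).
have -> : (fun n => \prod_(0 <= k < n) cexp (a k +i* b k)) =
   (fun n => (expR (series a n) * cos (series b n)) +i*
             (expR (series a n) * sin (series b n)) : R[i]^o).
  apply/funext => n; rewrite cexp_sum -cexpE; congr cexp.
  rewrite /series /=; elim/big_rec3: _ => //= i z x y _ ->.
  by [].
rewrite cexpE; apply: cvg_complex; apply: cvgM.
- by apply: (cvg_comp _ _ ca); exact: continuous_expR.
- by apply: (cvg_comp _ _ cb); exact: continuous_cos.
- by apply: (cvg_comp _ _ ca); exact: continuous_expR.
- by apply: (cvg_comp _ _ cb); exact: continuous_sin.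
Qed.

End polar_form.

(** * Taylor remainders of [lnmod] and [atan] *)

Section taylor_remainders.
Variable R : realType.
Implicit Types (f g df : R -> R) (t : R).

Lemma pow_bound_of_derive_ge0 g df n t : (forall s, is_derive s (1:R) g (df s)) ->
  g 0 = 0 -> (forall s, 0 <= s -> df s <= s ^+ n) -> 0 <= t ->
  g t <= t ^+ n.+1 / n.+1%:R.
Proof.
move=> dg g0 dfn t0.
pose h := fun s => s ^+ n.+1 / n.+1%:R - g s.
have dh s : is_derive s (1:R) h (s ^+ n - df s).
  have -> : h = (n.+1%:R^-1 \*: ((id : R -> R) ^+ n.+1 : R -> R) : R -> R) - g.
    by apply/funext => x; rewrite /h !fctE /GRing.scale/= mulrC.
  apply: is_derive_eq. rewrite /GRing.scale/= mulr1 mulrA mulVf ?pnatr_eq0//.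
  by rewrite mul1r.
have ch : {within `[0, t], continuous h}.
  by apply: derivable_within_continuous => z _; apply: ex_derive.
move: t0; rewrite le_eqVlt => /predU1P[<-|t0].
  by rewrite g0 expr0n mul0r.
have [c + E] := MVT t0 (fun s _ => dh s) ch.
rewrite in_itv/= => /andP[c0 _].
have : 0 <= h t - h 0 by rewrite E mulr_ge0// subr_ge0; [exact/dfn/ltW|exact: ltW].
by rewrite /h g0 expr0n /= mul0r !subr0 subr_ge0.
Qed.

(** The one-sided bound is applied to [g] and [- g] for nonnegative arguments, then to the reflected
    function for negative ones. *)
Lemma pow_bound_of_derive g df n t : (forall s, is_derive s (1:R) g (df s)) ->
  g 0 = 0 -> (forall s, `|df s| <= `|s| ^+ n) ->
  `|g t| <= `|t| ^+ n.+1 / n.+1%:R.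
Proof.
have pos g' df' t' : (forall s, is_derive s (1:R) g' (df' s)) ->
    g' 0 = 0 -> (forall s, `|df' s| <= `|s| ^+ n) -> 0 <= t' ->
    `|g' t'| <= t' ^+ n.+1 / n.+1%:R.
  move=> dg g0 dfn t0; rewrite ler_norml lerNl; apply/andP; split.
    apply: (@pow_bound_of_derive_ge0 (- g') (fun s => - df' s)) => //.
      by rewrite fctE g0 oppr0.
    move=> s s0; rewrite -{2}(ger0_norm s0); apply: le_trans (dfn s).
    by rewrite -normrN ler_norm.
  apply: (@pow_bound_of_derive_ge0 g' df') => //.
  move=> s s0; rewrite -{2}(ger0_norm s0); apply: le_trans (dfn s).
  exact: ler_norm.
move=> dg g0 dfn.
have [t0|t0] := leP 0 t; first by rewrite (ger0_norm t0); exact: (pos g df).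
rewrite (ltr0_norm t0).
have := pos (g \o -%R) (fun s => - df (- s)) (- t); rewrite /= opprK; apply.
- move=> s; rewrite -mulrN1.
  by apply: is_derive1_comp.
- by rewrite oppr0.
- by move=> s; rewrite normrN -(normrN s); exact: dfn.
- by rewrite oppr_ge0 ltW.
Qed.

(* When [f' t = t ^+ i / (1 + t ^+ 2)], this is [f] minus its Taylor polynomial
   with [m] terms. *)
Fixpoint taylor_rem f (i m : nat) t : R :=
  if m is m'.+1 then
    taylor_rem f i m' t - (-1) ^+ m' * (t ^+ (i + m'.*2).+1 / (i + m'.*2).+1%:R)
  else f t.

(** This is the geometric expansion of 1 / (1 + t^2): since t^n / (1 + t^2) - t^n = - t^(n+2) / (1 +
    t^2), subtracting one more Taylor term keeps the shape of the derivative, raises its exponent by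
    two and flips its sign. *)
Lemma is_derive_taylor_rem f i : (forall t, is_derive t (1:R) f (t ^+ i / (1 + t ^+ 2))) ->
  forall m t, is_derive t (1:R) (taylor_rem f i m)
    ((-1) ^+ m * (t ^+ (i + m.*2) / (1 + t ^+ 2))).
Proof.
move=> df; elim=> [|m IH] t; first by rewrite mul1r addn0.
have p0 : 1 + t ^+ 2 != 0 by rewrite gt_eqF// ltr_pwDl// sqr_ge0.
set n := (i + m.*2)%N.
have -> : taylor_rem f i m.+1 = taylor_rem f i m -
   (((-1) ^+ m / n.+1%:R) \*: ((id : R -> R) ^+ n.+1 : R -> R) : R -> R).
  by apply/funext => x; rewrite !fctE /= -/n /GRing.scale/=; ring.
apply: is_derive_eq; rewrite /GRing.scale/= mulr1.
have -> : (i + m.+1.*2)%N = n.+2 by rewrite doubleS !addnS.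
rewrite -/n !exprS.
have := pnatr_eq0 R n.+1; move/negbT => n0.
field.
by rewrite p0/= -natr1 in n0 *.
Qed.

(** The derivative of the remainder is at most a power because 1 / (1 + t^2) <= 1. The bound
    therefore holds for every real [t], also outside the disc of convergence of the series. *)
Lemma taylor_rem_bound f i : (forall t, is_derive t (1:R) f (t ^+ i / (1 + t ^+ 2))) ->
  f 0 = 0 ->
  forall m t, `|taylor_rem f i m t| <= `|t| ^+ (i + m.*2).+1 / (i + m.*2).+1%:R.
Proof.
move=> df f0 m t.
apply: pow_bound_of_derive (is_derive_taylor_rem df m) _ _.
  by elim: m => //= m ->; rewrite expr0n/= mul0r mulr0 subrr.
move=> s; rewrite normrM normrX normrN1 expr1n mul1r normrM normrX.
rewrite ler_piMr ?exprn_ge0// normfV ger0_norm ?addr_ge0 ?sqr_ge0//.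
by rewrite invf_le1 ?lerDl ?sqr_ge0// ltr_pwDl// sqr_ge0.
Qed.

Lemma is_derive_lnmod t : is_derive t (1:R) (@lnmod R) (t ^+ 1 / (1 + t ^+ 2)).
Proof.
have p0 : 0 < 1 + t ^+ 2 by rewrite ltr_pwDl// sqr_ge0.
have -> : @lnmod R = (2^-1 \*: (@ln R \o (cst 1 + (id : R -> R) ^+ 2))).
  by apply/funext => x; rewrite /lnmod/= fctE /GRing.scale/= mulrC.
have d1 : is_derive ((cst 1 + (id : R -> R) ^+ 2) t) 1 (@ln R) (1 + t ^+ 2)^-1.
  exact: is_derive1_ln.
apply: is_derive_eq.
rewrite /GRing.scale/= mulr1 add0r. field.
by rewrite gt_eqF.
Qed.

Lemma lnmod0 : @lnmod R 0 = 0.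
Proof. by rewrite /lnmod expr0n addr0 ln1 mul0r. Qed.

Lemma is_derive_atan_exp t : is_derive t (1:R) (@atan R) (t ^+ 0 / (1 + t ^+ 2)).
Proof. by rewrite expr0 mul1r; exact: is_derive1_atan. Qed.

Lemma lnmod_rem_bound m t :
  `|taylor_rem (@lnmod R) 1 m t| <= `|t| ^+ m.+1.*2 / m.+1.*2%:R.
Proof. by rewrite doubleS; exact: (taylor_rem_bound is_derive_lnmod lnmod0 m t). Qed.

Lemma atan_rem_bound m t :
  `|taylor_rem (@atan R) 0 m t| <= `|t| ^+ m.*2.+1 / m.*2.+1%:R.
Proof. exact: (taylor_rem_bound is_derive_atan_exp (@atan0 R) m t). Qed.

End taylor_remainders.

(** * Expansion of the logarithm of [F_omega] in power sums *)

Section cumulants.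
Variable R : realType.
Implicit Types (w : Omega R) (y t : R).
Notation dom w := (sqdominated (1 + delta w)).

(** Of the [k.+2] factors [z], two are kept as [z ^+ 2] and the other [k] are bounded by [M]. *)
Lemma sqdominated_pow (M c : R) k f y : 0 <= c ->
  (forall z, `|f z| <= c * `|z * y| ^+ k.+2) ->
  sqdominated M (c * (M ^+ k * `|y| ^+ k.+2)) f.
Proof.
move=> c0 fc z zM; rewrite (le_trans (fc z))// -mulrA ler_wpM2l//.
have -> : `|z * y| ^+ k.+2 = `|z| ^+ k * `|y| ^+ k.+2 * z ^+ 2.
  by rewrite normrM exprMn -(real_normK (num_real z)) -addn2 exprD; ring.
rewrite ler_wpM2r ?sqr_ge0// ler_wpM2r ?exprn_ge0//.
by rewrite lerXn2r// nnegrE// (le_trans _ zM).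
Qed.

Lemma natV_le1 n : (n.+1%:R : R)^-1 <= 1.
Proof. by rewrite invf_le1// ler1n. Qed.

Lemma lnmod_rem1 t : taylor_rem (@lnmod R) 1 1 t = lnmod t - t ^+ 2 / 2.
Proof. by rewrite /= expr0 mul1r. Qed.

Lemma lnmod_rem_dom w m y :
  dom w ((m.+1.*2%:R)^-1 * ((1 + delta w) ^+ m.*2 * `|y| ^+ m.+1.*2))
    (fun z => taylor_rem (@lnmod R) 1 m (z * y)).
Proof.
rewrite doubleS; apply: sqdominated_pow => // z.
by rewrite [leRHS]mulrC -doubleS; exact: lnmod_rem_bound.
Qed.

Lemma atan_rem_dom w m y :
  dom w ((m.+1.*2.+1%:R)^-1 * ((1 + delta w) ^+ m.*2.+1 * `|y| ^+ m.+1.*2.+1))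
    (fun z => taylor_rem (@atan R) 0 m.+1 (z * y)).
Proof.
rewrite doubleS; apply: sqdominated_pow => // z.
by rewrite [leRHS]mulrC -doubleS; exact: atan_rem_bound.
Qed.

Lemma pow_dom w k : dom w (1 * ((1 + delta w) ^+ k * `|1 : R| ^+ k.+2))
  (fun z => z ^+ k.+2).
Proof. by apply: sqdominated_pow => // z; rewrite mulr1 mul1r normrX. Qed.

(* [F_omega w y = exp (- lnA w y + i argB w y)]; the quadratic part of [lnA] is
   separated since [delta w] exceeds the sum of the [z ^+ 2] by [gamma2 w]. *)
Definition lnA w y :=
  delta w * y ^+ 2 / 2 + asum w (fun z => taylor_rem (@lnmod R) 1 1 (z * y)).

Definition argB w y :=
  gamma1 w * y + asum w (fun z => taylor_rem (@atan R) 0 1 (z * y)).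

(** Each factor is put in polar form, so that the two products become exponentials of one [asum].
    The convergence factors turn atan into atan z - z, which is summable, and adding [asum w (fun z
    => z ^+ 2) = delta w - gamma2 w] to the Gaussian term replaces [gamma2] by [delta]. *)
Lemma F_omegaE w y : F_omega w y = cexp (Complex (- lnA w y) (argB w y)).
Proof.
pose fl z := - lnmod (z * y); pose fa z := atan (z * y) - z * y.
have domfl : dom w (2^-1 * ((1 + delta w) ^+ 0 * `|y| ^+ 2)) fl.
  by move=> z /(@lnmod_rem_dom w 0 y z); rewrite /fl normrN.
have domfa := @atan_rem_dom w 0 y.
have faE : (fun z => taylor_rem (@atan R) 0 1 (z * y)) = fa.
  by apply/funext => z; rewrite /fa /= expr0 mul1r expr1 divr1.
rewrite faE in domfa.
have cl1 := is_cvg_ssum (sqsummable_alphap w) domfl.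
have cl2 := is_cvg_ssum (sqsummable_alphaNm w) domfl.
have ca1 := is_cvg_ssum (sqsummable_alphap w) domfa.
have ca2 := is_cvg_ssum (sqsummable_alphaNm w) domfa.
rewrite /F_omega.
have -> : (fun k => cexp (- ('i%C * (alphap w k * y)%:C%C)) /
                     (1 - 'i%C * (alphap w k * y)%:C%C)) =
          (fun k => cexp (Complex (fl (alphap w k)) (fa (alphap w k)))).
  by apply/funext => k; rewrite cexp_div_polar.
have -> : (fun k => cexp ('i%C * (alpham w k * y)%:C%C) /
                     (1 + 'i%C * (alpham w k * y)%:C%C)) =
          (fun k => cexp (Complex (fl (- alpham w k)) (fa (- alpham w k)))).
  apply/funext => k; rewrite -cexp_div_polar mulNr rmorphN mulrN !opprK.
  by [].
rewrite !cprod_oo_cexp// -!cexpD; congr cexp.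
rewrite /argB faE /lnA.
have -> : asum w (fun z => taylor_rem (@lnmod R) 1 1 (z * y)) =
    - asum w fl - y ^+ 2 / 2 * (delta w - gamma2 w).
  rewrite -asum_sqr -mulN1r -mulNr -(asumZ _ domfl) -(asumZ _ (@pow_dom w 0)).
  rewrite -(@asumD _ _ (2^-1 * ((1 + delta w) ^+ 0 * `|y| ^+ 2))
                    (y ^+ 2 / 2)).
  - by apply: eq_asum => z; rewrite lnmod_rem1 /fl; field.
  - by move=> z zM; rewrite mulN1r [leLHS]normrN; exact: domfl.
  - move=> z zM; rewrite normrM normrN.
    by rewrite !ger0_norm ?sqr_ge0// divr_ge0 ?sqr_ge0.
rewrite /asum /ssum /=.
apply/eqP; rewrite eq_complex /=; by apply/andP; split; apply/eqP; field.
Qed.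

(** From 0 <= ln (1 + s^2) / 2 <= s^2 / 2 with s = z y. In contrast to [lnmod_rem_dom], the constant
    is sharp and independent of [w]. *)
Lemma lnmod_rem1_dom w y :
  dom w (y ^+ 2 / 2) (fun z => taylor_rem (@lnmod R) 1 1 (z * y)).
Proof.
move=> z zM; rewrite lnmod_rem1.
have -> : y ^+ 2 / 2 * z ^+ 2 = (z * y) ^+ 2 / 2 by ring.
have l0 : 0 <= lnmod (z * y) by rewrite divr_ge0// ln_ge0// lerDl sqr_ge0.
have l1 : lnmod (z * y) <= (z * y) ^+ 2 / 2.
  have := lnmod_rem_bound 0 (z * y).
  by rewrite real_normK ?num_real// ger0_norm.
by rewrite ler_norml; apply/andP; split; lra.
Qed.

(** This is the inequality |F_omega| <= 1: the sum of the remainders is at least - delta y^2 / 2,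
    which the quadratic term of [lnA] exactly compensates. *)
Lemma lnA_ge0 w y : 0 <= lnA w y.
Proof.
have := asum_norm_le _ (@lnmod_rem1_dom w y).
rewrite divr_ge0 ?sqr_ge0// => /(_ isT).
by rewrite ler_norml /lnA => /andP[+ _]; lra.
Qed.

Lemma lnA_le w y : lnA w y <= delta w * y ^+ 2.
Proof.
have := asum_norm_le _ (@lnmod_rem1_dom w y).
rewrite divr_ge0 ?sqr_ge0// => /(_ isT).
by rewrite ler_norml /lnA => /andP[_ +]; lra.
Qed.

(* Formally, [ln (F_omega w y)] is the sum over [n] of [i^n * cum w n * y^n / n]. *)
Definition cum w n : R :=
  match n with
  | 0 => 0 | 1 => gamma1 w | 2 => delta w
  | _ => asum w (fun z => z ^+ n)
  end.

(** Each induction step moves one Taylor term out of the remainder; the sum splits because the power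
    and the next remainder are both dominated. The term [j = 0] comes from the definition of [lnA],
    which is why [cum w 2] is [delta w] and not a power sum. *)
Lemma lnA_cum w y m : lnA w y =
  \sum_(j < m.+1) (-1) ^+ j * cum w j.+1.*2 * y ^+ j.+1.*2 / j.+1.*2%:R +
  asum w (fun z => taylor_rem (@lnmod R) 1 m.+1 (z * y)).
Proof.
elim: m => [|m ->].
  by rewrite big_ord_recl big_ord0 addr0 expr0 mul1r.
rewrite [in RHS]big_ord_recr /= -[in RHS]addrA; congr (_ + _).
pose c := (-1) ^+ m.+1 * y ^+ m.+2.*2 / m.+2.*2%:R.
have d := @lnmod_rem_dom w m.+2 y.
rewrite -[asum w (fun z => z ^+ _)]/(asum w (fun z => z ^+ m.+2.*2)).
have dp := @pow_dom w m.+1.*2; rewrite -doubleS in dp.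
transitivity (c * asum w (fun z => z ^+ m.+2.*2) +
   asum w (fun z => taylor_rem (@lnmod R) 1 m.+2 (z * y))); last first.
  by rewrite /c; congr (_ + _); ring.
rewrite -(asumZ _ dp) -(@asumD _ _ (`|c| * (1 * ((1 + delta w) ^+ m.+1.*2 * `|1 : R| ^+ m.+2.*2))) _ _ _ _ d).
  apply: eq_asum => z; rewrite [in RHS]/= -/(taylor_rem (@lnmod R) 1 m.+1 (z * y)).
  have -> : (1 + m.+1.*2).+1 = m.+2.*2 by rewrite doubleS.
  by rewrite /c exprMn; ring.
by move=> z /dp zC; rewrite normrM -[leRHS]mulrA ler_wpM2l.
Qed.

Lemma argB_cum w y m : argB w y =
  \sum_(j < m.+1) (-1) ^+ j * cum w j.*2.+1 * y ^+ j.*2.+1 / j.*2.+1%:R +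
  asum w (fun z => taylor_rem (@atan R) 0 m.+1 (z * y)).
Proof.
elim: m => [|m ->].
  by rewrite big_ord_recl big_ord0 addr0 expr0 mul1r divr1 expr1.
rewrite [in RHS]big_ord_recr /= -[in RHS]addrA; congr (_ + _).
pose c := (-1) ^+ m.+1 * y ^+ m.+1.*2.+1 / m.+1.*2.+1%:R.
have d := @atan_rem_dom w m.+1 y.
rewrite -[asum w (fun z => z ^+ _)]/(asum w (fun z => z ^+ m.+1.*2.+1)).
have dp := @pow_dom w m.*2.+1.
transitivity (c * asum w (fun z => z ^+ m.+1.*2.+1) +
   asum w (fun z => taylor_rem (@atan R) 0 m.+2 (z * y))); last first.
  by rewrite /c; congr (_ + _); ring.
rewrite -(asumZ _ dp) -(@asumD _ _ (`|c| * (1 * ((1 + delta w) ^+ m.*2.+1 * `|1 : R| ^+ m.*2.+3))) _ _ _ _ d).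
  apply: eq_asum => z; rewrite [in RHS]/= -/(taylor_rem (@atan R) 0 m.+1 (z * y)).
  by rewrite /c add0n exprMn; ring.
by move=> z /dp zC; rewrite normrM -[leRHS]mulrA ler_wpM2l.
Qed.

End cumulants.

(** * Differences of cumulants and their leading terms *)

Section cumulant_gap.
Variable R : realType.
Implicit Types (w : Omega R) (y t : R).

Definition cum_gap t w w' n : R := cum w' n - (cum w n + (n == 2%N)%:R * t).

(** Together with [argB_gap], it describes the quotient of F_w'(y) by e^(- t y^2 / 2) F_w(y), which
    equals exp (- [lnA_gap] + i [argB_gap]). *)
Definition lnA_gap t w w' y : R := lnA w' y - (lnA w y + t * y ^+ 2 / 2).

Definition argB_gap w w' y : R := argB w' y - argB w y.

Definition rem_cst w w' n : R := (1 + delta w) ^+ n + (1 + delta w') ^+ n.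

(** The Taylor coefficient [a] is dropped and [delta w] is rounded up to [1 + delta w], so that the
    later constants are plain powers of [1 + delta w], which are monotone in [delta w] and in the
    exponent. *)
Lemma asum_norm_le1 w (a b : R) f : 0 <= a <= 1 -> 0 <= b ->
  sqdominated (1 + delta w) (a * b) f -> `|asum w f| <= b * (1 + delta w).
Proof.
move=> /andP[a0 a1] b0 d; have d0 := delta_ge0 w.
apply: le_trans (asum_norm_le _ d) _; first exact: mulr_ge0.
apply: ler_pM => //; [exact: mulr_ge0|exact: ler_piMl|by rewrite lerDr].
Qed.

Lemma lnmod_rem_asum_le w m y :
  `|asum w (fun z => taylor_rem (@lnmod R) 1 m (z * y))| <=
  (1 + delta w) ^+ m.*2.+1 * `|y| ^+ m.+1.*2.
Proof.
have d0 := delta_ge0 w.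
apply: le_trans (asum_norm_le1 _ _ (@lnmod_rem_dom _ w m y)) _.
- by rewrite invr_ge0 ler0n doubleS natV_le1.
- by rewrite mulr_ge0// exprn_ge0// addr_ge0.
- by rewrite mulrAC -exprSr.
Qed.

Lemma atan_rem_asum_le w m y :
  `|asum w (fun z => taylor_rem (@atan R) 0 m.+1 (z * y))| <=
  (1 + delta w) ^+ m.+1.*2 * `|y| ^+ m.+1.*2.+1.
Proof.
have d0 := delta_ge0 w.
apply: le_trans (asum_norm_le1 _ _ (@atan_rem_dom _ w m y)) _.
- by rewrite invr_ge0 ler0n natV_le1.
- by rewrite mulr_ge0// exprn_ge0// addr_ge0.
- by rewrite mulrAC -exprSr.
Qed.

Lemma lnA_gap_cum t w w' y m : lnA_gap t w w' y =
  \sum_(j < m.+1)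
    (-1) ^+ j * cum_gap t w w' j.+1.*2 * y ^+ j.+1.*2 / j.+1.*2%:R +
  (asum w' (fun z => taylor_rem (@lnmod R) 1 m.+1 (z * y)) -
   asum w (fun z => taylor_rem (@lnmod R) 1 m.+1 (z * y))).
Proof.
rewrite /lnA_gap (lnA_cum w' y m) (lnA_cum w y m).
rewrite (_ : t * y ^+ 2 / 2 = \sum_(j < m.+1)
    (-1) ^+ j * ((j.+1.*2 == 2)%:R * t) * y ^+ j.+1.*2 / j.+1.*2%:R); last first.
  rewrite big_ord_recl/= expr0 !mul1r big1 ?addr0// => j _.
  by rewrite !mul0r mulr0 !mul0r.
rewrite (_ : \sum_(j < m.+1)
    (-1) ^+ j * cum_gap t w w' j.+1.*2 * y ^+ j.+1.*2 / j.+1.*2%:R =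
  \sum_(j < m.+1) (-1) ^+ j * cum w' j.+1.*2 * y ^+ j.+1.*2 / j.+1.*2%:R -
  (\sum_(j < m.+1) (-1) ^+ j * cum w j.+1.*2 * y ^+ j.+1.*2 / j.+1.*2%:R +
   \sum_(j < m.+1) (-1) ^+ j * ((j.+1.*2 == 2)%:R * t) * y ^+ j.+1.*2 / j.+1.*2%:R)).
  have E (a b c e f : R) : a + b - (c + e + f) = a - (c + f) + (b - e) by ring.
  by rewrite E.
rewrite -big_split -sumrB; apply: eq_bigr => j _ /=.
by rewrite /cum_gap /=; move: (_ == _)%:R => b; ring.
Qed.

Lemma argB_gap_cum t w w' y m : argB_gap w w' y =
  \sum_(j < m.+1)
    (-1) ^+ j * cum_gap t w w' j.*2.+1 * y ^+ j.*2.+1 / j.*2.+1%:R +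
  (asum w' (fun z => taylor_rem (@atan R) 0 m.+1 (z * y)) -
   asum w (fun z => taylor_rem (@atan R) 0 m.+1 (z * y))).
Proof.
rewrite /argB_gap (argB_cum w' y m) (argB_cum w y m).
rewrite (_ : \sum_(j < m.+1)
    (-1) ^+ j * cum_gap t w w' j.*2.+1 * y ^+ j.*2.+1 / j.*2.+1%:R =
  \sum_(j < m.+1) (-1) ^+ j * cum w' j.*2.+1 * y ^+ j.*2.+1 / j.*2.+1%:R -
  \sum_(j < m.+1) (-1) ^+ j * cum w j.*2.+1 * y ^+ j.*2.+1 / j.*2.+1%:R).
  have E (a b c e : R) : a + b - (c + e) = a - c + (b - e) by ring.
  by rewrite E.
rewrite -sumrB; apply: eq_bigr => j _.
have -> : cum_gap t w w' j.*2.+1 = cum w' j.*2.+1 - cum w j.*2.+1.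
  rewrite /cum_gap (_ : (j.*2.+1 == 2)%N = false) ?mul0r ?addr0//.
  by apply/negP => /eqP/(congr1 odd); rewrite /= odd_double.
by ring.
Qed.

(** All terms before [j = q] vanish, and the remainders for [w] and [w'] are bounded separately;
    these are the two summands of [rem_cst]. *)
Lemma lnA_gap_lead t w w' q y :
  (forall j, (j < q)%N -> cum_gap t w w' j.+1.*2 = 0) ->
  `|lnA_gap t w w' y -
    (-1) ^+ q / q.+1.*2%:R * cum_gap t w w' q.+1.*2 * y ^+ q.+1.*2| <=
  rem_cst w w' q.*2.+3 * `|y| ^+ q.+2.*2.
Proof.
move=> Y0; rewrite (lnA_gap_cum t w w' y q) big_ord_recr/= big1 ?add0r; last first.
  by move=> j _; rewrite Y0 ?ltn_ord// mulr0 !mul0r.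
set a := asum w' _; set b := asum w _.
rewrite (_ : _ - _ = a - b); last by ring.
rewrite (le_trans (ler_normB _ _))// addrC mulrDl lerD//.
  exact: (@lnmod_rem_asum_le w q.+1 y).
exact: (@lnmod_rem_asum_le w' q.+1 y).
Qed.

Lemma lnA_gap_small t w w' q y :
  (forall j, (j <= q)%N -> cum_gap t w w' j.+1.*2 = 0) ->
  `|lnA_gap t w w' y| <= rem_cst w w' q.*2.+3 * `|y| ^+ q.+2.*2.
Proof.
move=> Y0; have := @lnA_gap_lead t w w' q y.
rewrite Y0// mulr0 mul0r subr0; apply => j jq; apply: Y0; exact: ltnW.
Qed.

Lemma argB_gap_lead t w w' q y :
  (forall j, (j < q)%N -> cum_gap t w w' j.*2.+1 = 0) ->
  `|argB_gap w w' y -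
    (-1) ^+ q / q.*2.+1%:R * cum_gap t w w' q.*2.+1 * y ^+ q.*2.+1| <=
  rem_cst w w' q.+1.*2 * `|y| ^+ q.+1.*2.+1.
Proof.
move=> Y0; rewrite (argB_gap_cum t w w' y q) big_ord_recr/= big1 ?add0r; last first.
  by move=> j _; rewrite Y0 ?ltn_ord// mulr0 !mul0r.
set a := asum w' _; set b := asum w _.
rewrite (_ : _ - _ = a - b); last by ring.
rewrite (le_trans (ler_normB _ _))// addrC mulrDl lerD//.
  exact: (@atan_rem_asum_le w q y).
exact: (@atan_rem_asum_le w' q y).
Qed.

Lemma rem_cst_ge0 w w' n : 0 <= rem_cst w w' n.
Proof. by rewrite addr_ge0// exprn_ge0// addr_ge0// delta_ge0. Qed.

(* The arguments [y = 1 / (p k)] and exponents [N = r k ^ n] are chosen so that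
   [N * y ^ n = r / p ^ n] does not depend on [k]. *)
Lemma cvg_scaled_lead (g : R -> R) (c K : R) n (r p : nat) :
  (forall y, 0 <= y <= 1 -> `|g y - c * y ^+ n| <= K * y ^+ n.+1) ->
  (fun k => (r * k.+1 ^ n)%:R * g ((p.+1 * k.+1)%:R^-1)) @ \oo -->
  r%:R * c * (p.+1%:R^-1) ^+ n.
Proof.
move=> gK.
pose D k : R := (r * k.+1 ^ n)%:R * g ((p.+1 * k.+1)%:R^-1) - r%:R * c * (p.+1%:R^-1) ^+ n.
have K0 : 0 <= K.
  by have := gK 1; rewrite ler01 lexx !expr1n !mulr1 => /(_ isT)/(le_trans (normr_ge0 _)).
suff D0 : D @ \oo --> (0 : R).
  have := cvgD D0 (cvg_cst (r%:R * c * (p.+1%:R^-1) ^+ n)).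
  rewrite add0r (_ : D + _ =
    fun k => (r * k.+1 ^ n)%:R * g ((p.+1 * k.+1)%:R^-1)).
    by apply.
  by apply/funext => k; rewrite /D !fctE /= subrK.
apply: norm_cvg0.
have H : (fun k => r%:R * K * (k.+1%:R)^-1) @ \oo --> (0 : R).
  rewrite -(mulr0 (r%:R * K)); apply: cvgM; first exact: cvg_cst.
  exact: cvg_harmonic.
apply: (squeeze_cvgr _ (cvg_cst 0) H); apply: nearW => k.
rewrite normr_ge0 /=.
set y := (p.+1 * k.+1)%:R^-1 : R.
have y01 : 0 <= y <= 1.
  by rewrite invr_ge0 ler0n /= invf_le1 ?ltr0n ?muln_gt0// ler1n muln_gt0.
have yE : y = p.+1%:R^-1 / k.+1%:R by rewrite /y natrM invfM.
have k0 : k.+1%:R != 0 :> R by rewrite pnatr_eq0.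
have yn : k.+1%:R ^+ n * y ^+ n = p.+1%:R^-1 ^+ n.
  by rewrite yE -exprMn mulrCA mulfV// mulr1.
have -> : D k = r%:R * k.+1%:R ^+ n * (g y - c * y ^+ n).
  by rewrite /D -/y -yn natrM natrX; ring.
rewrite normrM ger0_norm ?mulr_ge0// ?exprn_ge0//.
apply: (@le_trans _ _ (r%:R * k.+1%:R ^+ n * (K * y ^+ n.+1))).
  by rewrite ler_wpM2l ?mulr_ge0 ?exprn_ge0//; exact: gK.
have -> : r%:R * k.+1%:R ^+ n * (K * y ^+ n.+1) =
   r%:R * K * y * (k.+1%:R ^+ n * y ^+ n) by rewrite exprS; ring.
rewrite yn -mulrA ler_wpM2l ?mulr_ge0//.
have pi1 : (p.+1%:R : R)^-1 <= 1 by exact: natV_le1.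
rewrite yE mulrAC -[leRHS]mul1r ler_wpM2r ?invr_ge0// -exprS.
by rewrite exprn_ile1.
Qed.

End cumulant_gap.

(** * Power sums determine the points *)

Section moment_uniqueness.
Variable R : realType.
Implicit Types (a b : nat -> R) (f g : R -> R) (D c : R) (w : Omega R).

Lemma ssum_ge0 a D C f : sqsummable a D -> sqdominated (1 + D) C f ->
  (forall k, 0 <= f (a k)) -> 0 <= ssum a f.
Proof.
move=> aD fC f0; apply: limr_ge; first exact: is_cvg_ssum aD fC.
by apply: nearW => n; apply: sumr_ge0 => k _.
Qed.

Lemma sqsummable_shift a D : sqsummable a D -> sqsummable (fun k => a k.+1) D.
Proof.
move=> aD n; apply: le_trans (aD n.+1).
by rewrite big_nat_recl// lerDr sqr_ge0.
Qed.

Lemma ssum_recl a D C f : sqsummable a D -> sqdominated (1 + D) C f ->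
  ssum a f = f (a 0%N) + ssum (fun k => a k.+1) f.
Proof.
move=> aD fC; have cs := is_cvg_ssum (sqsummable_shift aD) fC.
apply: cvg_lim => //; rewrite -cvg_shiftS.
rewrite (_ : (fun n => _) = (fun n => f (a 0%N) + series (fun k => f (a k.+1)) n)).
  by apply: cvgD; [exact: cvg_cst|exact: cs].
by apply/funext => n; rewrite /series/= big_nat_recl.
Qed.

Lemma ssum_oppX a n : ssum (fun k => - a k) (fun x => x ^+ n) =
  ssum a (fun x => (- x) ^+ n).
Proof. by []. Qed.

(** The exponents start at 4 so that the lowest one gives the weight [x ^+ 4], nonnegative at points
    of either sign. *)
Definition moments_eq a b a' b' := forall j,
  ssum a (fun x => x ^+ j.+4) + ssum (fun k => - b k) (fun x => x ^+ j.+4) =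
  ssum a' (fun x => x ^+ j.+4) + ssum (fun k => - b' k) (fun x => x ^+ j.+4).

Lemma powM_dominated D c j m :
  exists C, sqdominated (1 + D) C (fun x => x ^+ j.+4 * (x + c) ^+ m).
Proof.
exists ((1 + D) ^+ j.+2 * (1 + D + `|c|) ^+ m) => z zD.
have D0 : 0 <= 1 + D by apply: le_trans zD.
rewrite normrM !normrX -addn2 exprD real_normK ?num_real// mulrAC.
rewrite ler_wpM2r ?sqr_ge0// ler_pM// ?exprn_ge0//.
  by rewrite lerXn2r// nnegrE.
have Dc : 0 <= 1 + D + `|c| by exact: addr_ge0.
rewrite lerXn2r//.
by rewrite (le_trans (ler_normD _ _))// lerD2r.
Qed.

(** The function is a combination of powers with exponent at least 4. The induction on [m] writes
    one factor [x + c] as a shift of [j] plus a multiplication by [c], so it must be uniform in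
    [j]. *)
Lemma moments_eq_powM D c a b a' b' m j :
  sqsummable a D -> sqsummable (fun k => - b k) D ->
  sqsummable a' D -> sqsummable (fun k => - b' k) D ->
  moments_eq a b a' b' ->
  ssum a (fun x => x ^+ j.+4 * (x + c) ^+ m) +
  ssum (fun k => - b k) (fun x => x ^+ j.+4 * (x + c) ^+ m) =
  ssum a' (fun x => x ^+ j.+4 * (x + c) ^+ m) +
  ssum (fun k => - b' k) (fun x => x ^+ j.+4 * (x + c) ^+ m).
Proof.
move=> sa sb sa' sb' E; elim: m j => [|m IH] j.
  by under eq_fun do rewrite expr0 mulr1; exact: E.
have [C1 H1] := powM_dominated D c j.+1 m.
have [C2 H2] := powM_dominated D c j m.
have H2c : sqdominated (1 + D) (`|c| * C2) (fun x => c * (x ^+ j.+4 * (x + c) ^+ m)).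
  by move=> z /H2 zC; rewrite normrM -[leRHS]mulrA ler_wpM2l.
have -> : (fun x => x ^+ j.+4 * (x + c) ^+ m.+1) =
   (fun x => x ^+ j.+1.+4 * (x + c) ^+ m + c * (x ^+ j.+4 * (x + c) ^+ m)).
  apply/funext => x; rewrite [_ ^+ m.+1]exprS [_ ^+ j.+1.+4]exprS.
  by move: (x ^+ j.+4) ((x + c) ^+ m) => u v; ring.
rewrite (ssumD sa H1 H2c) (ssumD sb H1 H2c) (ssumD sa' H1 H2c) (ssumD sb' H1 H2c).
rewrite (ssumZ _ sa H2) (ssumZ _ sb H2) (ssumZ _ sa' H2) (ssumZ _ sb' H2).
have e1 := IH j.+1; have e2 := IH j.
rewrite addrACA e1 -mulrDr e2 mulrDr; ring.
Qed.

Lemma geometric_unbounded (rho C : R) : 1 < rho -> exists m, C < rho ^+ m.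
Proof.
move=> r1; have [C0|C0] := leP C 0; first by exists 0%N; rewrite expr0 (le_lt_trans C0).
have r0 : 0 < rho by exact: lt_trans r1.
have : (fun n => C * rho^-1 ^+ n) @ \oo --> (0 : R).
  by apply: cvg_geometric; rewrite ger0_norm ?invr_ge0 ?ltW// invf_lt1.
move=> /cvgrPdist_lt /(_ 1 ltr01)[m _ /(_ m (leqnn m))].
rewrite sub0r normrN => /(le_lt_trans (ler_norm _)).
by rewrite exprVn ltr_pdivrMr ?exprn_gt0// mul1r => ?; exists m.
Qed.

(* As [m] grows, [x ^+ 4 * (x + c) ^+ m] picks out the largest of the points
   [a k, - b k]; the shift by [c] makes all [x + c] nonnegative, so that the
   negative points do not interfere. *)
Lemma moments_eq_head_le D a b a' b' :
  (forall k, 0 <= a k) -> (forall k, 0 <= b k) ->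
  (forall k, 0 <= a' k) -> (forall k, 0 <= b' k) -> nonincreasing_seq a' ->
  sqsummable a D -> sqsummable (fun k => - b k) D ->
  sqsummable a' D -> sqsummable (fun k => - b' k) D ->
  moments_eq a b a' b' -> a 0%N <= a' 0%N.
Proof.
move=> a0 b0 a'0 b'0 dec sa sb sa' sb' E; rewrite leNgt; apply/negP => lt.
pose c := 1 + D.
have D0 : 0 <= D by have := sa 0%N; rewrite big_geq.
have c0 : 0 < c by rewrite ltr_pwDl.
have alec k : `|a k| <= c by exact: sqsummable_bound sa.
have blec k : `|- b k| <= c by exact: sqsummable_bound sb.
have a'lec k : `|a' k| <= c by exact: sqsummable_bound sa'.
have b'lec k : `|- b' k| <= c by exact: sqsummable_bound sb'.
have d0 : 0 < a' 0%N + c by rewrite ltr_wpDl.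
pose rho := (a 0%N + c) / (a' 0%N + c).
have r1 : 1 < rho by rewrite ltr_pdivlMr// mul1r ltrD2r.
have a0p : 0 < a 0%N by exact: le_lt_trans lt.
(* [S] is the fourth power sum of the primed points. If [a' 0 < a 0], comparing the two sides gives
   [a 0 ^+ 4 * (a 0 + c) ^+ m <= S * (a' 0 + c) ^+ m] for every [m], so the powers of [rho > 1]
   would be bounded by [S / a 0 ^+ 4]. *)
pose S := ssum a' (fun x => x ^+ 4 * (x + c) ^+ 0) +
          ssum (fun k => - b' k) (fun x => x ^+ 4 * (x + c) ^+ 0).
have [m] := geometric_unbounded (S / a 0%N ^+ 4) r1.
rewrite ltr_pdivrMr ?exprn_gt0// ltNge => /negP; apply.
rewrite /rho expr_div_n mulrAC ler_pdivrMr ?exprn_gt0//.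
have [C HC] := powM_dominated D c 0 m.
have [C0 HC0] := powM_dominated D c 0 0.
have nn x : `|x| <= c -> 0 <= x ^+ 4 * (x + c) ^+ m.
  rewrite ler_norml => /andP[xc _].
  apply: mulr_ge0; first exact: exprn_even_ge0.
  by rewrite exprn_ge0// -lerBlDr sub0r.
have L : (a 0%N + c) ^+ m * a 0%N ^+ 4 <=
    ssum a (fun x => x ^+ 4 * (x + c) ^+ m) +
    ssum (fun k => - b k) (fun x => x ^+ 4 * (x + c) ^+ m).
  rewrite (ssum_recl sa HC) mulrC -addrA lerDl addr_ge0//.
    by apply: (ssum_ge0 (sqsummable_shift sa) HC) => k; exact: nn.
  by apply: (ssum_ge0 sb HC) => k; exact: nn.
apply: le_trans L _; rewrite (moments_eq_powM c m 0 sa sb sa' sb' E).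
pose K := (a' 0%N + c) ^+ m.
have dK : sqdominated (1 + D) (`|K| * C0) (fun x => K * (x ^+ 4 * (x + c) ^+ 0)).
  by move=> z /HC0 zC; rewrite normrM -[leRHS]mulrA ler_wpM2l.
have dN : sqdominated (1 + D) C (fun x => -1 * (x ^+ 4 * (x + c) ^+ m)).
  by move=> z zC; rewrite mulN1r normrN; exact: HC.
have dd : sqdominated (1 + D) (`|K| * C0 + C)
   (fun x => K * (x ^+ 4 * (x + c) ^+ 0) + -1 * (x ^+ 4 * (x + c) ^+ m)).
  move=> z zC; rewrite (le_trans (ler_normD _ _))// mulrDl lerD//.
    exact: dK.
  exact: dN.
(* Every primed point is at most [a' 0], the negative ones trivially, so the factor [(u + c) ^+ m]
   is at most [K]. *)
have pos u : `|u| <= c -> u <= a' 0%N ->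
   0 <= K * (u ^+ 4 * (u + c) ^+ 0) + -1 * (u ^+ 4 * (u + c) ^+ m).
  rewrite ler_norml => /andP[uc _] ua.
  rewrite expr0 mulr1 mulN1r subr_ge0 [leRHS]mulrC ler_wpM2l ?exprn_even_ge0//.
  have uc0 : 0 <= u + c by rewrite -lerBlDr sub0r.
  by rewrite lerXn2r ?nnegrE// ?lerD2r// (le_trans uc0)// lerD2r.
have : 0 <= ssum a' (fun x => K * (x ^+ 4 * (x + c) ^+ 0) + -1 * (x ^+ 4 * (x + c) ^+ m))
  + ssum (fun k => - b' k)
     (fun x => K * (x ^+ 4 * (x + c) ^+ 0) + -1 * (x ^+ 4 * (x + c) ^+ m)).
  apply: addr_ge0.
    by apply: (ssum_ge0 sa' dd) => k; apply: pos => //; exact: dec.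
  apply: (ssum_ge0 sb' dd) => k; apply: pos => //.
  by rewrite (@le_trans _ _ 0)// oppr_le0.
rewrite (ssumD sa' dK dN) (ssumD sb' dK dN) (ssumZ _ sa' HC0) (ssumZ _ sb' HC0).
rewrite (ssumZ _ sa' HC) (ssumZ _ sb' HC) => H.
rewrite -subr_ge0.
apply: le_trans H _; rewrite /S /K le_eqVlt; apply/orP; left; apply/eqP; ring.
Qed.

(** The heads agree by comparison in both directions; cancelling the common head from both sums
    leaves the same hypothesis for the tails, with [b] and [b'] untouched. *)
Lemma moments_eq_inj D k a b a' b' :
  (forall k, 0 <= a k) -> (forall k, 0 <= b k) ->
  (forall k, 0 <= a' k) -> (forall k, 0 <= b' k) ->
  nonincreasing_seq a -> nonincreasing_seq a' ->
  sqsummable a D -> sqsummable (fun k => - b k) D ->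
  sqsummable a' D -> sqsummable (fun k => - b' k) D ->
  moments_eq a b a' b' -> a k = a' k.
Proof.
elim: k a a' => [|k IH] a a' a0 b0 a'0 b'0 da da' sa sb sa' sb' E.
  apply/eqP; rewrite eq_le; apply/andP; split.
    exact: (moments_eq_head_le a0 b0 a'0 b'0 da' sa sb sa' sb' E).
  by apply: (moments_eq_head_le a'0 b'0 a0 b0 da sa' sb' sa sb) => j; rewrite E.
have E0 : a 0%N = a' 0%N.
  apply/eqP; rewrite eq_le; apply/andP; split.
    exact: (moments_eq_head_le a0 b0 a'0 b'0 da' sa sb sa' sb' E).
  by apply: (moments_eq_head_le a'0 b'0 a0 b0 da sa' sb' sa sb) => j; rewrite E.
apply: (IH (fun k => a k.+1) (fun k => a' k.+1)) => //.
- by move=> i j ij; apply: da; rewrite ltnS.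
- by move=> i j ij; apply: da'; rewrite ltnS.
- exact: sqsummable_shift.
- exact: sqsummable_shift.
- move=> j; have := E j.
  have [C HC] := powM_dominated D 0 j 0.
  have {}HC : sqdominated (1 + D) C (fun x => x ^+ j.+4).
    by move=> z /HC; rewrite expr0 mulr1.
  by rewrite (ssum_recl sa HC) (ssum_recl sa' HC) E0 -!addrA => /addrI.
Qed.

(** Reflection at 0 multiplies both sides by the same sign. It exchanges the two families, so that
    what is proved for the alpha^+ carries over to the alpha^-. *)
Lemma moments_eqC D a b a' b' :
  sqsummable a D -> sqsummable b D -> sqsummable a' D -> sqsummable b' D ->
  moments_eq a b a' b' -> moments_eq b a b' a'.
Proof.
move=> sa sb sa' sb' E j.
have [C HC] := powM_dominated D 0 j 0.
have {}HC : sqdominated (1 + D) C (fun x => x ^+ j.+4).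
  by move=> z /HC; rewrite expr0 mulr1.
have N x : sqsummable x D -> ssum (fun k => - x k) (fun x => x ^+ j.+4) =
    (-1) ^+ j.+4 * ssum x (fun x => x ^+ j.+4).
  move=> sx; rewrite ssum_oppX -(ssumZ _ sx HC).
  by congr ssum; apply/funext => u; exact: exprNn.
have := E j; rewrite (N _ sa) (N _ sb) (N _ sa') (N _ sb').
have : (-1) ^+ j.+4 * (-1) ^+ j.+4 = 1 :> R by rewrite -expr2 sqrr_sign.
move: ((-1) ^+ j.+4) => s ss Ej.
rewrite -[ssum b _]mul1r -[ssum b' _]mul1r -ss -!mulrA -!mulrDr.
by rewrite [_ + ssum a _]addrC Ej [_ + ssum a' _]addrC.
Qed.

Lemma cum_inj w w' : (forall n, (3 <= n)%N -> cum w' n = cum w n) ->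
  (forall k, alphap w' k = alphap w k) /\ (forall k, alpham w' k = alpham w k).
Proof.
move=> E.
have M : moments_eq (alphap w') (alpham w') (alphap w) (alpham w).
  by move=> j; exact: (E j.+4).
pose D := delta w' + delta w.
have le_D x D1 : sqsummable x D1 -> D1 <= D -> sqsummable x D.
  by move=> s ? n; apply: le_trans (s n) _.
have l' : delta w' <= D by rewrite lerDl delta_ge0.
have l : delta w <= D by rewrite lerDr delta_ge0.
have N x : sqsummable (fun k => - x k) D -> sqsummable x D.
  by move=> s n; apply: le_trans (s n); under [leRHS]eq_bigr do rewrite sqrrN.
have N' x : sqsummable x D -> sqsummable (fun k => - x k) D.
  by move=> s n; under eq_bigr do rewrite sqrrN; exact: s.
have sp' := le_D _ _ (sqsummable_alphap w') l'.
have sp := le_D _ _ (sqsummable_alphap w) l.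
have sm' := le_D _ _ (sqsummable_alphaNm w') l'.
have sm := le_D _ _ (sqsummable_alphaNm w) l.
split=> k.
  apply: (@moments_eq_inj D k _ (alpham w') _ (alpham w)) => //;
    by [exact: alphap_ge0|exact: alpham_ge0|exact: alphap_nincr].
have M' := moments_eqC sp' (N _ sm') sp (N _ sm) M.
apply: (@moments_eq_inj D k _ (alphap w') _ (alphap w)) => //;
  by [exact: alphap_ge0|exact: alpham_ge0|exact: alpham_nincr|exact: N|exact: N'].
Qed.

End moment_uniqueness.

(** * Integration of kernels *)

Import HBNNSimple.

Section mixture.
Context d1 d2 (X : measurableType d1) (Y : measurableType d2) (R : realType).
Variables (mu : {measure set X -> \bar R}) (k : X -> {measure set Y -> \bar R}).
Variable nu : {measure set Y -> \bar R}.
Hypothesis mk : forall U : set Y, measurable U -> measurable_fun [set: X] (fun x => k x U : \bar R).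
Hypothesis nuE : forall U : set Y, measurable U -> nu U = (\int[mu]_x (k x U))%E.
Local Open Scope ereal_scope.

Let mixture_nnsfun (f : {nnsfun Y >-> R}) :
  \int[nu]_y (f y)%:E = \int[mu]_x \int[k x]_y (f y)%:E.
Proof.
under [in LHS]eq_integral do rewrite fimfunE -fsumEFin//.
rewrite ge0_integral_fsum//; last 2 first.
  - by move=> r; exact/measurable_EFinP/measurableT_comp.
  - by move=> r z _; rewrite EFinM nnfun_muleindic_ge0.
under [in RHS]eq_integral.
  move=> y _.
  under eq_integral.
    by move=> z _; rewrite fimfunE -fsumEFin//; over.
  rewrite /= ge0_integral_fsum//; last 2 first.
    - by move=> r; exact/measurable_EFinP/measurableT_comp.
    - by move=> r z _; rewrite EFinM nnfun_muleindic_ge0.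
  under eq_fsbigr.
    move=> r _.
    rewrite (integralZl_indic _ (fun r => f @^-1` [set r]))//; last first.
      by move=> r0; rewrite preimage_nnfun0.
    rewrite integral_indic// setIT.
    over.
  over.
rewrite /= ge0_integral_fsum//; last 2 first.
  - by move=> r; apply: measurable_funeM; exact: mk.
  - move=> n y _.
    have := mulemu_ge0 (fun n => f @^-1` [set n]).
    by apply; exact: preimage_nnfun0.
apply: eq_fsbigr => r _.
rewrite (integralZl_indic _ (fun r => f @^-1` [set r]))//; last first.
  exact: preimage_nnfun0.
rewrite /= integral_indic// setIT nuE//.
have [r0|r0] := leP 0%R r.
  by rewrite ge0_integralZl//; exact: mk.
rewrite integral0_eq ?mule0.
  by rewrite integral0_eq// => y _; rewrite preimage_nnfun0// measure0 mule0.
by move=> y _; rewrite preimage_nnfun0// measure0.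
Qed.

(** The identity on measurable sets extends to simple functions by linearity, then to [f] by
    monotone convergence, applied under both integrals on the right. *)
Lemma ge0_integral_mixture f : (forall y, 0 <= f y) -> measurable_fun [set: Y] f ->
  \int[nu]_y f y = \int[mu]_x \int[k x]_y f y.
Proof.
move=> f0 mf.
pose f_ := nnsfun_approx measurableT mf.
transitivity (\int[nu]_z (lim ((f_ n z)%:E @[n --> \oo]))).
  by apply/eq_integral => z _; apply/esym/cvg_lim => //=; exact: cvg_nnsfun_approx.
rewrite monotone_convergence//; last 3 first.
  by move=> n; exact/measurable_EFinP.
  by move=> n z _; rewrite lee_fin.
  by move=> z _ a b ab; rewrite lee_fin; exact/lefP/nd_nnsfun_approx.
rewrite (_ : (fun _ => _) =
    (fun n => \int[mu]_x (\int[k x]_z (f_ n z)%:E)))//; last first.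
  by apply/funext => n; rewrite mixture_nnsfun.
transitivity (\int[mu]_x lim ((\int[k x]_z (f_ n z)%:E) @[n --> \oo])).
  rewrite -monotone_convergence//; last 3 first.
  - move=> n; apply: measurable_fun_integral_kernel => //.
    + by move=> z; rewrite lee_fin.
    + exact/measurable_EFinP.
  - by move=> n z _; apply: integral_ge0 => y _; rewrite lee_fin.
  - move=> z _ a b ab; apply: ge0_le_integral => //.
    + by move=> y _; rewrite lee_fin.
    + exact/measurable_EFinP.
    + exact/measurable_EFinP.
    + by move=> y _; rewrite lee_fin; exact/lefP/nd_nnsfun_approx.
apply: eq_integral => z _; rewrite -monotone_convergence//; last 3 first.
  - by move=> n; exact/measurable_EFinP.
  - by move=> n y _; rewrite lee_fin.
  - by move=> y _ a b ab; rewrite lee_fin; exact/lefP/nd_nnsfun_approx.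
by apply: eq_integral => y _; apply/cvg_lim => //; exact: cvg_nnsfun_approx.
Qed.

End mixture.

(** * Bounded measurable functions *)

Section bounded_functions.
Context d (T : measurableType d) (R : realType).
Implicit Types (f g : T -> R).

Definition bounded_mfun f :=
  measurable_fun [set: T] f /\ exists M, forall x, `|f x| <= M.

Lemma bounded_mfun_integrable (mu : {finite_measure set T -> \bar R}) f :
  bounded_mfun f -> mu.-integrable [set: T] (EFin \o f).
Proof.
move=> [mf [M fM]]; apply: measurable_bounded_integrable => //.
  by have := fin_num_measure mu setT measurableT; rewrite fin_num_abs gee0_abs.
exists M; split; first exact: num_real.
by move=> x Mx y _ /=; apply: le_trans (fM y) _; exact: ltW.
Qed.

Lemma bounded_mfunD f g : bounded_mfun f -> bounded_mfun g ->
  bounded_mfun (fun x => f x + g x).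
Proof.
move=> [mf [M fM]] [mg [K gK]]; split; first exact: measurable_funD.
by exists (M + K) => x; rewrite (le_trans (ler_normD _ _))// lerD.
Qed.

Lemma bounded_mfunM f g : bounded_mfun f -> bounded_mfun g ->
  bounded_mfun (fun x => f x * g x).
Proof.
move=> [mf [M fM]] [mg [K gK]]; split; first exact: measurable_funM.
by exists (M * K) => x; rewrite normrM ler_pM.
Qed.

Lemma bounded_mfun_cst (c : R) : bounded_mfun (fun=> c).
Proof. by split; [exact: measurable_cst|exists `|c|]. Qed.

Lemma bounded_mfunB f g : bounded_mfun f -> bounded_mfun g ->
  bounded_mfun (fun x => f x - g x).
Proof.
move=> [mf [M fM]] [mg [K gK]]; split; first exact: measurable_funB.
by exists (M + K) => x; rewrite (le_trans (ler_normB _ _))// lerD.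
Qed.

Lemma bounded_mfun_cos f : measurable_fun [set: T] f -> bounded_mfun (cos \o f).
Proof.
move=> mf; split; last by exists 1 => x; exact: cos_max.
apply: measurableT_comp => //; apply: continuous_measurable_fun; exact: continuous_cos.
Qed.

Lemma bounded_mfun_sin f : measurable_fun [set: T] f -> bounded_mfun (sin \o f).
Proof.
move=> mf; split; last by exists 1 => x; exact: sin_max.
apply: measurableT_comp => //; apply: continuous_measurable_fun; exact: continuous_sin.
Qed.

Lemma bounded_RintegralD (mu : {finite_measure set T -> \bar R}) f g :
  bounded_mfun f -> bounded_mfun g ->
  \int[mu]_x (f x + g x) = \int[mu]_x f x + \int[mu]_x g x.
Proof.
by move=> bf bg; rewrite RintegralD//; exact: bounded_mfun_integrable.
Qed.

Lemma bounded_RintegralB (mu : {finite_measure set T -> \bar R}) f g :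
  bounded_mfun f -> bounded_mfun g ->
  \int[mu]_x (f x - g x) = \int[mu]_x f x - \int[mu]_x g x.
Proof.
by move=> bf bg; rewrite RintegralB//; exact: bounded_mfun_integrable.
Qed.

Lemma bounded_RintegralZl (mu : {finite_measure set T -> \bar R}) f (c : R) :
  bounded_mfun f -> \int[mu]_x (c * f x) = c * \int[mu]_x f x.
Proof. by move=> bf; rewrite RintegralZl//; exact: bounded_mfun_integrable. Qed.

Lemma probability_Rintegral_cst (P : probability T R) (c : R) :
  \int[P]_x c = c.
Proof.
rewrite Rintegral_cst// -[RHS]mulr1 -[RHS]/(c * fine 1%E); congr (_ * fine _).
exact: probability_setT.
Qed.

Lemma bounded_Rintegral_le (P : probability T R) f (M : R) :
  bounded_mfun f -> (forall x, `|f x| <= M) -> `|\int[P]_x f x| <= M.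
Proof.
move=> bf fM; apply: (le_trans (le_normr_Rintegral measurableT (bounded_mfun_integrable P bf))).
rewrite -[leRHS](probability_Rintegral_cst P); apply: le_Rintegral => //.
  exact/integrable_norm/bounded_mfun_integrable.
exact/bounded_mfun_integrable/bounded_mfun_cst.
Qed.

Lemma bounded_EFin_Rintegral (mu : {finite_measure set T -> \bar R}) f :
  bounded_mfun f -> (\int[mu]_x (f x)%:E)%E = (\int[mu]_x f x)%:E.
Proof.
move=> bf; rewrite /Rintegral fineK//; apply: integrable_fin_num => //.
exact: bounded_mfun_integrable.
Qed.

End bounded_functions.

Section mixture_bounded.
Context d1 d2 (X : measurableType d1) (Y : measurableType d2) (R : realType).

(** Adding the bound [M] makes the integrand nonnegative, and since [k x] has mass one, this only
    shifts the integral by [M]. *)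
Lemma measurable_Rintegral_kernel (k : X -> probability Y R) (f : Y -> R) :
  (forall U : set Y, measurable U -> measurable_fun [set: X] (fun x => k x U : \bar R)) ->
  bounded_mfun f -> bounded_mfun (fun x => \int[k x]_y f y).
Proof.
move=> mk bf; have [mf [M fM]] := bf.
have bM := @bounded_mfun_cst _ Y _ M.
split; last by exists M => x; exact: bounded_Rintegral_le.
have -> : (fun x => \int[k x]_y f y) =
  (fun x => fine (\int[k x]_y (f y + M)%:E)%E - M).
  apply/funext => x; rewrite bounded_EFin_Rintegral; last exact: bounded_mfunD.
  by rewrite bounded_RintegralD//= probability_Rintegral_cst addrK.
apply: measurable_funB => //; apply: measurableT_comp => //.
apply: measurable_fun_integral_kernel => //.
  by move=> y; rewrite lee_fin -lerBlDr sub0r; have := fM y; rewrite ler_norml => /andP[].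
by apply/measurable_EFinP; exact: measurable_funD.
Qed.

Lemma Rintegral_mixture (mu : probability X R) (k : X -> probability Y R)
    (nu : probability Y R) (f : Y -> R) :
  (forall U : set Y, measurable U -> measurable_fun [set: X] (fun x => k x U : \bar R)) ->
  (forall U : set Y, measurable U -> nu U = (\int[mu]_x (k x U))%E) ->
  bounded_mfun f ->
  \int[nu]_y f y = \int[mu]_x \int[k x]_y f y.
Proof.
move=> mk nuE bf; have [mf [M fM]] := bf.
have bM := @bounded_mfun_cst _ Y _ M.
have bMX := @bounded_mfun_cst _ X _ M.
have bfM : bounded_mfun (fun y => f y + M) by exact: bounded_mfunD.
have bk := measurable_Rintegral_kernel mk bf.
have : (\int[nu]_y (f y + M)%:E = \int[mu]_x \int[k x]_y (f y + M)%:E)%E.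
  apply: ge0_integral_mixture => //.
    by move=> y; rewrite lee_fin -lerBlDr sub0r; have := fM y; rewrite ler_norml => /andP[].
  by apply/measurable_EFinP; exact: measurable_funD.
rewrite bounded_EFin_Rintegral//.
under [X in _ = X -> _]eq_integral do
  rewrite bounded_EFin_Rintegral// bounded_RintegralD//= probability_Rintegral_cst.
rewrite bounded_EFin_Rintegral; last exact: bounded_mfunD.
by rewrite !bounded_RintegralD//= !probability_Rintegral_cst => -[] /addIr.
Qed.

(** The image under [V] of the measure with density [g] is the mixture of the kernels [g x] times
    the Dirac mass at [V x]. *)
Lemma ge0_integral_density (mu : {measure set X -> \bar R}) (g : X -> R)
    (V : X -> Y) (nu : {measure set Y -> \bar R}) (f : Y -> \bar R) :
  measurable_fun setT g -> (forall x, 0 <= g x) -> measurable_fun setT V ->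
  (forall U : set Y, measurable U -> nu U = (\int[mu]_(x in V @^-1` U) (g x)%:E)%E) ->
  (forall y, 0 <= f y)%E -> measurable_fun setT f ->
  (\int[nu]_y f y = \int[mu]_x ((g x)%:E * f (V x)))%E.
Proof.
move=> mg g0 mV nuE f0 mf.
pose k x : {measure set Y -> \bar R} := mscale (NngNum (g0 x)) (\d_(V x)).
have kE x U : k x U = ((g x)%:E * (\1_U (V x))%:E)%E by [].
rewrite (@ge0_integral_mixture _ _ _ _ _ mu k nu)//.
- apply: eq_integral => x _; rewrite ge0_integral_mscale//= integral_dirac//.
  by rewrite diracT mul1e.
- move=> U mU; under eq_fun do rewrite kE -EFinM.
  apply/measurable_EFinP/measurable_funM => //.
  exact: (measurableT_comp (measurable_indic mU)).
- move=> U mU; rewrite nuE// integral_mkcond; apply: eq_integral => x _.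
  have xU : (x \in V @^-1` U) = (V x \in U) by apply/idP/idP; rewrite !inE.
  by rewrite kE patchE indicE xU; case: ifPn; rewrite ?mule1 ?mule0.
Qed.

(** The nonnegative case is applied to [f + M] and to the constant [M], and the results are
    subtracted. *)
Lemma Rintegral_density (mu : {measure set X -> \bar R}) (g : X -> R)
    (V : X -> Y) (nu : {finite_measure set Y -> \bar R}) (f : Y -> R) :
  (forall x, 0 <= g x) -> mu.-integrable setT (EFin \o g) ->
  measurable_fun setT V ->
  (forall U : set Y, measurable U ->
    nu U = (\int[mu]_(x in V @^-1` U) (g x)%:E)%E) ->
  bounded_mfun f ->
  \int[nu]_y f y = \int[mu]_x (g x * f (V x)).
Proof.
move=> g0 ig mV nuE bf; have [mf [M0 fM0]] := bf.
pose M : R := `|M0|; have fM x : `|f x| <= M by rewrite (le_trans (fM0 x))// ler_norm.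
have bM := @bounded_mfun_cst _ Y _ M.
have mg : measurable_fun setT g by apply/measurable_EFinP; exact: measurable_int ig.
have igf (h : Y -> R) : measurable_fun setT h -> (forall y, `|h y| <= M) ->
    mu.-integrable setT (EFin \o (fun x => g x * h (V x))).
  move=> mh hM.
  apply: (le_integrable measurableT _ _ (integrableZl measurableT M ig)).
    apply/measurable_EFinP; apply: measurable_funM => //.
    exact: measurableT_comp.
  move=> x _; rewrite /= lee_fin !normrM mulrC ler_wpM2r//.
  by rewrite [leRHS]normr_id.
have e1 : (\int[nu]_y (f y + M)%:E = \int[mu]_x ((g x)%:E * (f (V x) + M)%:E))%E.
  apply: (ge0_integral_density mg g0 mV nuE).
    by move=> y; rewrite lee_fin -lerBlDr sub0r; have := fM y; rewrite ler_norml => /andP[].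
  by apply/measurable_EFinP; exact: measurable_funD.
have e2 : (\int[nu]_y M%:E = \int[mu]_x ((g x)%:E * M%:E))%E.
  apply: (@ge0_integral_density mu g V nu (cst M%:E) mg g0 mV nuE) => //.
  by move=> y; rewrite /= lee_fin normr_ge0.
have {}e1 : \int[nu]_y (f y + M) = \int[mu]_x (g x * f (V x) + g x * M).
  by rewrite /Rintegral e1; congr fine; apply: eq_integral => x _; rewrite -EFinM mulrDr.
have {}e2 : \int[nu]_y M = \int[mu]_x (g x * M) by rewrite /Rintegral e2.
move: e1; rewrite bounded_RintegralD// RintegralD//; last 2 first.
- exact: igf.
- by apply: (igf (cst M)) => // y; rewrite ger0_norm.
by rewrite e2 => /addIr.
Qed.

Lemma Rintegral_law (mu : probability X R) (V : X -> Y) (nu : probability Y R)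
    (f : Y -> R) : measurable_fun setT V ->
  (forall U : set Y, measurable U -> nu U = mu (V @^-1` U)) ->
  bounded_mfun f -> \int[nu]_y f y = \int[mu]_x f (V x).
Proof.
move=> mV nuE bf.
have -> : \int[mu]_x f (V x) = \int[mu]_x (1 * f (V x)).
  by apply: eq_Rintegral => x _; rewrite mul1r.
apply: Rintegral_density => //.
  exact/bounded_mfun_integrable/bounded_mfun_cst.
move=> U mU; rewrite integral_cst ?mul1e; first exact: nuE.
by rewrite -[_ @^-1` _]setTI; exact: mV.
Qed.

End mixture_bounded.

Section measure_prob.
Context d (T : measurableType d) (R : realType).
Variables (m : {measure set T -> \bar R}) (m1 : m setT = 1%E).

(** An alias carrying the proof of total mass one, on which the probability structure is declared.
    It turns the values of a probability kernel into probabilities. *)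
Definition measure_prob of m setT = 1%E : set T -> \bar R := m.

HB.instance Definition _ := isMeasure.Build _ _ _ (measure_prob m1)
  (@measure0 _ _ _ m) (@measure_ge0 _ _ _ m) (@measure_semi_sigma_additive _ _ _ m).

HB.instance Definition _ := Measure_isProbability.Build _ _ _ (measure_prob m1) m1.

End measure_prob.

Section kernel_prob.
Context d1 d2 (X : measurableType d1) (Y : measurableType d2) (R : realType).

Definition kernel_prob (k : R.-pker X ~> Y) (x : X) : probability Y R :=
  measure_prob (prob_kernel (s := k) x).

End kernel_prob.

Section equal_mixtures.
Context d1 d2 d3 (X1 : measurableType d1) (X2 : measurableType d2)
  (Y : measurableType d3) (R : realType).

(** Both iterated integrals are integrals against one measure [nu], built as the first mixture and
    equal to the second by hypothesis. This carries the intertwining relation from sets to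
    functions. *)
Lemma eq_mixture_Rintegral (mu1 : probability X1 R) (k1 : R.-pker X1 ~> Y)
    (mu2 : probability X2 R) (k2 : R.-pker X2 ~> Y) (f : Y -> R) :
  (forall U, measurable U -> (\int[mu1]_x k1 x U = \int[mu2]_x k2 x U)%E) ->
  bounded_mfun f ->
  \int[mu1]_x \int[kernel_prob k1 x]_y f y =
  \int[mu2]_x \int[kernel_prob k2 x]_y f y.
Proof.
move=> E bf.
pose nu U := (\int[mu1]_x k1 x U)%E.
have nu0 : nu set0 = 0%E by apply: integral0_eq => x _; rewrite measure0.
have nu_ge0 U : (0 <= nu U)%E by apply: integral_ge0 => x _; exact: measure_ge0.
have nu_sigma : semi_sigma_additive nu.
  move=> F mF tF mUF.
  have -> : nu (\bigcup_n F n) = (\sum_(0 <= i <oo) nu (F i))%E.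
    rewrite -integral_nneseries//; last by move=> n; exact: measurable_kernel.
    apply: eq_integral => x _; symmetry; apply: cvg_lim => //.
    exact: measure_semi_sigma_additive.
  by apply: is_cvg_nneseries => n _ _.
pose nuM : {measure set Y -> \bar R} := HB.pack nu (isMeasure.Build _ _ _ nu nu0 nu_ge0 nu_sigma).
have nuT : nuM setT = 1%E.
  rewrite -(@probability_setT _ _ _ mu1) -[RHS]mul1e -integral_cst//.
  by apply: eq_integral => x _; exact: prob_kernel.
rewrite -(@Rintegral_mixture _ _ _ _ _ mu1 (kernel_prob k1) (measure_prob nuT))//.
  rewrite -(@Rintegral_mixture _ _ _ _ _ mu2 (kernel_prob k2) (measure_prob nuT))//.
  by move=> U mU; exact: (measurable_kernel k2 U mU).
by move=> U mU; exact: (measurable_kernel k1 U mU).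
Qed.

End equal_mixtures.

(** * Gaussian characteristic functions *)

Section gaussian_charfun.
Variable R : realType.
Notation mu := (@lebesgue_measure R).
Implicit Types (h dh : R -> R).

(** The fundamental theorem on [[- n.+1, n.+1]] followed by dominated convergence; it serves as
    integration by parts on the whole line. *)
Lemma Rintegral_derive_eq0 h dh :
  (forall x, is_derive x (1:R) h (dh x)) -> continuous dh ->
  mu.-integrable setT (EFin \o dh) ->
  h n.+1%:R @[n --> \oo] --> (0:R) -> h (- n.+1%:R) @[n --> \oo] --> (0:R) ->
  \int[mu]_x dh x = 0.
Proof.
move=> hdh cdh idh hp hm.
pose I n : set R := `[- n.+1%:R, n.+1%:R]%classic.
have mdh : measurable_fun setT dh by exact: continuous_measurable_fun.
have ftc n : (\int[mu]_(x in I n) (dh x)%:E = (h n.+1%:R - h (- n.+1%:R))%:E)%E.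
  rewrite EFinB; apply: continuous_FTC2.
  - by rewrite (@lt_trans _ _ 0)// oppr_lt0.
  - exact/continuous_subspaceT.
  - have ch : continuous h.
      move=> x; apply: differentiable_continuous; apply/derivable1_diffP.
      exact: ex_derive.
    split.
    + by move=> x _; exact: ex_derive.
    + by apply: cvg_at_right_filter; exact: ch.
    + by apply: cvg_at_left_filter; exact: ch.
  - by move=> x _; rewrite derive1E; exact: derive_val.
pose f_ n := (EFin \o dh) \_ (I n).
have mf_ n : measurable_fun setT (f_ n).
  apply/(measurable_restrictT _ _).1; first exact: measurable_itv.
  by apply/measurable_EFinP; exact: measurable_funTS.
have f_f : {ae mu, forall x, setT x -> f_ ^~ x @ \oo --> (EFin \o dh) x}.
  apply: aeW => x _; apply: cvg_near_cst.
  near=> n; rewrite /f_ patchE mem_set//=.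
  rewrite /I/= in_itv/= -ler_norml.
  apply: (@le_trans _ _ n%:R); last by rewrite ler_nat.
  by near: n; exact: nbhs_infty_ger.
have f_g : {ae mu, forall x n, setT x -> (`|f_ n x| <= (abse \o (EFin \o dh)) x)%E}.
  apply: aeW => x n _; rewrite /f_ patchE /=; case: ifPn => // _.
  by rewrite (_ : point = 0%E)// abse0.
have [_ _] := @dominated_convergence _ _ _ mu setT measurableT f_ (EFin \o dh)
  (abse \o (EFin \o dh)) mf_ (measurable_int mu idh) f_f (integrable_abse idh) f_g.
have -> : (fun n => (\int[mu]_x f_ n x)%E) =
    (fun n => (h n.+1%:R - h (- n.+1%:R))%:E).
  by apply/funext => n; rewrite -integral_mkcond ftc.
have lim0 : (fun n => (h n.+1%:R - h (- n.+1%:R))%:E) @ \oo --> (0:R)%:E.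
  apply: cvg_EFin; first exact: nearW.
  by rewrite -(subr0 0); apply: cvgB.
move=> cv; have E := cvg_unique _ cv lim0.
by rewrite /Rintegral (E _).
Unshelve. all: end_near. Qed.

(** A Gaussian of twice the variance absorbs the factor x: one has |x| <= (1 + 4 s^2) e^(x^2 / (4
    s^2)), and this exponential halves the exponent of the density. The right-hand side is the
    integrable majorant used for differentiation under the integral. *)
Lemma gaussian_moment1 (s x : R) : s != 0 ->
  `|normal_pdf 0 s x * x| <=
  normal_peak s * (1 + 4 * s ^+ 2) / normal_peak (Num.sqrt 2 * s) * normal_pdf 0 (Num.sqrt 2 * s) x.
Proof.
move=> s0.
have s2 : 0 < s ^+ 2 by rewrite exprn_even_gt0.
have ss0 : Num.sqrt 2 * s != 0 by rewrite mulf_neq0// gt_eqF// sqrtr_gt0.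
rewrite !normal_pdfE//= [leRHS]mulrA divfK ?gt_eqF ?normal_peak_gt0//.
rewrite -!mulrA normrM ger0_norm ?normal_peak_ge0// ler_wpM2l ?normal_peak_ge0//.
rewrite /normal_fun !subr0 exprMn sqr_sqrtr//.
have xabs : `|x| <= (1 + 4 * s ^+ 2) * expR (x ^+ 2 / (4 * s ^+ 2)).
  apply: (@le_trans _ _ ((1 + 4 * s ^+ 2) * (1 + x ^+ 2 / (4 * s ^+ 2)))); last first.
    by rewrite ler_wpM2l ?expR_ge1Dx// addr_ge0// mulr_ge0// ltW.
  have -> : (1 + 4 * s ^+ 2) * (1 + x ^+ 2 / (4 * s ^+ 2)) =
    1 + x ^+ 2 + 4 * s ^+ 2 + x ^+ 2 / (4 * s ^+ 2).
    by field; rewrite ?s0 ?gt_eqF.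
  have : 0 <= x ^+ 2 / (4 * s ^+ 2) by rewrite divr_ge0 ?sqr_ge0// mulr_ge0 ?ltW.
  have := sqr_ge0 (`|x| - 1); rewrite -(real_normK (num_real x)).
  have := normr_ge0 x; nra.
rewrite normrM (ger0_norm (expR_ge0 _)) (le_trans (ler_wpM2l (expR_ge0 _) xabs))//.
rewrite mulrCA -expRD ler_wpM2l//; first by rewrite addr_ge0// mulr_ge0// ltW.
rewrite le_eqVlt; apply/orP; left; apply/eqP.
by congr expR; field; rewrite ?s0 ?gt_eqF.
Qed.

Lemma is_derive_normal_pdf (s x : R) : s != 0 ->
  is_derive x (1:R) (normal_pdf 0 s) (- (x / s ^+ 2) * normal_pdf 0 s x).
Proof.
move=> s0; rewrite normal_pdfE//=.
have -> : (fun x => normal_peak s * normal_fun 0 s x) =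
  normal_peak s \*: (expR \o (- (s ^+ 2 *+ 2)^-1 \*: ((id : R -> R) ^+ 2 : R -> R))).
  apply/funext => z; rewrite /normal_fun subr0 !fctE /GRing.scale/=.
  by congr (_ * expR _); rewrite /GRing.scale/=; ring.
apply: is_derive_eq; rewrite /GRing.scale/= !fctE /normal_fun subr0 mulr1 expr1.
rewrite /GRing.scale/=.
  rewrite (_ : - (s ^+ 2 *+ 2)^-1 * x ^+ 2 = - x ^+ 2 / (s ^+ 2 *+ 2)); last by ring.
by field; rewrite s0.
Qed.

Lemma is_derive_cos_affine (c theta y : R) :
  is_derive y (1:R) (fun y => cos (y * c + theta)) (- (c * sin (y * c + theta))).
Proof.
have -> : (fun y => cos (y * c + theta)) = cos \o (c \*: id + cst theta).
  by apply/funext => z; rewrite /= fctE /GRing.scale/= mulrC.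
apply: is_derive_eq; rewrite !fctE /GRing.scale/=.
by rewrite -[c *: y]/(c * y) [c * y]mulrC; ring.
Qed.

Lemma is_derive_sin_affine (c theta y : R) :
  is_derive y (1:R) (fun y => sin (y * c + theta)) (c * cos (y * c + theta)).
Proof.
have -> : (fun y => sin (y * c + theta)) = sin \o (c \*: id + cst theta).
  by apply/funext => z; rewrite /= fctE /GRing.scale/= mulrC.
apply: is_derive_eq; rewrite !fctE /GRing.scale/=.
by rewrite -[c *: y]/(c * y) [c * y]mulrC; ring.
Qed.

Lemma measurable_cos_affine (c theta : R) :
  measurable_fun setT (fun x : R => cos (c * x + theta)).
Proof.
apply: (measurableT_comp (continuous_measurable_fun (@continuous_cos R))).
by apply: measurable_funD => //; apply: measurable_funM.
Qed.

Lemma measurable_sin_affine (c theta : R) :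
  measurable_fun setT (fun x : R => sin (c * x + theta)).
Proof.
apply: (measurableT_comp (continuous_measurable_fun (@continuous_sin R))).
by apply: measurable_funD => //; apply: measurable_funM.
Qed.

Section phase.
Variables (s theta : R).
Hypothesis s0 : s != 0.
Let p := normal_pdf 0 s.

Let integrable_le (g G : R -> R) : measurable_fun setT g ->
  mu.-integrable setT (EFin \o G) -> (forall x, `|g x| <= G x) ->
  mu.-integrable setT (EFin \o g).
Proof.
move=> mg iG gG; apply: le_integrable iG => //; first exact/measurable_EFinP.
by move=> x _; rewrite /= lee_fin (le_trans (gG x))// ler_norm.
Qed.

Let integrable_moment1 (g : R -> R) : measurable_fun setT g ->
  (forall x, `|g x| <= 1) -> mu.-integrable setT (EFin \o (fun x => p x * x * g x)).
Proof.
move=> mg g1.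
pose c := normal_peak s * (1 + 4 * s ^+ 2) / normal_peak (Num.sqrt 2 * s).
apply: (@integrable_le _ (fun x => c * normal_pdf 0 (Num.sqrt 2 * s) x)).
- apply: measurable_funM => //; apply: measurable_funM => //.
  exact: measurable_normal_pdf.
- exact: (integrableZl measurableT c (integrable_normal_pdf 0 (Num.sqrt 2 * s))).
- move=> x; rewrite normrM; apply: le_trans (gaussian_moment1 x s0).
  by rewrite ler_piMr.
Qed.

Let integrable_moment0 (g : R -> R) : measurable_fun setT g ->
  (forall x, `|g x| <= 1) -> mu.-integrable setT (EFin \o (fun x => p x * g x)).
Proof.
move=> mg g1; apply: (@integrable_le _ p).
- by apply: measurable_funM => //; exact: measurable_normal_pdf.
- exact: integrable_normal_pdf.
- by move=> x; rewrite normrM (ger0_norm (normal_pdf_ge0 _ _ _)) ler_piMr ?normal_pdf_ge0.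
Qed.

Let Phi y := \int[mu]_x (p x * cos (y * x + theta)).

(** Differentiation under the integral gives minus the integral of x p sin. Integrating by parts
    with p' = - (x / s^2) p turns that integral into s^2 y times the integral of p cos. *)
Let is_derive_Phi y : is_derive y (1:R) Phi (- (s ^+ 2 * y) * Phi y).
Proof.
pose f y x := p x * cos (y * x + theta).
have df z x : is_derive z (1:R) (f ^~ x) (- (p x * x * sin (z * x + theta))).
  have -> : f ^~ x = p x \*: (fun y => cos (y * x + theta)) by [].
  have d := is_derive_cos_affine x theta z.
  by apply: is_derive_eq; rewrite /GRing.scale/= mulrN mulrA.
have d1f z x : partial1of2 f z x = - (p x * x * sin (z * x + theta)).
  by rewrite /partial1of2 derive1E; exact: derive_val.
pose c := normal_peak s * (1 + 4 * s ^+ 2) / normal_peak (Num.sqrt 2 * s).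
pose G x := c * normal_pdf 0 (Num.sqrt 2 * s) x.
(* The majorant [G] does not depend on [z], so any open interval around [y] would do. *)
have Iy : `]y - 1, y + 1[%classic y.
  by rewrite /= in_itv/= ltrBlDr !ltrDl ltr01.
have intf z : `]y - 1, y + 1[%classic z -> mu.-integrable setT (EFin \o f z).
  move=> _; apply: integrable_moment0; first exact: measurable_cos_affine.
  by move=> x; exact: cos_max.
have derf z x : `]y - 1, y + 1[%classic z -> setT x -> derivable (f ^~ x) z 1.
  by move=> _ _; exact: ex_derive.
have c0 : 0 <= c.
  by rewrite divr_ge0 ?normal_peak_ge0// mulr_ge0 ?normal_peak_ge0// addr_ge0// mulr_ge0// sqr_ge0.
have G0 x : 0 <= G x by rewrite mulr_ge0// normal_pdf_ge0.
have iG : mu.-integrable setT (EFin \o G).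
  exact: (integrableZl measurableT c (integrable_normal_pdf 0 (Num.sqrt 2 * s))).
have Gub z x : `]y - 1, y + 1[%classic z -> setT x -> `|partial1of2 f z x| <= G x.
  move=> _ _; rewrite d1f normrN normrM; apply: le_trans (gaussian_moment1 x s0).
  by rewrite ler_piMr// sin_max.
apply: DeriveDef; first exact: (derivable_under_integral measurableT Iy intf derf G0 iG Gub).
rewrite -derive1E (differentiation_under_integral measurableT Iy intf derf G0 iG Gub).
under eq_Rintegral do rewrite d1f.
have ms := measurable_sin_affine y theta; have mc := measurable_cos_affine y theta.
have i1 := integrable_moment1 ms (fun x => sin_max _).
have i0 := integrable_moment0 mc (fun x => cos_max _).
pose dh x := - (s ^- 2) * (p x * x * sin (y * x + theta)) + y * (p x * cos (y * x + theta)).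
have idh : mu.-integrable setT (EFin \o dh).
  have := integrableD measurableT (integrableZl measurableT (- s ^- 2) i1)
    (integrableZl measurableT y i0).
  by apply: eq_integrable.
have cp : continuous p by exact: continuous_normal_pdf.
have cdh : continuous dh.
  move=> x.
  have cx : {for x, continuous (fun x : R => y * x + theta)}.
    by apply: cvgD; [apply: cvgM; [exact: cvg_cst|exact: cvg_id]|exact: cvg_cst].
  apply: cvgD; apply: cvgM; try exact: cvg_cst; apply: cvgM.
  - by apply: cvgM; [exact: cp|exact: cvg_id].
  - by apply: (cvg_comp _ _ cx); exact: continuous_sin.
  - exact: cp.
  - by apply: (cvg_comp _ _ cx); exact: continuous_cos.
pose h x := p x * sin (y * x + theta).
have hdh x : is_derive x (1:R) h (dh x).
  have d1 := is_derive_normal_pdf x s0.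
  have d2 := is_derive_sin_affine y theta x.
  have -> : h = p * (fun x => sin (x * y + theta)).
    by apply/funext => z; rewrite /h fctE [z * y]mulrC.
  apply: (is_derive_eq (is_deriveM d1 d2)); rewrite /GRing.scale/= /dh [x * y]mulrC.
  rewrite -/(p x); move: (p x) (sin _) (cos _) => a b e.
  by field; rewrite s0.
have hle x : `|h x| * `|x| <= c * normal_peak (Num.sqrt 2 * s).
  rewrite -normrM (_ : h x * x = p x * x * sin (y * x + theta)); last by rewrite /h; ring.
  rewrite normrM.
  apply: (@le_trans _ _ `|p x * x|); first by rewrite ler_piMr// sin_max.
  apply: (le_trans (gaussian_moment1 x s0)); rewrite ler_wpM2l// normal_pdf_ub//.
  by rewrite mulf_neq0// gt_eqF// sqrtr_gt0.
have h0 (u : nat -> R) : (forall n, `|u n| = n.+1%:R) -> h (u n) @[n --> \oo] --> (0:R).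
  move=> un; apply: norm_cvg0.
  have H : (fun n => c * normal_peak (Num.sqrt 2 * s) * (n.+1%:R)^-1) @ \oo --> (0 : R).
    rewrite -(mulr0 (c * normal_peak (Num.sqrt 2 * s))).
    by apply: cvgM; [exact: cvg_cst|exact: cvg_harmonic].
  apply: (squeeze_cvgr _ (cvg_cst 0) H); apply: nearW => n.
  by rewrite normr_ge0/= ler_pdivlMr// -un hle.
have := Rintegral_derive_eq0 hdh cdh idh.
move=> /(_ (h0 _ (fun n => ger0_norm (ler0n _ n.+1)))) dh0.
have {}dh0 : \int[mu]_x dh x = 0.
  by apply/dh0/h0 => n; rewrite normrN ger0_norm.
move: dh0; rewrite RintegralD//; last 2 first.
- exact: (integrableZl measurableT (- s ^- 2) i1).
- exact: (integrableZl measurableT y i0).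
rewrite !RintegralZl// => dh0.
under eq_Rintegral do rewrite -mulN1r.
rewrite RintegralZl// mulN1r.
have := dh0; rewrite -/(Phi y).
move: (Rintegral _ _ _) (Phi y) => a b E.
move: E; rewrite mulNr addrC => /eqP; rewrite subr_eq0 => /eqP e.
by rewrite mulNr -mulrA e; field; rewrite s0.
Qed.

(** By the differential equation, [Phi z] times e^(s^2 z^2 / 2) has derivative zero, and at 0 it
    equals [cos theta]. The phase [theta] treats cosine and sine at once. *)
Lemma integral_normal_pdf_cos y :
  \int[mu]_x (p x * cos (y * x + theta)) = expR (- (s ^+ 2 * y ^+ 2 / 2)) * cos theta.
Proof.
rewrite -/(Phi y).
pose g z := Phi z * expR (s ^+ 2 * z ^+ 2 / 2).
have dg z : is_derive z (1:R) g 0.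
  have d1 := is_derive_Phi z.
  have -> : g = Phi * (expR \o ((s ^+ 2 / 2) \*: ((id : R -> R) ^+ 2 : R -> R))).
    apply/funext => u; rewrite /g !fctE /=; congr (_ * expR _).
    by rewrite /GRing.scale/=; ring.
  apply: is_derive_eq; rewrite !fctE /GRing.scale/=.
  by move: (expR _) (Phi z) => a b; field.
have := is_derive_0_is_cst y 0 dg.
rewrite /g expr0n mulr0 mul0r expR0 mulr1 expRN.
have -> : Phi 0 = cos theta.
  rewrite /Phi; under eq_Rintegral do rewrite mul0r add0r mulrC.
  rewrite RintegralZl//; last exact: integrable_normal_pdf.
  by rewrite /Rintegral integral_normal_pdf mulr1.
move=> <-; rewrite mulrCA mulVf ?mulr1//.
by rewrite gt_eqF// expR_gt0.
Qed.

End phase.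

End gaussian_charfun.

(** * Sums of independent variables *)

Section gaussian_sums.
Variable R : realType.

Lemma Rintegral_normal_prob (s : R) (f : R -> R) : bounded_mfun f ->
  \int[normal_prob 0 s]_x f x = \int[lebesgue_measure]_x (normal_pdf 0 s x * f x).
Proof.
apply: (@Rintegral_density _ _ _ _ _ lebesgue_measure (normal_pdf 0 s) id).
- exact: normal_pdf_ge0.
- exact: integrable_normal_pdf.
- exact: measurable_id.
- by [].
Qed.

Lemma normal_prob_cos (s y : R) : s != 0 ->
  \int[normal_prob 0 s]_x cos (y * x) = expR (- (s ^+ 2 * y ^+ 2 / 2)).
Proof.
move=> s0; have := integral_normal_pdf_cos 0 s0 y.
rewrite cos0 mulr1 => <-; rewrite Rintegral_normal_prob.
  by apply: eq_Rintegral => x _; rewrite addr0.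
by apply: bounded_mfun_cos; exact: measurable_funM.
Qed.

Lemma normal_prob_sin (s y : R) : s != 0 ->
  \int[normal_prob 0 s]_x sin (y * x) = 0.
Proof.
move=> s0; rewrite Rintegral_normal_prob; last first.
  by apply: bounded_mfun_sin; exact: measurable_funM.
(* A phase of - pi / 2 turns the cosine into a sine. *)
have := integral_normal_pdf_cos (- (pi / 2)) s0 y.
rewrite cosN cos_pihalf mulr0 => H; rewrite -[RHS]H.
by apply: eq_Rintegral => x _; rewrite cosBpihalf.
Qed.

Section independent.
Context d (S : measurableType d) (Pr : probability S R).

(** The hypothesis says that the conditional expectation of [f] given [V] is the constant [c]. To
    work with measures, [f] is shifted by [M]: under the density [f + M], the image of [Pr] by [V]
    is [c + M] times the law of [V]. *)
Lemma Rintegral_uncorrelated (f : S -> R) (V : S -> R) (c : R) (phi : R -> R) :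
  bounded_mfun f -> measurable_fun setT V ->
  (forall A, measurable A ->
    \int[Pr]_(w in V @^-1` A) f w = c * fine (Pr (V @^-1` A))) ->
  bounded_mfun phi ->
  \int[Pr]_w (f w * phi (V w)) = c * \int[Pr]_w phi (V w).
Proof.
move=> bf mV fV bphi.
have [nu lawV] : exists nu : probability R R,
    forall A : set R, measurable A -> nu A = Pr (V @^-1` A).
  by exists (distribution Pr (mfun_Sub (mem_set mV))).
have [mf [M0 fM0]] := bf.
pose M : R := `|M0|; have fM x : `|f x| <= M by rewrite (le_trans (fM0 x))// ler_norm.
have cE : c = \int[Pr]_w f w.
  have := fV setT measurableT; rewrite preimage_setT => ->.
  by rewrite probability_setT mulr1.
have cM : 0 <= c + M.
  rewrite -lerBlDr sub0r cE; have := bounded_Rintegral_le Pr bf fM.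
  by rewrite ler_norml => /andP[].
have bM := @bounded_mfun_cst _ S _ M.
have bphiV : bounded_mfun (phi \o V).
  have [mphi [K phiK]] := bphi; split; first exact: measurableT_comp.
  by exists K => x; exact: phiK.
have bfM : bounded_mfun (fun w => f w + M) by exact: bounded_mfunD.
have bfphi : bounded_mfun (fun w => f w * phi (V w)) by exact: (bounded_mfunM bf bphiV).
have mVU U : measurable U -> measurable (V @^-1` U).
  by move=> mU; rewrite -[_ @^-1` _]setTI; exact: mV.
have e1 : \int[Pr]_w phi (V w) = \int[nu]_x phi x.
  by symmetry; exact: Rintegral_law.
pose nu' : {measure set R -> \bar R} := mscale (NngNum cM) nu.
have : \int[nu']_x phi x = \int[Pr]_w ((f w + M) * phi (V w)).
  apply: (@Rintegral_density _ _ _ _ _ Pr (fun w => f w + M) V nu') => //.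
  - by move=> w; rewrite -lerBlDr sub0r; have := fM w; rewrite ler_norml => /andP[].
  - exact: bounded_mfun_integrable.
  - move=> U mU.
    have ifVU g : bounded_mfun g -> Pr.-integrable (V @^-1` U) (EFin \o g).
      move=> bg; apply: (integrableS measurableT (mVU _ mU) (@subsetT _ _)).
      exact: bounded_mfun_integrable.
    transitivity (\int[Pr]_(w in V @^-1` U) (f w + M))%:E; last first.
      by rewrite /Rintegral fineK//; apply: integrable_fin_num; [exact: mVU|exact: ifVU].
    rewrite RintegralD//; [|exact: mVU|exact: ifVU|exact: (ifVU (cst M))].
    rewrite fV// Rintegral_cst; last exact: mVU.
    transitivity ((c * fine (nu U) + M * fine (nu U))%:E).
      by rewrite -mulrDl EFinM fineK// fin_num_measure.
    by rewrite lawV.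
rewrite (_ : \int[nu']_x phi x = (c + M) * \int[nu]_x phi x); last first.
  rewrite -bounded_RintegralZl//.
  apply: (@Rintegral_density _ _ _ _ _ nu (cst (c + M)) id nu') => //.
    exact/bounded_mfun_integrable/bounded_mfun_cst.
  move=> U mU; transitivity (\int[nu]_(x in U) (cst (c + M)%:E x))%E => //.
  by rewrite integral_cst.
under [X in _ = X -> _]eq_Rintegral do rewrite mulrDl.
rewrite bounded_RintegralD//; last exact: bounded_mfunM.
by rewrite bounded_RintegralZl// e1 mulrDl => /addIr ->.
Qed.

Lemma Rintegral_indic_mul (D : set S) (f : S -> R) :
  \int[Pr]_(w in D) f w = \int[Pr]_w (\1_D w * f w).
Proof.
rewrite Rintegral_mkcond; apply: eq_Rintegral => w _.
by rewrite patchE indicE; case: ifPn; rewrite ?mul1r ?mul0r.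
Qed.

Lemma bounded_mfun_indic (D : set S) : measurable D -> bounded_mfun (\1_D : S -> R).
Proof.
move=> mD; split; first exact: measurable_indic.
by exists 1 => w; rewrite indicE; case: (_ \in _); rewrite ?normr1 ?normr0.
Qed.

Variables (N : nat) (V : 'I_N -> S -> R).
Hypothesis mV : forall i, measurable_fun setT (V i).
Hypothesis indepV : forall A : 'I_N -> set R, (forall i, measurable (A i)) ->
  Pr (\bigcap_i (V i @^-1` A i)) = (\prod_(i < N) Pr (V i @^-1` A i))%E.

Let event (A : 'I_N -> set R) := \bigcap_i (V i @^-1` A i).

Let measurable_event A : (forall i, measurable (A i)) -> measurable (event A).
Proof.
move=> mA; apply: fin_bigcap_measurable; first exact: finite_finset.
by move=> i _; rewrite -[_ @^-1` _]setTI; exact: mV.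
Qed.

Let fine_prod (A : 'I_N -> set R) : (forall i, measurable (A i)) ->
  fine (\prod_(i < N) Pr (V i @^-1` A i))%E =
  \prod_(i < N) fine (Pr (V i @^-1` A i)).
Proof.
move=> mA; rewrite (eq_bigr (fun i => (fine (Pr (V i @^-1` A i)))%:E)).
  by rewrite prodEFin.
move=> i _; rewrite fineK// fin_num_measure//.
by rewrite -[_ @^-1` _]setTI; exact: mV.
Qed.

(** The variables are added one at a time with the addition formulas; independence of the next one
    from the partial sum is derived from the product rule for events, with no product space. *)
Lemma independent_sum_cos_sin (y a : R) :
  (forall i, \int[Pr]_w cos (y * V i w) = a) ->
  (forall i, \int[Pr]_w sin (y * V i w) = 0) ->
  \int[Pr]_w cos (y * \sum_(i < N) V i w) = a ^+ N /\
  \int[Pr]_w sin (y * \sum_(i < N) V i w) = 0.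
Proof.
move=> cosa isin0.
pose T k w := \sum_(i < N | (i < k)%N) V i w.
have mT k : measurable_fun setT (T k).
  rewrite (_ : T k = fun w => \sum_(i < N) (if (i < k)%N then V i w else 0)).
    by apply: measurable_sum => i; case: (_ < _)%N; [exact: mV|exact: measurable_cst].
  by apply/funext => w; rewrite /T big_mkcond.
have mid : measurable_fun setT (fun x : R => y * x) by exact: measurable_funM.
have bc k : bounded_mfun (fun w => cos (y * T k w)).
  by apply: bounded_mfun_cos; exact: measurable_funM.
have bs k : bounded_mfun (fun w => sin (y * T k w)).
  by apply: bounded_mfun_sin; exact: measurable_funM.
(* The statement is strengthened by an indicator constraining the variables not yet added: [A i] is
   arbitrary for [i >= k]. This is what the induction uses to express independence of variable [k]
   from the partial sum [T k]. *)
suff claim k : (k <= N)%N -> forall A : 'I_N -> set R, (forall i, measurable (A i)) ->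
    (forall i : 'I_N, (i < k)%N -> A i = setT) ->
    \int[Pr]_w (\1_(event A) w * cos (y * T k w)) =
      a ^+ k * \prod_(i < N) fine (Pr (V i @^-1` A i)) /\
    \int[Pr]_w (\1_(event A) w * sin (y * T k w)) = 0.
  have [] := claim N (leqnn N) (fun=> setT) (fun=> measurableT) (fun _ _ => erefl).
  rewrite (_ : event _ = setT); last by rewrite /event bigcapT.
  have TN w : T N w = \sum_(i < N) V i w by apply: eq_bigl => i; rewrite ltn_ord.
  under eq_Rintegral do rewrite indicT mul1r TN.
  move=> ->; under eq_Rintegral do rewrite indicT mul1r TN.
  move=> ->; split => //.
  by rewrite big1 ?mulr1// => i _; rewrite probability_setT.
elim: k => [_ A mA _|k IH kN A mA AT].
  have T0 w : T 0%N w = 0 by rewrite /T big_pred0.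
  under eq_Rintegral do rewrite T0 mulr0 cos0.
  under [X in _ /\ X = _]eq_Rintegral do rewrite T0 mulr0 sin0 mulr0.
  rewrite -(Rintegral_indic_mul _ (cst 1)) probability_Rintegral_cst; split => //.
  rewrite Rintegral_cst; last exact: measurable_event.
  by rewrite expr0 !mul1r -fine_prod// -indepV.
pose i0 := Ordinal kN.
pose c := a ^+ k * \prod_(i < N) fine (Pr (V i @^-1` A i)).
have AB B : measurable B ->
   \int[Pr]_(w in V i0 @^-1` B) (\1_(event A) w * cos (y * T k w)) = c * fine (Pr (V i0 @^-1` B)) /\
   \int[Pr]_(w in V i0 @^-1` B) (\1_(event A) w * sin (y * T k w)) = 0 * fine (Pr (V i0 @^-1` B)).
  move=> mB; pose A' i := if i == i0 then B else A i.
  have mA' i : measurable (A' i) by rewrite /A'; case: ifP.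
  have A'T (i : 'I_N) : (i < k)%N -> A' i = setT.
    move=> ik; rewrite /A'; case: eqP => [ii0|_]; last by apply: AT; exact: ltnW.
    by move: ik; rewrite ii0 ltnn.
  have eA' : event A' = V i0 @^-1` B `&` event A.
    apply/seteqP; split => [w Aw|w [Bw Aw] i _].
      split; first by have := Aw i0 I; rewrite /A' /= eqxx.
      move=> i _; have := Aw i I; rewrite /A' /=; case: eqP => // -> _.
      by rewrite AT.
    by rewrite /A'; case: eqP => [->//|_]; exact: Aw.
  have [IHc IHs] := IH (ltnW kN) A' mA' A'T.
  have ind g : \int[Pr]_(w in V i0 @^-1` B) (\1_(event A) w * g w) =
      \int[Pr]_w (\1_(event A') w * g w).
    rewrite Rintegral_indic_mul; apply: eq_Rintegral => w _.
    by rewrite eA' indicI mulrA.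
  rewrite !ind IHc IHs mul0r; split => //.
  rewrite /c (bigD1 i0)//= [in RHS](bigD1 i0)//= AT//= probability_setT mul1r.
  rewrite /A' eqxx -mulrA; congr (_ * _); rewrite mulrC; congr (_ * _).
  by apply: eq_bigr => i /negbTE ->.
have bE := bounded_mfun_indic (measurable_event mA).
have TS w : y * T k.+1 w = y * T k w + y * V i0 w.
  rewrite -mulrDr; congr (_ * _); rewrite /T (bigD1 i0)//= addrC; congr (_ + _).
  apply: eq_bigl => i; rewrite ltnS -(inj_eq val_inj)/= leq_eqVlt.
  by case: eqP => [->|] //=; rewrite ?ltnn ?andbT ?andbF.
have bcV : bounded_mfun (fun x : R => cos (y * x)) by exact: bounded_mfun_cos.
have bsV : bounded_mfun (fun x : R => sin (y * x)) by exact: bounded_mfun_sin.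
have bcVw : bounded_mfun (fun w => cos (y * V i0 w)).
  by apply: bounded_mfun_cos; exact: measurable_funM.
have bsVw : bounded_mfun (fun w => sin (y * V i0 w)).
  by apply: bounded_mfun_sin; exact: measurable_funM.
have bEc := bounded_mfunM bE (bc k); have bEs := bounded_mfunM bE (bs k).
have cc := Rintegral_uncorrelated bEc (mV i0) (fun B mB => (AB B mB).1) bcV.
have cs := Rintegral_uncorrelated bEc (mV i0) (fun B mB => (AB B mB).1) bsV.
have sc := Rintegral_uncorrelated bEs (mV i0) (fun B mB => (AB B mB).2) bcV.
have ss := Rintegral_uncorrelated bEs (mV i0) (fun B mB => (AB B mB).2) bsV.
split.
  under eq_Rintegral do rewrite TS cosD mulrBr !mulrA.
  rewrite bounded_RintegralB; [|exact: bounded_mfunM|exact: bounded_mfunM].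
  by rewrite cc ss cosa mul0r subr0 /c exprS mulrC mulrA.
under eq_Rintegral do rewrite TS sinD mulrDr !mulrA.
rewrite bounded_RintegralD; [|exact: bounded_mfunM|exact: bounded_mfunM].
by rewrite sc cs isin0 mulr0 mul0r addr0.
Qed.

End independent.
End gaussian_sums.

(** * The trace of Dyson Brownian motion *)

Section borel_measurability.
Variable R : realType.

Lemma continuous_borel_measurable (T : ptopologicalType) (f : T -> R) :
  continuous f -> measurable_fun [set: borel T] (f : borel T -> R).
Proof.
move=> /continuousP cf; apply: (measurability _ (RGenOpens.measurableE R)).
move=> _ [_ [a [b ->] <-]]; rewrite setTI; apply: sub_sigma_algebra.
exact/cf/interval_open.
Qed.

End borel_measurability.

Section dyson_trace.
Variable R : realType.

Definition coord_sum (N : nat) (x : Weyl R N) : R := \sum_(i < N) coords x 0 i.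

Lemma continuous_coords (N : nat) (i : 'I_N) :
  continuous (fun x : Weyl R N => coords x 0 i).
Proof.
move=> x; apply: (@continuous_comp _ _ _ (fun x : Weyl R N => coords x)
  (fun M : 'rV[R]_N => M 0 i)).
  exact: initial_continuous.
exact: coord_continuous.
Qed.

Lemma measurable_coord_sum N :
  measurable_fun [set: borel (Weyl R N)] (@coord_sum N : borel (Weyl R N) -> R).
Proof.
apply: measurable_sum => i.
exact: (continuous_borel_measurable (@continuous_coords N i)).
Qed.

(** The summand is antisymmetric in (i, j); with [0^-1 = 0] this also holds where coordinates
    coincide. *)
Lemma sum_dyson_drift N (x : 'rV[R]_N) : \sum_(i < N) dyson_drift x i = 0.
Proof.
pose g i j := if j != i then (x 0 i - x 0 j)^-1 else 0.
have -> : \sum_(i < N) dyson_drift x i = \sum_(i < N) \sum_(j < N) g i j.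
  by apply: eq_bigr => i _; rewrite /dyson_drift big_mkcond.
have gN i j : g j i = - g i j.
  by rewrite /g eq_sym; case: ifP => _; rewrite ?oppr0// -invrN opprB.
have : \sum_(i < N) \sum_(j < N) g i j = - \sum_(i < N) \sum_(j < N) g i j.
  rewrite {1}exchange_big -sumrN; apply: eq_bigr => i _.
  by rewrite -sumrN; apply: eq_bigr => j _; exact: gN.
by move/eqP; rewrite -addr_eq0 -mulr2n mulrn_eq0 => /eqP.
Qed.

(** Each drift is integrable by itself, so the finite sum passes under the time integral before the
    drifts cancel. *)
Lemma dyson_trace N (x0 : Weyl R N) d (S : measurableType d)
    (Pr : probability S R) (F : R -> set (set S)) (W : 'I_N -> R -> S -> R)
    (X : R -> S -> borel (Weyl R N)) (t : R) :
  is_DBM_solution x0 Pr F W X -> 0 <= t ->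
  {ae Pr, forall w, coord_sum (X t w) = coord_sum x0 + \sum_(i < N) W i t w}.
Proof.
move=> [_ [_ _ sol]] t0; apply: filterS sol => w [_ int eqn].
rewrite /coord_sum; under eq_bigr do rewrite eqn//.
rewrite big_split /= big_split /= -[RHS]addr0; congr (_ + _).
pose f i s := dyson_drift (coords (X s w)) i.
transitivity (\int[lebesgue_measure]_(s in `[0, t]) (\sum_(i < N) f i s)).
  rewrite /Rintegral; under [in RHS]eq_integral do rewrite -sumEFin.
  rewrite integral_sum//; last by move=> i; exact: int.
  rewrite sum_fine// => i _; apply: integrable_fin_num => //; exact: int.
under eq_Rintegral do rewrite sum_dyson_drift.
by rewrite Rintegral_cst// mul0r.
Qed.

Lemma ae_eq_Rintegral d (S : measurableType d) (Pr : probability S R) (f g : S -> R) :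
  bounded_mfun f -> bounded_mfun g -> {ae Pr, forall w, f w = g w} ->
  \int[Pr]_w f w = \int[Pr]_w g w.
Proof.
move=> [mf _] [mg _] fg; congr fine; apply: ae_eq_integral => //.
- exact/measurable_EFinP.
- exact/measurable_EFinP.
- by apply: filterS fg => w -> _.
Qed.

(** The trace at time [t] is its initial value plus a sum of [N] independent Gaussian variables of
    variance [t], each contributing the factor e^(- t y^2 / 2). *)
Lemma dyson_trace_charfun N
    (P : R -> R.-pker (borel (Weyl R N)) ~> (borel (Weyl R N))) (t y : R)
    (x0 : Weyl R N) :
  is_DBM_semigroup P -> 0 < t ->
  \int[kernel_prob (P t) x0]_x cos (y * coord_sum x) =
    expR (- (t * y ^+ 2 / 2)) ^+ N * cos (y * coord_sum x0) /\
  \int[kernel_prob (P t) x0]_x sin (y * coord_sum x) =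
    expR (- (t * y ^+ 2 / 2)) ^+ N * sin (y * coord_sum x0).
Proof.
move=> [_ dbm] t0; have [d [S [Pr [F [W [X [sol law]]]]]]] := dbm x0.
have [[[filtF _] [adW W0 _ incW] adX] _] := sol.
have t0' := ltW t0.
have tr := dyson_trace sol t0'.
have Fm A : F t A -> measurable A by have [_] := filtF _ t0'; exact.
have mX : measurable_fun setT (X t).
  by move=> _ A mA; rewrite setTI; apply/Fm/adX.
have mW i : measurable_fun setT (W i t).
  by move=> _ A mA; rewrite setTI; apply/Fm/adW.
pose s := Num.sqrt t.
have s0 : s != 0 by rewrite gt_eqF// sqrtr_gt0.
have normalW (A : 'I_N -> set R) : (forall i, measurable (A i)) ->
  Pr (\bigcap_i (W i t @^-1` A i)) = (\prod_(i < N) normal_prob 0 s (A i))%E.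
  move=> mA; have F0T : F 0 setT.
    have [[FS0 FSD _] _] := filtF _ (lexx 0).
    by rewrite -(setD0 setT); exact: FSD.
  (* The increments are taken from time 0, where [W] vanishes, on the event [setT]. *)
  have := incW 0 t setT A (lexx 0) t0 F0T mA.
  rewrite setTI subr0 => H; transitivity (Pr setT * \prod_(i < N) normal_prob 0 s (A i))%E.
    rewrite -H; congr (Pr _); apply: eq_bigcapr => i _.
    by apply/seteqP; split => w /=; rewrite W0 subr0.
  by rewrite probability_setT mul1e.
have lawW i (B : set R) : measurable B -> Pr (W i t @^-1` B) = normal_prob 0 s B.
  (* The marginal law: all other coordinates are left unconstrained. *)
  move=> mB; pose A j := if j == i then B else setT.
  have := normalW A; rewrite (_ : \bigcap_i _ = W i t @^-1` B).
    move=> ->; last by move=> j; rewrite /A; case: ifP.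
    rewrite (bigD1 i)//= /A eqxx big1 ?mule1// => j /negbTE ->.
    exact: probability_setT.
  apply/seteqP; split => [w /(_ i I)|w Bw j _]; rewrite /A /=; first by rewrite eqxx.
  by case: eqP => [->|].
have indepW (A : 'I_N -> set R) : (forall i, measurable (A i)) ->
    Pr (\bigcap_i (W i t @^-1` A i)) = (\prod_(i < N) Pr (W i t @^-1` A i))%E.
  by move=> mA; rewrite normalW//; apply: eq_bigr => i _; rewrite lawW.
have cosW i : \int[Pr]_w cos (y * W i t w) = expR (- (s ^+ 2 * y ^+ 2 / 2)).
  rewrite -(normal_prob_cos y s0); symmetry.
  apply: (@Rintegral_law _ _ S (measurableTypeR R) R Pr (W i t) (normal_prob 0 s)).
  - exact: mW.
  - by move=> U mU; rewrite lawW.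
  - by apply: bounded_mfun_cos; exact: measurable_funM.
have sinW i : \int[Pr]_w sin (y * W i t w) = 0.
  have := normal_prob_sin y s0 => <-; symmetry.
  apply: (@Rintegral_law _ _ S (measurableTypeR R) R Pr (W i t) (normal_prob 0 s)).
  - exact: mW.
  - by move=> U mU; rewrite lawW.
  - by apply: bounded_mfun_sin; exact: measurable_funM.
have [ec es] := independent_sum_cos_sin mW indepW cosW sinW.
rewrite sqr_sqrtr// in ec.
have my : measurable_fun [set: borel (Weyl R N)] (fun x : borel (Weyl R N) => y * coord_sum x).
  by apply: measurable_funM => //; exact: measurable_coord_sum.
have mTX : measurable_fun setT (fun w => y * coord_sum (X t w)).
  by apply: (measurableT_comp my mX).
have mTW : measurable_fun setT (fun w => y * \sum_(i < N) W i t w).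
  by apply: measurable_funM => //; apply: measurable_sum.
have bcW := bounded_mfun_cos mTW; have bsW := bounded_mfun_sin mTW.
have bC c := @bounded_mfun_cst _ S _ c.
split.
  rewrite (@Rintegral_law _ _ S (borel (Weyl R N)) R Pr (X t) (kernel_prob (P t) x0) _ mX
    (fun U mU => law t U t0' mU)); last exact: bounded_mfun_cos my.
  rewrite (@ae_eq_Rintegral _ _ _ _ (fun w =>
    cos (y * coord_sum x0) * cos (y * \sum_(i < N) W i t w) -
    sin (y * coord_sum x0) * sin (y * \sum_(i < N) W i t w))).
  - rewrite bounded_RintegralB; [|exact: bounded_mfunM|exact: bounded_mfunM].
    by rewrite !bounded_RintegralZl// ec es mulr0 subr0 mulrC.
  - exact: bounded_mfun_cos.
  - by apply: bounded_mfunB; exact: bounded_mfunM.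
  - by apply: filterS tr => w ->; rewrite mulrDr cosD.
rewrite (@Rintegral_law _ _ S (borel (Weyl R N)) R Pr (X t) (kernel_prob (P t) x0) _ mX
    (fun U mU => law t U t0' mU)); last exact: bounded_mfun_sin my.
rewrite (@ae_eq_Rintegral _ _ _ _ (fun w =>
    sin (y * coord_sum x0) * cos (y * \sum_(i < N) W i t w) +
    cos (y * coord_sum x0) * sin (y * \sum_(i < N) W i t w))).
- rewrite bounded_RintegralD; [|exact: bounded_mfunM|exact: bounded_mfunM].
  by rewrite !bounded_RintegralZl// ec es mulr0 addr0 mulrC.
- exact: bounded_mfun_sin.
- by apply: bounded_mfunD; exact: bounded_mfunM.
- by apply: filterS tr => w ->; rewrite mulrDr sinD.
Qed.

End dyson_trace.

(** * The trace of the corners *)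

Section corner_trace.
Variable R : realType.
Implicit Types (X : H_oo R) (N : nat).
Local Open Scope complex_scope.

Lemma entry_conj X i j : entry X j i = Num.conj (entry X i j).
Proof. by have := valP X; rewrite inE => /(_ i j). Qed.

Lemma corner_hermitian N X : corner N X \is hermsymmx.
Proof.
apply/is_hermitianmxP; rewrite expr0 scale1r; apply/matrixP => i j.
by rewrite !mxE entry_conj.
Qed.

Lemma char_poly_conjmx (F : fieldType) n (P D : 'M[F]_n) : P \in unitmx ->
  char_poly (invmx P *m D *m P) = char_poly D.
Proof.
move=> uP; rewrite /char_poly.
have -> : char_poly_mx (invmx P *m D *m P) =
    map_mx polyC (invmx P) *m char_poly_mx D *m map_mx polyC P.
  rewrite /char_poly_mx !map_mxM mulmxBr mulmxBl; congr (_ - _).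
  by rewrite scalar_mxC -mulmxA -map_mxM mulVmx// map_mx1 mulmx1.
rewrite !det_mulmx mulrAC -det_mulmx -map_mxM mulVmx// map_mx1 det1.
by rewrite mul1r.
Qed.

Lemma hermitian_char_poly_split N (A : 'M[R[i]]_N) : A \is hermsymmx ->
  exists r : 'I_N -> R, char_poly A = \prod_(i < N) ('X - ((r i)%:C)%:P).
Proof.
move=> hA; have nA := hermitian_normalmx hA.
have /mxOverP dreal := hermitian_spectral_diag_real hA.
exists (fun i => complex.Re (spectral_diag A 0 i)).
have /orthomx_spectralP AE := nA.
rewrite {1}AE char_poly_conjmx ?unitarymx_unit ?spectral_unitarymx//.
rewrite char_poly_trig ?diag_mx_is_trig//.
apply: eq_bigr => i _; rewrite !mxE eqxx mulr1n RRe_real//.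
Qed.

(** [eigenvalues] is a choice with a default value, so a witness is needed: the real diagonal given
    by the spectral theorem, sorted into the chamber. *)
Lemma hermitian_eigenvalues N (A : 'M[R[i]]_N) : A \is hermsymmx ->
  char_poly A = \prod_(i < N) ('X - ((coords (eigenvalues A) 0 i)%:C)%:P).
Proof.
move=> /hermitian_char_poly_split[r rE].
pose s := sort <=%R [seq r i | i <- enum 'I_N].
have ss : size s = N by rewrite size_sort size_map size_enum_ord.
have xW : (\row_(i < N) nth 0 s i : 'rV[R]_N) \in @chamber R N.
  rewrite inE => i j ij; rewrite !mxE.
  apply: (sorted_leq_nth (@le_trans _ R) (@lexx _ R)) => //; rewrite ?inE ?ss//.
  exact: sort_le_sorted.
rewrite /eigenvalues.
apply: (@xgetPex _ point [set x : Weyl R N |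
    char_poly A = \prod_(i < N) ('X - ((coords x 0 i)%:C)%:P)]).
exists (SigSub xW); rewrite /= rE /coords /=.
under [RHS]eq_bigr do rewrite mxE.
transitivity (\prod_(z <- s) ('X - (z%:C)%:P)).
  rewrite (perm_big [seq r i | i <- enum 'I_N]) ?perm_sort//=.
  by rewrite big_map big_enum.
by rewrite (big_nth 0) ss big_mkord.
Qed.

(** Both traces are, up to sign, the same coefficient of the characteristic polynomial; the
    right-hand side is the trace of a diagonal matrix. Size 0 has no such coefficient and is treated
    apart. *)
Lemma trace_of_char_poly N (A : 'M[R[i]]_N) (r : 'I_N -> R[i]) :
  char_poly A = \prod_(i < N) ('X - (r i)%:P) -> \tr A = \sum_(i < N) r i.
Proof.
case: N A r => [|n] A r E; first by rewrite /mxtrace !big_ord0.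
have D : char_poly (diag_mx (\row_i r i)) = char_poly A.
  rewrite E char_poly_trig ?diag_mx_is_trig//.
  by apply: eq_bigr => i _; rewrite !mxE eqxx.
have := char_poly_trace A (ltn0Sn n); rewrite -D char_poly_trace// => /oppr_inj <-.
by rewrite mxtrace_diag; apply: eq_bigr => i _; rewrite mxE.
Qed.

Definition corner_trace N X : R := \sum_(i < N) complex.Re (entry X i i).

Lemma corner_traceE N X : \tr (corner N X) = (corner_trace N X)%:C.
Proof.
rewrite /mxtrace /corner_trace rmorph_sum /=; apply: eq_bigr => i _.
rewrite mxE RRe_real//; apply/CrealP; exact/esym/entry_conj.
Qed.

Lemma coord_sum_corner_eigenvalues N X :
  coord_sum (corner_eigenvalues N X) = corner_trace N X.
Proof.
have := trace_of_char_poly (hermitian_eigenvalues (corner_hermitian N X)).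
by rewrite corner_traceE -rmorph_sum /= => /complexI ->.
Qed.

Lemma continuous_Re : continuous (@complex.Re R : R[i]^o -> R).
Proof.
move=> z; have nF := nbhs_filter (z : R[i]^o).
apply/(@cvgrPdist_lt _ _ _ _ nF) => e e0.
have e0' : 0 < e%:C by rewrite ltcR.
have := @nbhsx_ballx _ R[i]^o z _ e0'; apply: filterS => u.
rewrite -ltcR; apply: le_lt_trans; rewrite normc_def lecR.
rewrite -sqrtr_sqr ler_sqrt; last by rewrite addr_ge0 ?sqr_ge0.
by case: z {nF} u => [a b] [c d] /=; rewrite lerDl sqr_ge0.
Qed.

Lemma continuous_entry (i j : nat) : continuous (fun X => entry X i j : R[i]^o).
Proof.
move=> X.
have c1 : {for X, continuous (\val : H_oo R -> {ptws nat -> {ptws nat -> R[i]^o}})}.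
  exact: initial_continuous.
have c2 := @proj_continuous nat (fun=> {ptws nat -> R[i]^o}) i (\val X).
have c3 := @proj_continuous nat (fun=> R[i]^o) j (\val X i).
exact: (cvg_comp _ _ (cvg_comp _ _ c1 c2) c3).
Qed.

Lemma measurable_corner_trace N :
  measurable_fun [set: borel (H_oo R)] (corner_trace N : borel (H_oo R) -> R).
Proof.
apply: measurable_sum => i; apply: (@continuous_borel_measurable R (H_oo R)) => X.
by apply: (cvg_comp _ _ (@continuous_entry i i X)); exact: continuous_Re.
Qed.

End corner_trace.

Section corner_charfun.
Variable R : realType.
Local Open Scope complex_scope.

Lemma cexp_i (a : R) : cexp ('i%C * a%:C) = cos a +i* sin a.
Proof. by rewrite /cexp; simpc; rewrite /= ?oppr0 ?mul0r expR0 !mul1r. Qed.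

(** With all [r j] equal to [y], the diagonal matrix is a multiple of the identity, and the
    characteristic function of the corner becomes that of its trace. *)
Lemma corner_trace_charfun (mu : probability (borel (H_oo R)) R) (f : R -> R[i])
    N (y : R) : has_charfun mu f ->
  \int[mu]_X cos (y * corner_trace N X) = complex.Re (f y ^+ N) /\
  \int[mu]_X sin (y * corner_trace N X) = complex.Im (f y ^+ N).
Proof.
move=> /(_ N (fun=> y)); rewrite /cintegral prodr_const card_ord; case: (f y ^+ N) => a b [<- <-].
have E X : cexp ('i%C * \tr (diag_mx (\row_(j < N) y%:C) *m corner N X)) =
    cos (y * corner_trace N X) +i* sin (y * corner_trace N X).
  have -> : \row_(j < N) y%:C = const_mx y%:C by apply/rowP => j; rewrite !mxE.
  by rewrite diag_const_mx mul_scalar_mx mxtraceZ corner_traceE -rmorphM cexp_i.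
split; apply: eq_Rintegral => X _; apply/esym.
  exact: (congr1 (@complex.Re R) (E X)).
exact: (congr1 (@complex.Im R) (E X)).
Qed.

(** Both integrals are compared with an integral over the real line against [law], the law of the
    trace. The maps to the line, [coord_sum] and [corner_trace], are sums of continuous functions,
    hence measurable. *)
Lemma corner_eigenvalues_charfun (mu : probability (borel (H_oo R)) R) N
    (nu : probability (borel (Weyl R N)) R) (f : R -> R[i]) (y : R) :
  has_charfun mu f ->
  (forall A, measurable A -> nu A = mu (@corner_eigenvalues R N @^-1` A)) ->
  \int[nu]_x cos (y * coord_sum x) = complex.Re (f y ^+ N) /\
  \int[nu]_x sin (y * coord_sum x) = complex.Im (f y ^+ N).
Proof.
move=> /(@corner_trace_charfun _ _ N y)[<- <-] nuE.
have mS := @measurable_coord_sum R N.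
pose law : probability R R := distribution nu (mfun_Sub (mem_set mS)).
have lawE (U : set R) : measurable U -> law U = mu (@corner_trace R N @^-1` U).
  move=> mU; change (law U) with (nu (@coord_sum R N @^-1` U)); rewrite nuE; last first.
    by rewrite -[_ @^-1` _]setTI; exact: (mS measurableT).
  congr (mu _); apply/seteqP; split => X /=; rewrite coord_sum_corner_eigenvalues//.
have my : measurable_fun setT (fun x : R => y * x) by exact: mulrl_measurable.
have tr (g : R -> R) : bounded_mfun (fun x : R => g x) ->
    \int[nu]_x g (coord_sum x) = \int[mu]_X g (corner_trace N X).
  move=> bg; rewrite -(Rintegral_law (nu := law) mS)//.
  by rewrite -(Rintegral_law (nu := law) (@measurable_corner_trace R N)).
by split; [apply: (tr (fun x => cos (y * x)))|apply: (tr (fun x => sin (y * x)))];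
  [exact: bounded_mfun_cos|exact: bounded_mfun_sin].
Qed.

End corner_charfun.

(** * Intertwining *)

Section intertwining.
Variable R : realType.
Local Open Scope complex_scope.

(** The real part of the [N]-th power of the quotient of F_w'(y) by e^(- t y^2 / 2) F_w(y). *)
Definition gap_charfun (t : R) (w w' : Omega R) N (y : R) : R :=
  expR (- (N%:R * lnA_gap t w w' y)) * cos (N%:R * argB_gap w w' y).

Lemma F_omegaX (w : Omega R) (y : R) N : F_omega w y ^+ N =
  expR (- (N%:R * lnA w y)) * cos (N%:R * argB w y) +i*
  (expR (- (N%:R * lnA w y)) * sin (N%:R * argB w y)).
Proof.
rewrite F_omegaE cexpX -cexpE; congr cexp.
elim: N => [|N IH]; first by rewrite mulr0n !mul0r oppr0.
rewrite mulrS IH; apply/eqP; rewrite eq_complex /=; apply/andP.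
by split; apply/eqP; rewrite -natr1; ring.
Qed.

(** For fixed [w] the expression is linear in the real and imaginary parts of [F_omega w' y ^+ N],
    so measurability and the mean in [w'] are inherited from these. *)
Lemma gap_charfunE t (w w' : Omega R) N y : gap_charfun t w w' N y =
  expR (N%:R * (lnA w y + t * y ^+ 2 / 2)) * cos (N%:R * argB w y) *
    complex.Re (F_omega w' y ^+ N) +
  expR (N%:R * (lnA w y + t * y ^+ 2 / 2)) * sin (N%:R * argB w y) *
    complex.Im (F_omega w' y ^+ N).
Proof.
rewrite F_omegaX /= /gap_charfun /argB_gap.
rewrite (mulrBr N%:R (argB _ _)) cosB.
have -> : - (N%:R * lnA_gap t w w' y) =
    N%:R * (lnA w y + t * y ^+ 2 / 2) + - (N%:R * lnA w' y).
  by rewrite /lnA_gap; ring.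
rewrite expRD; move: (expR _) (expR _) (cos _) (cos _) (sin _) (sin _) => *.
ring.
Qed.

Section with_kernels.
Variables (N : nat) (P : R -> R.-pker (borel (Weyl R N)) ~> (borel (Weyl R N)))
  (L : R.-pker (borel (Omega R)) ~> (borel (Weyl R N)))
  (Q : R.-pker (borel (Omega R)) ~> (borel (Omega R))) (t : R) (w : Omega R).
Hypotheses (hP : is_DBM_semigroup P) (t0 : 0 < t).
Hypothesis L_charfun : forall w' y,
  \int[kernel_prob L w']_x cos (y * coord_sum x) = complex.Re (F_omega w' y ^+ N) /\
  \int[kernel_prob L w']_x sin (y * coord_sum x) = complex.Im (F_omega w' y ^+ N).
Hypothesis inter : forall U, measurable U ->
  (\int[Q w]_w' L w' U = \int[L w]_x P t x U)%E.

Let bounded_trig (y : R) :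
  bounded_mfun (fun x : borel (Weyl R N) => cos (y * coord_sum x)) /\
  bounded_mfun (fun x : borel (Weyl R N) => sin (y * coord_sum x)).
Proof.
have m : measurable_fun setT (fun x : borel (Weyl R N) => y * coord_sum x).
  by apply: measurable_funM => //; exact: measurable_coord_sum.
by split; [exact: (bounded_mfun_cos m)|exact: (bounded_mfun_sin m)].
Qed.

Let mL (U : set (borel (Weyl R N))) : measurable U ->
  measurable_fun [set: borel (Omega R)] (fun x => kernel_prob L x U : \bar R).
Proof. by move=> mU; exact: (measurable_kernel L U mU). Qed.

(** Measurability and boundedness in [w'] come from writing the function as the integral of a
    bounded function against the kernel [L]. *)
Lemma bounded_F_omegaX (y : R) :
  bounded_mfun (fun w' : borel (Omega R) => complex.Re (F_omega w' y ^+ N)) /\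
  bounded_mfun (fun w' : borel (Omega R) => complex.Im (F_omega w' y ^+ N)).
Proof.
have [bc bs] := bounded_trig y; split.
  have -> : (fun w' : borel (Omega R) => complex.Re (F_omega w' y ^+ N)) =
    (fun w' => \int[kernel_prob L w']_x cos (y * coord_sum x)).
    by apply/funext => w'; case: (L_charfun w' y).
  exact: measurable_Rintegral_kernel.
have -> : (fun w' : borel (Omega R) => complex.Im (F_omega w' y ^+ N)) =
  (fun w' => \int[kernel_prob L w']_x sin (y * coord_sum x)).
  by apply/funext => w'; case: (L_charfun w' y).
exact: measurable_Rintegral_kernel.
Qed.

(** The intertwining relation is tested on the cosine and sine of the trace: the kernel from [Omega]
    produces the power of [F_omega], and the Dyson step multiplies it by the Gaussian factor. *)
Lemma F_omegaX_transition (y : R) :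
  \int[kernel_prob Q w]_w' complex.Re (F_omega w' y ^+ N) =
    expR (- (t * y ^+ 2 / 2)) ^+ N * complex.Re (F_omega w y ^+ N) /\
  \int[kernel_prob Q w]_w' complex.Im (F_omega w' y ^+ N) =
    expR (- (t * y ^+ 2 / 2)) ^+ N * complex.Im (F_omega w y ^+ N).
Proof.
have [bc bs] := bounded_trig y.
split.
- transitivity (\int[kernel_prob Q w]_w' \int[kernel_prob L w']_x cos (y * coord_sum x)).
    by apply: eq_Rintegral => w' _; case: (L_charfun w' y).
  rewrite (eq_mixture_Rintegral (mu2 := kernel_prob L w) (k2 := P t))//.
  have [<- _] := L_charfun w y; rewrite -bounded_RintegralZl//.
  by apply: eq_Rintegral => x _; case: (dyson_trace_charfun y x hP t0).
- transitivity (\int[kernel_prob Q w]_w' \int[kernel_prob L w']_x sin (y * coord_sum x)).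
    by apply: eq_Rintegral => w' _; case: (L_charfun w' y).
  rewrite (eq_mixture_Rintegral (mu2 := kernel_prob L w) (k2 := P t))//.
  have [_ <-] := L_charfun w y; rewrite -bounded_RintegralZl//.
  by apply: eq_Rintegral => x _; case: (dyson_trace_charfun y x hP t0).
Qed.

Lemma bounded_gap_charfun (y : R) :
  bounded_mfun (fun w' : borel (Omega R) => gap_charfun t w w' N y).
Proof.
have [bR bI] := bounded_F_omegaX y.
have -> := funext (fun w' => gap_charfunE t w w' N y).
by apply: bounded_mfunD; apply: bounded_mfunM => //; exact: bounded_mfun_cst.
Qed.

(** After [F_omegaX_transition] the exponential factors cancel and cos^2 + sin^2 = 1 remains. *)
Lemma Rintegral_gap_charfun (y : R) :
  \int[kernel_prob Q w]_w' gap_charfun t w w' N y = 1.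
Proof.
have [bR bI] := bounded_F_omegaX y.
under eq_Rintegral do rewrite gap_charfunE.
rewrite bounded_RintegralD ?bounded_RintegralZl//; last 2 first.
- by apply: bounded_mfunM => //; exact: bounded_mfun_cst.
- by apply: bounded_mfunM => //; exact: bounded_mfun_cst.
have [-> ->] := F_omegaX_transition y; rewrite F_omegaX /=.
rewrite -expRM_natl mulrDr expRD !mulrN !expRN.
have e1 := expR_gt0 (N%:R * lnA w y); have e2 := expR_gt0 (N%:R * (t * y ^+ 2 / 2)).
have := cos2Dsin2 (N%:R * argB w y).
move: (expR _) (expR _) (cos _) (sin _) e1 e2 => a b c s a0 b0 <-.
field; by rewrite !gt_eqF.
Qed.

End with_kernels.
End intertwining.

(** * Measurability of the cumulants on [Omega] *)

Section coordinates.
Variable R : realType.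

Let continuous_val : continuous (\val : Omega R ->
  ({ptws nat -> R} * {ptws nat -> R} * R * R)%type).
Proof. exact: initial_continuous. Qed.

Lemma continuous_delta : continuous (@delta R).
Proof. move=> w; exact: (cvg_comp _ _ (@continuous_val w) cvg_snd). Qed.

Lemma continuous_gamma1 : continuous (@gamma1 R).
Proof.
by move=> w; exact: (cvg_comp _ _ (cvg_comp _ _ (@continuous_val w) cvg_fst) cvg_snd).
Qed.

Lemma continuous_alphap k : continuous (fun w : Omega R => alphap w k).
Proof.
move=> w; have c : (fun w : Omega R => (alphap w : {ptws nat -> R})) x @[x --> w] -->
    (alphap w : {ptws nat -> R}).
  apply: (cvg_comp _ _ (cvg_comp _ _ (cvg_comp _ _ (@continuous_val w) cvg_fst) cvg_fst)).
  exact: cvg_fst.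
exact: (cvg_comp _ _ c (@proj_continuous nat (fun=> R) k (alphap w))).
Qed.

Lemma continuous_alpham k : continuous (fun w : Omega R => alpham w k).
Proof.
move=> w; have c : (fun w : Omega R => (alpham w : {ptws nat -> R})) x @[x --> w] -->
    (alpham w : {ptws nat -> R}).
  apply: (cvg_comp _ _ (cvg_comp _ _ (cvg_comp _ _ (@continuous_val w) cvg_fst) cvg_fst)).
  exact: cvg_snd.
exact: (cvg_comp _ _ c (@proj_continuous nat (fun=> R) k (alpham w))).
Qed.

Let measurable_coordinates k :
  [/\ measurable_fun [set: borel (Omega R)] (@delta R : borel (Omega R) -> R),
   measurable_fun [set: borel (Omega R)] (@gamma1 R : borel (Omega R) -> R),
   measurable_fun [set: borel (Omega R)] ((fun w => alphap w k) : borel (Omega R) -> R) &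
   measurable_fun [set: borel (Omega R)] ((fun w => alpham w k) : borel (Omega R) -> R)].
Proof.
split; apply: (@continuous_borel_measurable R (Omega R)).
- exact: continuous_delta.
- exact: continuous_gamma1.
- exact: continuous_alphap.
- exact: continuous_alpham.
Qed.

Lemma measurable_cum n :
  measurable_fun [set: borel (Omega R)] ((fun w => cum w n) : borel (Omega R) -> R).
Proof.
have [md mg _ _] := measurable_coordinates 0.
case: n => [|[|[|n]]]; [exact: measurable_cst|exact: mg|exact: md|].
rewrite /= /asum; apply: measurable_funD.
- apply: (@measurable_fun_cvg _ _ _ setT
    (fun m (w : borel (Omega R)) => series (fun k => alphap w k ^+ n.+3) m)).
    move=> m; apply: measurable_sum => k.
    by apply: measurable_funX; case: (measurable_coordinates k).
  move=> w _; exact: (is_cvg_ssum (sqsummable_alphap w) (@pow_dom _ w n.+1)).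
- apply: (@measurable_fun_cvg _ _ _ setT
    (fun m (w : borel (Omega R)) => series (fun k => (- alpham w k) ^+ n.+3) m)).
    move=> m; apply: measurable_sum => k.
    apply: measurable_funX; apply: measurable_funN.
    by case: (measurable_coordinates k).
  move=> w _; exact: (is_cvg_ssum (sqsummable_alphaNm w) (@pow_dom _ w n.+1)).
Qed.

Lemma measurable_cum_gap t w n :
  measurable_fun [set: borel (Omega R)] ((fun w' => cum_gap t w w' n) : borel (Omega R) -> R).
Proof. by apply: measurable_funB; [exact: measurable_cum|exact: measurable_cst]. Qed.

End coordinates.

(** * Almost sure convergence and vanishing *)

Section almost_everywhere.
Context d (T : measurableType d) (R : realType) (P : probability T R).

(** Integrability of the limit is part of the conclusion, because [gap_limit] is controlled only
    almost everywhere and not at every point. *)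
Lemma bounded_convergence_ae (f : nat -> T -> R) (g : T -> R) (M : R) :
  (forall k, measurable_fun setT (f k)) -> measurable_fun setT g ->
  {ae P, forall x, f ^~ x @ \oo --> g x} ->
  {ae P, forall x, forall k, `|f k x| <= M} ->
  P.-integrable setT (EFin \o g) /\
  \int[P]_x f k x @[k --> \oo] --> \int[P]_x g x.
Proof.
move=> mf mg fg fM.
have [] := @dominated_convergence _ _ _ P setT measurableT
  (fun k => EFin \o f k) (EFin \o g) (cst M%:E).
- by move=> k; exact/measurable_EFinP.
- exact/measurable_EFinP.
- by apply: filterS fg => x + _ => fx; apply: cvg_EFin => //; exact: nearW.
- exact: (bounded_mfun_integrable P (@bounded_mfun_cst _ T R M)).
- by apply: filterS fM => x fx k _; rewrite /= lee_fin.
move=> ig _ c; split => //.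
apply: fine_cvg; rewrite /Rintegral fineK//; exact: integrable_fin_num.
Qed.

Lemma ae_eq0_Rintegral (f : T -> R) : P.-integrable setT (EFin \o f) ->
  (forall x, 0 <= f x) -> \int[P]_x f x = 0 -> {ae P, forall x, f x = 0}.
Proof.
move=> intf f0 If; have mf := measurable_int _ intf.
have : (\int[P]_x `|(EFin \o f) x| = 0)%E.
  have -> : (\int[P]_x `|(EFin \o f) x| = \int[P]_x (f x)%:E)%E.
    by apply: eq_integral => x _; rewrite gee0_abs//= lee_fin.
  by rewrite -[LHS]fineK ?integrable_fin_num// -[fine _]/(\int[P]_x f x) If.
move=> /(ae_eq_integral_abs P measurableT mf); apply: filterS => x /(_ I)[].
by [].
Qed.

End almost_everywhere.

(** * Vanishing of the cumulant differences *)

Section leading_terms.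
Variable R : realType.
Implicit Types (w : Omega R).

Definition zero_gaps t w w' n :=
  forall j, (0 < j < n)%N -> cum_gap t w w' j = 0.

(** These are the two parts of i^n / n, in the convention of [lnA] and [argB]: i^n / n = - [leadA] +
    i [leadB]. *)
Definition leadA n : R := if odd n then 0 else (-1) ^+ n./2.-1 / n%:R.
Definition leadB n : R := if odd n then (-1) ^+ n./2 / n%:R else 0.

Lemma ler_exp_small (y a K : R) m n : 0 <= y <= 1 -> a <= K -> 0 <= K -> (n <= m)%N ->
  a * y ^+ m <= K * y ^+ n.
Proof.
move=> /andP[y0 y1] aK K0 nm; apply: (@le_trans _ _ (K * y ^+ m)).
  by rewrite ler_wpM2r// exprn_ge0.
by rewrite ler_wpM2l// ler_wiXn2l.
Qed.

(** Only the part whose parity matches [n] has a term of order [n]; the first surviving term of the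
    other part has order [n.+1] and is absorbed in [K]. Here [K] may depend on [w'], since it serves
    pointwise convergence only. *)
Lemma gap_lead t w w' n : (0 < n)%N -> zero_gaps t w w' n ->
  exists K, forall y, 0 <= y <= 1 ->
    `|lnA_gap t w w' y - leadA n * cum_gap t w w' n * y ^+ n| <= K * y ^+ n.+1 /\
    `|argB_gap w w' y - leadB n * cum_gap t w w' n * y ^+ n| <= K * y ^+ n.+1.
Proof.
move=> n0 Y0; have [nodd|neven] := boolP (odd n).
- have nE : n = n./2.*2.+1 by rewrite -[LHS]odd_double_half nodd.
  move: n./2 nE => q nE; subst n.
  have YA j : (j < q)%N -> cum_gap t w w' j.+1.*2 = 0.
    by move=> jq; apply: Y0; rewrite double_gt0 /= ltnS leq_double.
  have YB j : (j < q)%N -> cum_gap t w w' j.*2.+1 = 0.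
    by move=> jq; apply: Y0; rewrite /= ltnS ltn_double.
  (* The coefficient of order [n.+1] in [lnA_gap], which goes into the error. *)
  pose c := (-1) ^+ q / q.+1.*2%:R * cum_gap t w w' q.+1.*2.
  exists (`|c| + rem_cst w w' q.*2.+3 + rem_cst w w' q.+1.*2) => y y01.
  have [y0 y1] := andP y01.
  have c0 := normr_ge0 c; have r1 := rem_cst_ge0 w w' q.*2.+3.
  have r2 := rem_cst_ge0 w w' q.+1.*2.
  have hA := lnA_gap_lead y YA; have hB := argB_gap_lead y YB.
  rewrite /leadA /leadB nodd /= uphalf_double -/c (ger0_norm y0) in hA hB *; split.
  + rewrite !mul0r subr0 -(subrK (c * y ^+ q.+1.*2) (lnA_gap _ _ _ _)).
    apply: le_trans (ler_normD _ _) _.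
    apply: (@le_trans _ _ (rem_cst w w' q.*2.+3 * y ^+ q.+1.*2 + `|c| * y ^+ q.+1.*2)).
      apply: lerD; first by apply: le_trans hA _; apply: ler_exp_small => //; lia.
      by rewrite normrM (ger0_norm (exprn_ge0 _ y0)).
    rewrite -mulrDl doubleS ler_wpM2r ?exprn_ge0//; lra.
  + apply: le_trans hB _; apply: ler_exp_small; rewrite ?doubleS//; lra.
- have nE : n = n./2.*2 by rewrite -[LHS]odd_double_half (negbTE neven).
  have : (0 < n./2)%N by rewrite -double_gt0 -nE.
  move: n./2 nE => -[//|q] nE _; subst n.
  have YA j : (j < q)%N -> cum_gap t w w' j.+1.*2 = 0.
    by move=> jq; apply: Y0; rewrite double_gt0 /= ltn_double.
  have YB j : (j < q.+1)%N -> cum_gap t w w' j.*2.+1 = 0.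
    by move=> jq; apply: Y0; rewrite -[(j.*2.+1 < _)%N]/(j.+1.*2 <= q.+1.*2)%N leq_double.
  pose c := (-1) ^+ q.+1 / q.+1.*2.+1%:R * cum_gap t w w' q.+1.*2.+1.
  exists (`|c| + rem_cst w w' q.*2.+3 + rem_cst w w' q.+2.*2) => y y01.
  have [y0 y1] := andP y01.
  have c0 := normr_ge0 c; have r1 := rem_cst_ge0 w w' q.*2.+3.
  have r2 := rem_cst_ge0 w w' q.+2.*2.
  have hA := lnA_gap_lead y YA; have hB := argB_gap_lead y YB.
  rewrite /leadA /leadB (negbTE neven) doubleK -/c (ger0_norm y0) in hA hB *; split.
  + apply: le_trans hA _; apply: ler_exp_small; rewrite ?doubleS//; lra.
  + rewrite !mul0r subr0 -(subrK (c * y ^+ q.+1.*2.+1) (argB_gap _ _ _)).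
    apply: le_trans (ler_normD _ _) _.
    apply: (@le_trans _ _ (rem_cst w w' q.+2.*2 * y ^+ q.+1.*2.+1 + `|c| * y ^+ q.+1.*2.+1)).
      apply: lerD; first by apply: le_trans hB _; apply: ler_exp_small => //; lia.
      by rewrite normrM (ger0_norm (exprn_ge0 _ y0)).
    rewrite -mulrDl ler_wpM2r ?exprn_ge0//; lra.
Qed.

(** The constant is uniform in [w'], and the bound is one-sided because only exp (- N [lnA_gap]) has
    to be dominated. For [n <= 2] the term [lnA w' y] is discarded by positivity; for [n >= 3] the
    second gap gives [delta w' = delta w + t], which fixes [rem_cst]. *)
Lemma lnA_gap_ge t w n : 0 <= t -> exists2 C, 0 <= C &
  forall w', zero_gaps t w w' n ->
  forall y, 0 <= y <= 1 -> - lnA_gap t w w' y <= C * y ^+ n.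
Proof.
move=> t0; have d0 := delta_ge0 w; have [n2|n3] := leqP n 2.
  exists (delta w + t); first by rewrite addr_ge0.
  move=> w' _ y y01; apply: (@le_trans _ _ ((delta w + t) * y ^+ 2)); last first.
    by apply: ler_exp_small; rewrite ?addr_ge0.
  have := lnA_ge0 w' y; have := lnA_le w y; have := sqr_ge0 y; rewrite /lnA_gap; nra.
pose b := (1 + delta w) ^+ n + (1 + (delta w + t)) ^+ n.
have b0 : 0 <= b by rewrite addr_ge0// exprn_ge0; lra.
exists b => // w' Y0 y y01; have [y0 _] := andP y01.
have Y2 : delta w' = delta w + t.
  by have := Y0 2; rewrite n3 /cum_gap /= mul1r => /(_ isT); lra.
(* The choice gives 2q + 3 <= n <= 2q + 4: the even gaps up to 2q + 2 vanish, the error has order at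
   least [n], and the exponent in [rem_cst] is at most [n]. *)
pose q := (n - 3)./2.
have nq : (q.*2.+3 <= n <= q.+2.*2)%N.
  by rewrite !doubleS /q; have := odd_double_half (n - 3); case: odd => /=; lia.
have [q3 q4] := andP nq.
have : `|lnA_gap t w w' y| <= rem_cst w w' q.*2.+3 * `|y| ^+ q.+2.*2.
  apply: lnA_gap_small => j jq; apply: Y0; rewrite double_gt0 /=.
  by apply: leq_trans q3; rewrite doubleS !ltnS leq_double.
rewrite -normrN => /(le_trans (ler_norm _)) /le_trans; apply.
rewrite ger0_norm//; apply: ler_exp_small => //.
by rewrite /rem_cst Y2 lerD// ler_weXn2l//; lra.
Qed.

End leading_terms.

Section limits.
Variable R : realType.

(** The real part of exp (r i^n Y_n / (n (p+1)^n)), with Y_n the [n]-th gap. *)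
Definition gap_limit t (w w' : Omega R) n r p : R :=
  expR (- (r%:R * (leadA R n * cum_gap t w w' n) * p.+1%:R^-1 ^+ n)) *
  cos (r%:R * (leadB R n * cum_gap t w w' n) * p.+1%:R^-1 ^+ n).

Lemma cvg_gap_charfun t (w w' : Omega R) n r p : (0 < n)%N -> zero_gaps t w w' n ->
  gap_charfun t w w' (r * k.+1 ^ n) (p.+1 * k.+1)%:R^-1 @[k --> \oo] -->
  gap_limit t w w' n r p.
Proof.
move=> n0 Y0; have [K hK] := gap_lead n0 Y0.
have hA := @cvg_scaled_lead _ _ _ _ _ r p (fun y y01 => (hK y y01).1).
have hB := @cvg_scaled_lead _ _ _ _ _ r p (fun y y01 => (hK y y01).2).
apply: cvgM; last first.
  exact: (cvg_comp _ _ hB (@continuous_cos R _)).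
exact: (cvg_comp _ _ (cvgN hA) (@continuous_expR R _)).
Qed.

Lemma gap_charfun_bound t (w : Omega R) n r : 0 <= t -> (0 < n)%N -> exists M,
  forall w', zero_gaps t w w' n -> forall p k,
  `|gap_charfun t w w' (r * k.+1 ^ n) (p.+1 * k.+1)%:R^-1| <= M.
Proof.
move=> t0 n0; have [C C0 hC] := lnA_gap_ge w n t0.
exists (expR (r%:R * C)) => w' Y0 p k.
rewrite normrM (ger0_norm (expR_ge0 _)) -[leRHS]mulr1.
apply: ler_pM; rewrite ?expR_ge0 ?cos_max// ler_expR -mulrN.
set y : R := _^-1.
have y01 : 0 <= y <= 1.
  by rewrite invr_ge0 ler0n /= natV_le1// muln_gt0.
have [y0 y1] := andP y01.
(* With N = r (k+1)^n and y = 1 / ((p+1) (k+1)) this gives N y^n <= r, hence the exponent [r * C] of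
   the bound. *)
have ky : k.+1%:R ^+ n * y ^+ n <= 1.
  rewrite -exprMn exprn_ile1 ?mulr_ge0// /y natrM invfM mulrCA mulfV ?pnatr_eq0// mulr1.
  exact: natV_le1.
rewrite natrM natrX -mulrA ler_wpM2l//.
apply: (@le_trans _ _ (k.+1%:R ^+ n * (C * y ^+ n))).
  by rewrite ler_wpM2l ?exprn_ge0//; exact: hC.
by rewrite mulrCA -[leRHS]mulr1 ler_wpM2l.
Qed.

Lemma measurable_gap_limit t w n r p :
  measurable_fun [set: borel (Omega R)] ((fun w' => gap_limit t w w' n r p) : borel (Omega R) -> R).
Proof.
have mY := measurable_cum_gap t w n.
have mlin c e : measurable_fun [set: borel (Omega R)]
    ((fun w' => r%:R * (c * cum_gap t w w' n) * e) : borel (Omega R) -> R).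
  apply: measurable_funM => //; apply: measurable_funM => //.
  by apply: measurable_funM.
apply: measurable_funM.
  apply: measurableT_comp; first exact: measurable_expR.
  exact: measurable_funN.
apply: measurableT_comp => //; apply: continuous_measurable_fun; exact: continuous_cos.
Qed.

Section induction.
Variables (nu : probability (borel (Omega R)) R) (t : R) (w : Omega R).
Hypothesis t0 : 0 <= t.
Hypothesis bounded_charfun : forall N y, (0 < N)%N ->
  bounded_mfun (fun w' : borel (Omega R) => gap_charfun t w w' N y).
Hypothesis Rintegral_charfun : forall N y, (0 < N)%N ->
  \int[nu]_w' gap_charfun t w w' N y = 1.

Lemma Rintegral_gap_limit n r p : (0 < n)%N -> (0 < r)%N ->
  {ae nu, forall w' : borel (Omega R), zero_gaps t w w' n} ->
  nu.-integrable setT (EFin \o (fun w' => gap_limit t w w' n r p)) /\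
  \int[nu]_w' gap_limit t w w' n r p = 1.
Proof.
move=> n0 r0 Y0; have [M hM] := gap_charfun_bound w r t0 n0.
have N0 k : (0 < r * k.+1 ^ n)%N by rewrite muln_gt0 r0 expn_gt0.
have [|||| ig c] := @bounded_convergence_ae _ _ R nu
  (fun k w' => gap_charfun t w w' (r * k.+1 ^ n) (p.+1 * k.+1)%:R^-1)
  (fun w' => gap_limit t w w' n r p) M.
- by move=> k; case: (bounded_charfun (p.+1 * k.+1)%:R^-1 (N0 k)).
- exact: measurable_gap_limit.
- by apply: filterS Y0 => w' Y0; exact: cvg_gap_charfun.
- by apply: filterS Y0 => w' Y0 k; exact: hM.
split => //; move: c.
have -> : (fun k => \int[nu]_w' gap_charfun t w w' (r * k.+1 ^ n) (p.+1 * k.+1)%:R^-1) =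
    cst 1.
  by apply/funext => k; exact: Rintegral_charfun.
by move=> /cvg_lim <-//; apply: cvg_lim => //; exact: cvg_cst.
Qed.

Lemma ae_even_gap n : ~~ odd n -> (0 < n)%N ->
  {ae nu, forall w' : borel (Omega R), zero_gaps t w w' n} ->
  {ae nu, forall w' : borel (Omega R), cum_gap t w w' n = 0}.
Proof.
move=> neven n0 Y0.
pose Z w' := expR (- (leadA R n * cum_gap t w w' n)).
have E w' r : gap_limit t w w' n r 0 = Z w' ^+ r.
  rewrite /gap_limit /leadB (negbTE neven) mul0r mulr0 mul0r cos0 invr1 expr1n !mulr1.
  by rewrite -mulrN expRM_natl.
have [i1 I1] := Rintegral_gap_limit 0 n0 (ltn0Sn 0) Y0.
have [i2 I2] := Rintegral_gap_limit 0 n0 (ltn0Sn 1) Y0.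
(* At [p = 0] the limits for [r = 1] and [r = 2] are Z and Z^2, both of mean 1, so that (Z - 1)^2
   has mean 1 - 2 + 1 = 0. *)
have Zeq : (fun w' : borel (Omega R) => (Z w' - 1) ^+ 2) =
   (fun w' => (gap_limit t w w' n 2 0 - 2 * gap_limit t w w' n 1 0) + 1).
  by apply/funext => w'; rewrite !E; ring.
have i1' := integrableZl measurableT 2 i1.
have i3 := integrableB measurableT i2 i1'.
have i0 := bounded_mfun_integrable nu (@bounded_mfun_cst _ (borel (Omega R)) R 1).
have : {ae nu, forall w' : borel (Omega R), (Z w' - 1) ^+ 2 = 0}.
  apply: ae_eq0_Rintegral.
  - by rewrite Zeq; exact: (integrableD measurableT i3 i0).
  - by move=> w'; exact: sqr_ge0.
  - rewrite Zeq RintegralD// RintegralB// RintegralZl// I1 I2 probability_Rintegral_cst.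
    ring.
apply: filterS => w' /eqP; rewrite sqrf_eq0 subr_eq0 => /eqP.
rewrite -expR0 => /expR_inj/eqP; rewrite oppr_eq0 mulf_eq0 => /orP[|/eqP//].
rewrite /leadA (negbTE neven) mulf_eq0 signr_eq0 invr_eq0 pnatr_eq0 /=.
by move=> /eqP nE; rewrite nE in n0.
Qed.

Lemma ae_odd_gap n : odd n -> {ae nu, forall w' : borel (Omega R), zero_gaps t w w' n} ->
  {ae nu, forall w' : borel (Omega R), cum_gap t w w' n = 0}.
Proof.
move=> nodd Y0; have n0 : (0 < n)%N by case: n nodd {Y0}.
pose s p w' := leadB R n * cum_gap t w w' n * p.+1%:R^-1 ^+ n.
have E w' p : gap_limit t w w' n 1 p = cos (s p w').
  by rewrite /gap_limit /leadA nodd mul0r mulr0 mul0r oppr0 expR0 !mul1r.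
have ac p : {ae nu, forall w' : borel (Omega R), 1 - cos (s p w') = 0}.
  have [i1 I1] := Rintegral_gap_limit p n0 (ltn0Sn 0) Y0.
  have Eq : (fun w' : borel (Omega R) => 1 - cos (s p w')) =
      (fun w' => 1 - gap_limit t w w' n 1 p).
    by apply/funext => w'; rewrite E.
  have i0 := bounded_mfun_integrable nu (@bounded_mfun_cst _ (borel (Omega R)) R 1).
  apply: ae_eq0_Rintegral.
  - by rewrite Eq; exact: (integrableB measurableT i0 i1).
  - by move=> w'; rewrite subr_ge0 cos_le1.
  - by rewrite Eq RintegralB// I1 probability_Rintegral_cst subrr.
have := ae_foralln ac; apply: filterS => w' cw.
have : leadB R n * cum_gap t w w' n = 0.
  (* The scale depends on the point [w'], which is why all [p] were treated on one set of full
     measure. As |x| <= p + 1, the angle is at most 1 <= pi in absolute value, and cosine is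
     injective on [0, pi]. *)
  set x := _ * _; pose p := Num.trunc `|x|.
  have xp : `|x * p.+1%:R^-1 ^+ n| <= 1.
    rewrite normrM [X in _ * X]ger0_norm ?exprn_ge0// exprVn ler_pdivrMr ?exprn_gt0// mul1r.
    apply: (@le_trans _ _ p.+1%:R); last by rewrite ler_eXnr ?ler1n.
    exact/ltW/truncnS_gt.
  have : cos `|x * p.+1%:R^-1 ^+ n| = cos 0.
    have /eqP := cw p; rewrite subr_eq0 cos0 eq_sym => /eqP.
    by case: ger0P; rewrite ?cosN.
  have pi1 : 1 <= pi :> R by apply: le_trans (pi_ge2 R); rewrite ler1n.
  move=> /cos_inj; rewrite !in_itv /= lexx normr_ge0 pi_ge0 (le_trans xp)//=.
  move=> /(_ isT isT)/normr0P; rewrite mulf_eq0 expf_eq0 invr_eq0 pnatr_eq0 andbF orbF.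
  by move=> /eqP.
move=> /eqP; rewrite mulf_eq0 => /orP[|/eqP//].
rewrite /leadB nodd mulf_eq0 signr_eq0 invr_eq0 pnatr_eq0 /=.
by move=> /eqP nE; rewrite nE in n0.
Qed.

Lemma ae_zero_gaps n : {ae nu, forall w' : borel (Omega R), zero_gaps t w w' n}.
Proof.
elim: n => [|n IH]; first by apply: aeW => w' j; rewrite ltn0 andbF.
have [->|n0] := posnP n.
  by apply: aeW => w' [|j].
have : {ae nu, forall w' : borel (Omega R), cum_gap t w w' n = 0}.
  by have [nodd|neven] := boolP (odd n); [exact: ae_odd_gap|exact: ae_even_gap].
move: IH; apply: filterS2 => w' Y0 Yn j /andP[j0]; rewrite ltnS leq_eqVlt.
by case/predU1P => [->//|jn]; apply: Y0; rewrite j0.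
Qed.

Lemma ae_cum_gap : {ae nu, forall w' : borel (Omega R), forall n, cum_gap t w w' n = 0}.
Proof.
have := ae_foralln ae_zero_gaps; apply: filterS => w' Y0 [|n].
  by rewrite /cum_gap /= mul0r addr0 subrr.
by apply: (Y0 n.+2); rewrite /= ltnS.
Qed.

End induction.
End limits.

(** * The Markov process *)

Section markov.
Context (R : realType) (T : ptopologicalType)
  (P : R -> R.-pker (borel T) ~> (borel T))
  d (S : measurableType d) (Pr : probability S R)
  (F : R -> set (set S)) (X : R -> S -> borel T).
Hypothesis hX : is_Markov_process P Pr F X.

(** The Markov property between times 0 and [t], on the event that [X 0] lies in [A0], expresses the
    probability as the integral of a vanishing function. *)
Lemma Markov_null t (A0 A : set (borel T)) : 0 <= t -> measurable A0 -> measurable A ->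
  (forall x, A0 x -> P t x A = 0%E) ->
  {ae Pr, forall s, ~ (A0 (X 0 s) /\ A (X t s))}.
Proof.
move=> t0 mA0 mA PA0; have [[hF _] ad mk] := hX.
have mXt (u : R) B : 0 <= u -> measurable B -> measurable (X u @^-1` B).
  by move=> u0 mB; apply: (hF u u0).2; exact: ad.
exists ((X 0 @^-1` A0) `&` (X t @^-1` A)); split.
- by apply: measurableI; exact: mXt.
- rewrite (mk 0 t) ?subr0//; last exact: ad.
  by apply: integral0_eq => s A0s; exact: PA0.
- by move=> s /= /contrapT.
Qed.

(** The Markov property controls only rectangles in (X_0, X_t). The event that f(X_t) differs from
    g(X_0) is covered by countably many of them, since a rational separates two distinct reals. *)
Lemma Markov_ae_eq t (f g : borel T -> R) : 0 <= t ->
  measurable_fun setT f -> measurable_fun setT g ->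
  (forall x, {ae kernel_prob (P t) x, forall y, f y = g x}) ->
  {ae Pr, forall s, f (X t s) = g (X 0 s)}.
Proof.
move=> t0 mf mg fg.
(* An enumeration of the rationals; the default value 0 only repeats one of them. *)
pose q n : R := if unpickle n is Some r then ratr (r : rat) else 0.
have mlt (h : borel T -> R) a : measurable_fun setT h -> measurable [set x | h x < a].
  move=> mh; rewrite -[X in measurable X]setTI.
  by have := mh measurableT _ (measurable_itv `]-oo, a[); rewrite set_itvE.
have mge (h : borel T -> R) a : measurable_fun setT h -> measurable [set x | a <= h x].
  move=> mh; rewrite -[X in measurable X]setTI.
  by have := mh measurableT _ (measurable_itv `[a, +oo[); rewrite set_itvE.
have null x (A : set (borel T)) : measurable A -> (forall y, A y -> f y <> g x) -> P t x A = 0%E.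
  move=> mA Afg; apply: (@measure_negligible _ _ _ (kernel_prob (P t) x) A mA).
  by apply: negligibleS (fg x) => y Ay /=; exact: Afg.
have h1 n : {ae Pr, forall s, ~ (q n <= g (X 0 s) /\ f (X t s) < q n)}.
  apply: (Markov_null t0 (mge _ _ mg) (mlt _ _ mf)) => x /= gx.
  by apply: null => [|y /= fy E]; [exact: mlt|move: fy; rewrite E ltNge gx].
have h2 n : {ae Pr, forall s, ~ (g (X 0 s) < q n /\ q n <= f (X t s))}.
  apply: (Markov_null t0 (mlt _ _ mg) (mge _ _ mf)) => x /= gx.
  by apply: null => [|y /= fy E]; [exact: mge|move: fy; rewrite E leNgt gx].
have := ae_foralln h1; have := ae_foralln h2; apply: filterS2 => s k2 k1.
apply/eqP; rewrite eq_le !leNgt; apply/andP; split; apply/negP => lt.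
- have [r] := rat_in_itvoo lt; rewrite in_itv /= => /andP[r1 r2].
  by apply: (k2 (pickle r)); rewrite /q pickleK; split => //; exact: ltW.
- have [r] := rat_in_itvoo lt; rewrite in_itv /= => /andP[r1 r2].
  by apply: (k1 (pickle r)); rewrite /q pickleK; split => //; exact: ltW.
Qed.

End markov.

Lemma rat_right_continuous_eq0 (R : realType) (g : R -> R) (t : R) :
  g s @[s --> t^'+] --> g t ->
  (forall r : rat, t < ratr r -> g (ratr r) = 0) -> g t = 0.
Proof.
move=> gt g0; apply/eqP; apply/negPn/negP => gt0.
have e0 : 0 < `|g t| by rewrite normr_gt0.
have [e /= e1 he] : \forall s \near t^'+, `|g t - g s| < `|g t|.
  by move/cvgrPdist_lt : gt; exact.
have [r] := @rat_in_itvoo R t (t + e) ltac:(by rewrite ltrDl).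
rewrite in_itv /= => /andP[r1 r2].
have := he (ratr r); rewrite /= ltr0_norm ?subr_lt0// opprB ltrBlDl => /(_ r2 r1).
by rewrite g0// subr0 ltxx.
Qed.

(** * From vanishing gaps to the evolution of the coordinates *)

Section evolution.
Variable R : realType.

Lemma cum_gap_eq0 t (w w' : Omega R) : (forall n, cum_gap t w w' n = 0) ->
  [/\ forall i, alphap w' i = alphap w i, forall i, alpham w' i = alpham w i,
      gamma1 w' = gamma1 w & delta w' = delta w + t].
Proof.
move=> Y0; have [ap am] : (forall i, alphap w' i = alphap w i) /\
    (forall i, alpham w' i = alpham w i).
  apply: cum_inj => n n3; have := Y0 n; rewrite /cum_gap (gtn_eqF (n3 : (2 < n)%N)).
  by rewrite mul0r addr0 => /subr0_eq.
split => //.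
- by have := Y0 1; rewrite /cum_gap /= mul0r addr0 => /subr0_eq.
- by have := Y0 2; rewrite /cum_gap /= mul1r => /subr0_eq.
Qed.

Lemma gamma2_evolves t (w w' : Omega R) :
  (forall i, alphap w' i = alphap w i) -> (forall i, alpham w' i = alpham w i) ->
  delta w' = delta w + t -> gamma2 w' = t + gamma2 w.
Proof.
by move=> ap am dw; rewrite /gamma2 dw (funext ap) (funext am) addrAC; ring.
Qed.

Lemma transition_ae
    (PDBM : forall N : nat, R -> R.-pker (borel (Weyl R N)) ~> (borel (Weyl R N)))
    (hDBM : forall N : nat, (1 <= N)%N -> is_DBM_semigroup (PDBM N))
    (M : Omega R -> probability (borel (H_oo R)) R)
    (hMchar : forall w : Omega R, has_charfun (M w) (F_omega w))
    (Lambda : forall N : nat, R.-pker (borel (Omega R)) ~> (borel (Weyl R N)))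
    (hLambda : forall (N : nat) (w : Omega R) (A : set (borel (Weyl R N))),
       (1 <= N)%N -> measurable A ->
       Lambda N w A = M w (@corner_eigenvalues R N @^-1` A))
    (Poo : R -> R.-pker (borel (Omega R)) ~> (borel (Omega R)))
    (hPoo : is_Feller_semigroup Poo)
    (hinter : forall (N : nat) (t : R) (w : Omega R) (A : set (borel (Weyl R N))),
       (1 <= N)%N -> 0 <= t -> measurable A ->
       (\int[Poo t w]_w' Lambda N w' A = \int[Lambda N w]_x PDBM N t x A)%E)
    (t : R) (w : borel (Omega R)) : 0 <= t ->
  {ae kernel_prob (Poo t) w, forall w' : borel (Omega R),
    forall n, cum_gap t w w' n = 0}.
Proof.
rewrite le_eqVlt => /predU1P[<-|t0].
  (* The trace computation requires positive time. At time 0 the transition is the Dirac mass at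
     [w], where the gap is zero; as this is known on measurable sets only, the exceptional set is
     first shown to be measurable. *)
  have [P0 _ _ _] := hPoo.
  have mgap n : measurable [set w' : borel (Omega R) | cum_gap 0 w w' n != 0].
    have m : measurable_fun setT
        ((fun w' => cum_gap 0 w w' n) : borel (Omega R) -> R) := measurable_cum_gap 0 w n.
    rewrite (_ : [set _ | _] = setT `&`
        (fun w' : borel (Omega R) => cum_gap 0 w w' n) @^-1` [set~ 0]).
      by apply: m => //; apply: measurableC; exact: measurable_set1.
    by rewrite setTI; apply/seteqP; split => w' /= /eqP.
  apply: ae_foralln => n; exists [set w' | cum_gap 0 w w' n != 0]; split => //.
  - transitivity (Poo 0 w [set w' | cum_gap 0 w w' n != 0]) => //.
    rewrite P0// diracE memNset//= /cum_gap mulr0 addr0 subrr eqxx; exact: negP.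
  - by move=> w' Yn; apply/eqP.
have L_charfun N w' y : (1 <= N)%N ->
    \int[kernel_prob (Lambda N) w']_x cos (y * coord_sum x) = complex.Re (F_omega w' y ^+ N) /\
    \int[kernel_prob (Lambda N) w']_x sin (y * coord_sum x) = complex.Im (F_omega w' y ^+ N).
  move=> N1; apply: corner_eigenvalues_charfun; first exact: hMchar.
  by move=> A; exact: hLambda.
apply: (ae_cum_gap (ltW t0)) => N y N1.
- exact: (bounded_gap_charfun _ _ (fun w' y => L_charfun N w' y N1)).
- apply: (Rintegral_gap_charfun (Q := Poo t) (w := w) (hDBM N N1) t0
    (fun w' y => L_charfun N w' y N1)).
  by move=> U mU; exact: hinter (ltW t0) mU.
Qed.

End evolution.

Theorem proposition5p5 (R : realType)
  (PDBM : forall N : nat, R -> R.-pker (borel (Weyl R N)) ~> (borel (Weyl R N)))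
  (hDBM : forall N : nat, (1 <= N)%N -> is_DBM_semigroup (PDBM N))
  (M : Omega R -> probability (borel (H_oo R)) R)
  (hMinv : forall w : Omega R, conj_invariant (M w))
  (hMchar : forall w : Omega R, has_charfun (M w) (F_omega w))
  (Lambda : forall N : nat, R.-pker (borel (Omega R)) ~> (borel (Weyl R N)))
  (hLambda : forall (N : nat) (w : Omega R) (A : set (borel (Weyl R N))),
     (1 <= N)%N -> measurable A ->
     Lambda N w A = M w (@corner_eigenvalues R N @^-1` A))
  (Poo : R -> R.-pker (borel (Omega R)) ~> (borel (Omega R)))
  (hPoo : is_Feller_semigroup Poo)
  (hinter : forall (N : nat) (t : R) (w : Omega R) (A : set (borel (Weyl R N))),
     (1 <= N)%N -> 0 <= t -> measurable A ->
     (\int[Poo t w]_w' Lambda N w' A = \int[Lambda N w]_x PDBM N t x A)%E)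
  (d : measure_display) (S : measurableType d) (Pr : probability S R)
  (F : R -> set (set S)) (X : R -> S -> borel (Omega R))
  (hX : is_Markov_process Poo Pr F X) :
  let evolves (t : R) (x0 xt : Omega R) : Prop :=
    [/\ forall i : nat, alphap xt i = alphap x0 i,
        forall i : nat, alpham xt i = alpham x0 i,
        gamma1 xt = gamma1 x0
      & gamma2 xt = t + gamma2 x0] in
  (forall t : R, 0 <= t -> {ae Pr, forall s, evolves t (X 0 s) (X t s)}) /\
  ((forall s, is_cadlag (fun t => X t s : Omega R)) ->
   {ae Pr, forall s, forall t : R, 0 <= t -> evolves t (X 0 s) (X t s)}).
Proof.
move=> evolves.
have trans t w := @transition_ae R PDBM hDBM M hMchar Lambda hLambda Poo hPoo hinter t w.
(* [delta] replaces [gamma2] because it is continuous on [Omega]. [gamma2] is not: many small alphas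
   can carry a fixed sum of squares while each tends to 0. *)
pose evolves' (t : R) (x0 xt : Omega R) :=
  [/\ forall i : nat, alphap xt i = alphap x0 i,
      forall i : nat, alpham xt i = alpham x0 i,
      gamma1 xt = gamma1 x0
    & delta xt = delta x0 + t].
have evolvesW t x0 xt : evolves' t x0 xt -> evolves t x0 xt.
  by case=> ap am g1 dx; split => //; exact: gamma2_evolves.
(* The slope [e] is 0 for the alphas and [gamma1], and 1 for [delta]. *)
have coord t (c : Omega R -> R) (e : R) : 0 <= t -> continuous c ->
    (forall w w', (forall n, cum_gap t w w' n = 0) -> c w' = c w + e * t) ->
    {ae Pr, forall s, c (X t s) = c (X 0 s) + e * t}.
  move=> t0 /continuous_borel_measurable mc h.
  apply: (Markov_ae_eq hX (f := c) (g := fun w => c w + e * t) t0 mc).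
    exact: measurable_funD.
  by move=> w; apply: filterS (trans t w t0) => w'; exact: h.
have fixed t : 0 <= t -> {ae Pr, forall s, evolves' t (X 0 s) (X t s)}.
  move=> t0.
  have ap : {ae Pr, forall s, forall i, alphap (X t s) i = alphap (X 0 s) i}.
    apply: ae_foralln => i.
    have : {ae Pr, forall s, alphap (X t s) i = alphap (X 0 s) i + 0 * t}.
      apply: (coord t (fun w => alphap w i) 0 t0); first exact: continuous_alphap.
      by move=> w w' /cum_gap_eq0[-> _ _ _]; rewrite mul0r addr0.
    by apply: filterS => s ->; rewrite mul0r addr0.
  have am : {ae Pr, forall s, forall i, alpham (X t s) i = alpham (X 0 s) i}.
    apply: ae_foralln => i.
    have : {ae Pr, forall s, alpham (X t s) i = alpham (X 0 s) i + 0 * t}.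
      apply: (coord t (fun w => alpham w i) 0 t0); first exact: continuous_alpham.
      by move=> w w' /cum_gap_eq0[_ -> _ _]; rewrite mul0r addr0.
    by apply: filterS => s ->; rewrite mul0r addr0.
  have g1 : {ae Pr, forall s, gamma1 (X t s) = gamma1 (X 0 s) + 0 * t}.
    apply: (coord t (@gamma1 R) 0 t0); first exact: continuous_gamma1.
    by move=> w w' /cum_gap_eq0[_ _ -> _]; rewrite mul0r addr0.
  have dt : {ae Pr, forall s, delta (X t s) = delta (X 0 s) + 1 * t}.
    apply: (coord t (@delta R) 1 t0); first exact: continuous_delta.
    by move=> w w' /cum_gap_eq0[_ _ _ ->]; rewrite mul1r.
  apply: filterS2 (filterI ap am) (filterI g1 dt) => s [aps ams] [g1s dts].
  by split => //; rewrite ?g1s ?dts ?mul0r ?addr0 ?mul1r.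
split=> [t t0|cad]; first by apply: filterS (fixed t t0) => s; exact: evolvesW.
(* The exceptional null set depends on the time; countably many rational times leave a single one,
   outside which right continuity reaches every time. *)
have rats : {ae Pr, forall s, forall n,
    if unpickle n is Some r then 0 <= ratr (r : rat) :> R ->
      evolves' (ratr r) (X 0 s) (X (ratr r) s) else True}.
  apply: ae_foralln => n; case: (unpickle n) => [r|]; last exact: aeW.
  have [r0|r0] := boolP (0 <= ratr r :> R).
    by apply: filterS (fixed _ r0).
  by apply: aeW => s /negP.
apply: filterS rats => s hs t t0; apply: evolvesW.
have hr (r : rat) : t < ratr r -> evolves' (ratr r) (X 0 s) (X (ratr r) s).
  by move=> tr; have := hs (pickle r); rewrite pickleK => /(_ (le_trans t0 (ltW tr))).
(* Both [c (X u s)] and the affine function of [u] are right continuous and agree at the rationals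
   beyond [t]. *)
have right (c : Omega R -> R) (e : R) : continuous c ->
    (forall r, t < ratr r -> c (X (ratr r) s) = c (X 0 s) + e * ratr r) ->
    c (X t s) = c (X 0 s) + e * t.
  move=> cc h; apply/eqP; rewrite -subr_eq0; apply/eqP.
  apply: (@rat_right_continuous_eq0 _ (fun u => c (X u s) - (c (X 0 s) + e * u))).
    apply: cvgB; first exact: (cvg_comp _ _ ((cad s).1 t t0) (cc _)).
    apply: cvgD; first exact: cvg_cst.
    apply: cvgM; first exact: cvg_cst.
    exact: cvg_at_right_filter.
  by move=> r tr; rewrite h// subrr.
split.
- move=> i; have := right (fun w => alphap w i) 0 (continuous_alphap (k := i)).
  by rewrite mul0r addr0; apply => r /hr[-> _ _ _]; rewrite mul0r addr0.
- move=> i; have := right (fun w => alpham w i) 0 (continuous_alpham (k := i)).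
  by rewrite mul0r addr0; apply => r /hr[_ -> _ _]; rewrite mul0r addr0.
- have := right (@gamma1 R) 0 (@continuous_gamma1 R).
  by rewrite mul0r addr0; apply => r /hr[_ _ -> _]; rewrite mul0r addr0.
- have := right (@delta R) 1 (@continuous_delta R).
  by rewrite mul1r; apply => r /hr[_ _ _ ->]; rewrite mul1r.
Qed.
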